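(* Let $b\ge2$, $D\ge1$ be integers, let $0<p,q\le\infty$ and $\alpha>0$, and let $S\subset L^p([0,1))$ be a finite-dimensional subspace that is closed under $b$-adic dilation. Then the classes $\mathcal F^\alpha_q(L^p)$ and $\mathcal S^\alpha_q(L^p)$ (equipped with their quasi-norms $\|\cdot\|_{A^\alpha_q}$) are (quasi-)Banach spaces satisfying the continuous embeddings $$\mathcal F^\alpha_q(L^p)\hookrightarrow\mathcal S^\alpha_q(L^p)\hookrightarrow\mathcal F^{\alpha/2}_q(L^p).$$
   Context: $L^p$ means $L^p([0,1)^D)$, $I_b=\{0,\ldots,b-1\}$. $S$ is closed under $b$-adic dilation if $f(b^{-1}(\cdot+k))\in S$ for all $f\in S$, $k\in\{0,\ldots,b-1\}$. Tensorization. For $L\ge0$ let $t_{b,L}(i_1,\ldots,i_L,\bar x)=b^{-L}\big(\sum_{k=1}^L i_kb^{L-k}+\bar x\big)$ for $i_k\in I_b$, $\bar x\in[0,1)$, and $t^D_{b,L}(i_1^1,\ldots,i_D^1,\ldots,i_1^L,\ldots,i_D^L,\bar x_1,\ldots,\bar x_D)=(t_{b,L}(i_1^1,\ldots,i_1^L,\bar x_1),\ldots,t_{b,L}(i_D^1,\ldots,i_D^L,\bar x_D))$; set $T^D_{b,L}f=f\circ t^D_{b,L}$. Let $V^D_{b,S}$ be the set of functions $f$ on $[0,1)^D$ such that for some $L\ge 0$, $T^D_{b,L}f\in\mathbb R^{I_b^{LD}}\otimes S^{\otimes D}$. Tensor trains. Fix a basis $\varphi_1,\ldots,\varphi_{\dim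 S}$ of $S$. For $L\ge0$ and $\boldsymbol r=(r_\nu)_{\nu=1}^{(L+1)D-1}$ with $r_\nu\in\mathbb N_{\ge0}$ and the convention $r_0=r_{(L+1)D}=1$, let $\mathcal P_{b,L,S,\boldsymbol r}$ be the set of tuples $\boldsymbol U=(U_1,\ldots,U_{(L+1)D})$ with $U_\nu\in\mathbb R^{r_{\nu-1}\times b\times r_\nu}$ for $1\le\nu\le LD$ and $U_\nu\in\mathbb R^{r_{\nu-1}\times\dim S\times r_\nu}$ for $LD<\nu\le(L+1)D$. The function $f=\mathcal R_{b,L,S,\boldsymbol r}(\boldsymbol U)$ on $[0,1)^D$ is defined by $$(T^D_{b,L}f)(i_1,\ldots,i_{LD},\bar x_1,\ldots,\bar x_D)=\sum_{k_1,\ldots,k_{(L+1)D-1}}\ \sum_{n_1,\ldots,n_D=1}^{\dim S}\ \prod_{\nu=1}^{LD}U_\nu(k_{\nu-1},i_\nu,k_\nu)\prod_{\nu=1}^{D}U_{LD+\nu}(k_{LD+\nu-1},n_\nu,k_{LD+\nu})\,\varphi_{n_\nu}(\bar x_\nu),$$ where $(i_1,\ldots,i_{LD})=(i_1^1,\ldots,i_D^1,\ldots,i_1^L,\ldots,i_D^L)$, $k_\nu$ runs over $1,\ldots,r_\nu$, $k_0=k_{(L+1)D}=1$, and empty sums are zero. Complexities. $\mathrm{compl}_{\mathcal F}(\boldsymbol U)$ is the total number of entries of $U_1,\ldots,U_{(L+1)D}$; $\mathrm{compl}_{\mathcal S}(\boldsymbol U):=\sum_{\nu=1}^{(L+1)D}\|U_\nu\|_{\ell^0}$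 is the total number of non-zero entries. For $\varphi\in V^D_{b,S}$, $\mathrm{compl}_{\mathcal F}(\varphi)$ is the minimum of $\mathrm{compl}_{\mathcal F}(\boldsymbol U)$ over all $L\ge0$, $\boldsymbol r$ and $\boldsymbol U\in\mathcal P_{b,L,S,\boldsymbol r}$ with $\mathcal R_{b,L,S,\boldsymbol r}(\boldsymbol U)=\varphi$; analogously $\mathrm{compl}_{\mathcal S}(\varphi)$. Set $\Phi^{\mathcal F}_n:=\{\varphi\in V^D_{b,S}:\mathrm{compl}_{\mathcal F}(\varphi)\le n\}$ and $\Phi^{\mathcal S}_n:=\{\varphi\in V^D_{b,S}:\mathrm{compl}_{\mathcal S}(\varphi)\le n\}$, $n\in\mathbb N_{\ge0}$. Approximation classes. For $\Phi=(\Phi_n)_{n\ge0}$ let $E_n(f)=\inf_{\varphi\in\Phi_n}\|f-\varphi\|_{L^p}$ and $\|f\|_{A^\alpha_q}=\big(\sum_{n\ge1}[n^\alpha E_{n-1}(f)]^q\frac1n\big)^{1/q}$ for $q<\infty$, $\|f\|_{A^\alpha_\infty}=\sup_{n\ge1}n^\alpha E_{n-1}(f)$; $A^\alpha_q(L^p,\Phi)=\{f\in L^p:\|f\|_{A^\alpha_q}<\infty\}$. Then $\mathcal F^\alpha_q(L^p):=A^\alpha_q(L^p,\Phi^{\mathcal F})$ and $\mathcal S^\alpha_q(L^p):=A^\alpha_q(L^p,\Phi^{\mathcal S})$. *)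

(* Defs.v *)
From HB Require Import structures.
From mathcomp Require Import all_boot all_order all_algebra.
From mathcomp Require Import all_classical all_reals.
From mathcomp Require Import ereal topology normedtype sequences exp measure.
From mathcomp Require Import measurable_realfun lebesgue_measure.
From mathcomp Require Import lebesgue_integral hoelder probability.

Set Implicit Arguments.
Unset Strict Implicit.
Unset Printing Implicit Defensive.
Import Order.TTheory GRing.Theory Num.Theory.
Import numFieldNormedType.Exports.

Local Open Scope classical_set_scope.
Local Open Scope ring_scope.

Section L0.
Context d (T : measurableType d) (R : realType).
Variable mu : {measure set T -> \bar R}.
Local Open Scope quotient_scope.

(* The library's [Lspace] requires [1 <= p]; here p ranges over ]0, +oo], so
   the L^p spaces are carved out of the vector space of all classes. *)
Definition L0 : Type := {mfun_ mu, T >-> R}.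
HB.instance Definition _ := Choice.on L0.

Definition L0_class (f : {mfun T >-> R}) : L0 := \pi_({mfun_ mu, T >-> R}) f.
Definition L0_repr (f : L0) : {mfun T >-> R} := repr f.
Definition L0_fun (f : L0) : T -> R := L0_repr f.
Coercion L0_fun : L0 >-> Funclass.

Lemma L0_eqP (f g : L0) : (f : T -> R) = g %[ae mu] -> f = g.
Proof.
move=> fg; rewrite -[f]reprK -[g]reprK; apply/eqP; rewrite eqmodE.
exact/asboolP.
Qed.

Lemma L0_classK (f : {mfun T >-> R}) : (L0_class f : T -> R) = f %[ae mu].
Proof.
suff : ae_eq_op mu (L0_repr (L0_class f)) f by move=> /asboolP.
by rewrite -eqmodE /L0_repr reprK.
Qed.

Definition L0_zero : L0 := L0_class 0.
Definition L0_opp (f : L0) : L0 := L0_class (- L0_repr f).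
Definition L0_add (f g : L0) : L0 := L0_class (L0_repr f + L0_repr g).
Definition L0_scale (a : R) (f : L0) : L0 := L0_class (a *: L0_repr f).

Lemma L0_zeroE : \forall x \ae mu, L0_zero x = 0.
Proof. by have := L0_classK 0; apply: filterS => x /(_ I). Qed.

Lemma L0_oppE f : \forall x \ae mu, L0_opp f x = - f x.
Proof. by have := L0_classK (- L0_repr f); apply: filterS => x /(_ I). Qed.

Lemma L0_addE f g : \forall x \ae mu, L0_add f g x = f x + g x.
Proof. by have := L0_classK (L0_repr f + L0_repr g); apply: filterS => x /(_ I). Qed.

Lemma L0_scaleE a f : \forall x \ae mu, L0_scale a f x = a * f x.
Proof. by have := L0_classK (a *: L0_repr f); apply: filterS => x /(_ I). Qed.

Let addA : associative L0_add.
Proof.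
move=> f g h; apply: L0_eqP.
near=> x => _.
have -> : L0_add f (L0_add g h) x = f x + L0_add g h x
  by near: x; exact: L0_addE.
have -> : L0_add g h x = g x + h x by near: x; exact: L0_addE.
have -> : L0_add (L0_add f g) h x = L0_add f g x + h x
  by near: x; exact: L0_addE.
have -> : L0_add f g x = f x + g x by near: x; exact: L0_addE.
by rewrite addrA.
Unshelve. all: by end_near. Qed.

Let addC : commutative L0_add.
Proof. by move=> f g; rewrite /L0_add addrC. Qed.

Let add0 : left_id L0_zero L0_add.
Proof.
move=> f; apply: L0_eqP; near=> x => _.
have -> : L0_add L0_zero f x = L0_zero x + f x by near: x; exact: L0_addE.
have -> : L0_zero x = 0 by near: x; exact: L0_zeroE.
by rewrite add0r.
Unshelve. all: by end_near. Qed.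

Let addN : left_inverse L0_zero L0_opp L0_add.
Proof.
move=> f; apply: L0_eqP; near=> x => _.
have -> : L0_add (L0_opp f) f x = L0_opp f x + f x by near: x; exact: L0_addE.
have -> : L0_opp f x = - f x by near: x; exact: L0_oppE.
have -> : L0_zero x = 0 by near: x; exact: L0_zeroE.
by rewrite addNr.
Unshelve. all: by end_near. Qed.

HB.instance Definition _ := GRing.isZmodule.Build L0 addA addC add0 addN.

Let scaleA a b f : L0_scale a (L0_scale b f) = L0_scale (a * b) f.
Proof.
apply: L0_eqP; near=> x => _.
have -> : L0_scale a (L0_scale b f) x = a * L0_scale b f x
  by near: x; exact: L0_scaleE.
have -> : L0_scale b f x = b * f x by near: x; exact: L0_scaleE.
have -> : L0_scale (a * b) f x = a * b * f x by near: x; exact: L0_scaleE.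
by rewrite mulrA.
Unshelve. all: by end_near. Qed.

Let scale1 : left_id 1 L0_scale.
Proof. by move=> f; rewrite /L0_scale scale1r /L0_class reprK. Qed.

Let scaleDr : right_distributive L0_scale +%R.
Proof.
move=> a f g; apply: L0_eqP; near=> x => _.
have -> : L0_scale a (f + g) x = a * (f + g : L0) x by near: x; exact: L0_scaleE.
have -> : (f + g : L0) x = f x + g x by near: x; exact: L0_addE.
have -> : (L0_scale a f + L0_scale a g : L0) x = L0_scale a f x + L0_scale a g x
  by near: x; exact: L0_addE.
have -> : L0_scale a f x = a * f x by near: x; exact: L0_scaleE.
have -> : L0_scale a g x = a * g x by near: x; exact: L0_scaleE.
by rewrite mulrDr.
Unshelve. all: by end_near. Qed.

Let scaleDl f : {morph L0_scale^~ f : a b / a + b}.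
Proof.
move=> a b; apply: L0_eqP; near=> x => _.
have -> : L0_scale (a + b) f x = (a + b) * f x by near: x; exact: L0_scaleE.
have -> : (L0_scale a f + L0_scale b f : L0) x = L0_scale a f x + L0_scale b f x
  by near: x; exact: L0_addE.
have -> : L0_scale a f x = a * f x by near: x; exact: L0_scaleE.
have -> : L0_scale b f x = b * f x by near: x; exact: L0_scaleE.
by rewrite mulrDl.
Unshelve. all: by end_near. Qed.

HB.instance Definition _ :=
  GRing.Zmodule_isLmodule.Build R L0 scaleA scale1 scaleDr scaleDl.

Definition Lp (p : \bar R) : set L0 := [set f | finite_norm mu p f].

Definition Lpnorm (p : \bar R) (f : L0) : \bar R := 'N[mu]_p[EFin \o f]%E.

End L0.
Arguments Lp {d T R} mu p.
Arguments Lpnorm {d T R} mu p f.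

Section cube.
Variable R : realType.

Local Notation TR := (measurableTypeR R).

Lemma measurable_unit_itv : measurable (`[0, 1[ : set TR).
Proof. exact: measurable_itv. Qed.

(* Functions on [0,1)^D are represented by functions on all of R^D, and the
   measure ignores what happens outside of the cube. *)
Definition leb01 : set TR -> \bar R :=
  mrestr (@lebesgue_measure R) measurable_unit_itv.

HB.instance Definition _ := Measure.on leb01.

Lemma leb01_setT : leb01 setT = 1%E.
Proof.
by rewrite /leb01 /mrestr setTI lebesgue_measure_itv /= lte_fin ltr01 oppr0 adde0.
Qed.

HB.instance Definition _ := Measure_isProbability.Build _ _ _ leb01 leb01_setT.

Definition tcons n (z : TR * n.-tuple TR) : n.+1.-tuple TR := [tuple of z.1 :: z.2].

Lemma measurable_tcons n : measurable_fun setT (@tcons n).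
Proof. by apply: measurable_cons. Qed.

HB.instance Definition _ n :=
  isMeasurableFun.Build _ _ _ _ (@tcons n) (@measurable_tcons n).

Section prod.
Context d1 d2 (T1 : measurableType d1) (T2 : measurableType d2).
Variables (P : probability T1 R) (Q : probability T2 R).
Definition prod_prob : set (T1 * T2) -> \bar R := (P \x Q)%E.
HB.instance Definition _ := Measure.on prod_prob.
Let prod_prob_setT : prod_prob setT = 1%E.
Proof.
rewrite /prod_prob -setXTT product_measure1E//.
exact: etrans (congr2 mule (probability_setT P) (probability_setT Q)) (mule1 _).
Qed.
HB.instance Definition _ :=
  Measure_isProbability.Build _ _ _ prod_prob prod_prob_setT.
End prod.

Fixpoint cube (D : nat) : probability (D.-tuple TR) R :=
  match D with
  | 0 => dirac [tuple]
  | n.+1 => distribution (prod_prob leb01 (cube n)) (@tcons n)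
  end.

End cube.
Arguments leb01 : clear implicits.
Arguments cube : clear implicits.

Section quasi_banach.
Context (R : realType) (E : lmodType R).
Implicit Types (A B : set E) (N M : E -> \bar R).

Record is_quasinorm A N : Prop := IsQuasinorm {
  quasinorm_fin : forall f, A f -> (0 <= N f < +oo)%E ;
  quasinorm_eq0 : forall f, A f -> N f = 0%E -> f = 0 ;
  quasinormZ : forall (a : R) f, A f -> N (a *: f) = (`|a|%:E * N f)%E ;
  quasinormD : exists C : R, forall f g, A f -> A g ->
    (N (f + g)%R <= C%:E * (N f + N g))%E
}.

Definition quasinorm_complete A N : Prop := forall u : nat -> E,
  (forall n, A (u n)) ->
  (forall e : R, 0 < e -> exists n0, forall m n, (n0 <= m)%N -> (n0 <= n)%N ->
    (N (u m - u n)%R < e%:E)%E) ->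
  exists2 f, A f & N (u n - f) @[n --> \oo] --> (0%E : \bar R).

Definition quasi_banach A N : Prop :=
  [/\ submod_closed (mem A), is_quasinorm A N & quasinorm_complete A N].

Definition continuous_embedding A N B M : Prop :=
  A `<=` B /\ exists C : R, forall f, A f -> (M f <= C%:E * N f)%E.

Section approx.
Variables (X : set E) (N : E -> \bar R) (Phi : nat -> set E).

Definition best_error (n : nat) (f : E) : \bar R :=
  ereal_inf [set N (f - phi) | phi in Phi n].

Definition approx_norm (alpha : R) (q : \bar R) (f : E) : \bar R :=
  (match q with
  | r%:E => (\sum_(1 <= n <oo)
      ((n%:R `^ alpha)%:E * best_error n.-1 f) `^ r * (n%:R^-1)%R%:E) `^ r^-1%R
  | +oo => ereal_sup [set (n%:R `^ alpha)%:E * best_error n.-1 f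
                       | n in [set n | (0 < n)%N]]
  | -oo => 0
  end)%E.

Definition approx_class (alpha : R) (q : \bar R) : set E :=
  X `&` [set f | (approx_norm alpha q f < +oo)%E].

End approx.
End quasi_banach.

Section tensor.
Context (R : realType).
Local Notation TR := (measurableTypeR R).
Local Notation L1 := (L0 (leb01 R)).
Local Notation LD D := (L0 (cube R D)).

Definition is_basis (S : set L1) (d : nat) (phi : 'I_d -> L1) : Prop :=
  (forall f, S f <-> exists c : 'I_d -> R, f = \sum_i c i *: phi i) /\
  (forall c : 'I_d -> R, \sum_i c i *: phi i = 0 -> forall i, c i = 0).

Definition dilation_closed (b : nat) (S : set L1) : Prop :=
  forall f (k : 'I_b), S f ->
    exists2 g, S g & \forall x \ae leb01 R, g x = f (b%:R^-1 * (x + k%:R)).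

Section fixed_dims.
Variables b D : nat.

Definition tmap1 (L : nat) (i : 'I_L -> 'I_b) (x : R) : R :=
  b%:R ^- L * (\sum_(k < L) (i k)%:R * b%:R ^+ (L - k.+1) + x).

Lemma flat_subproof L (l : 'I_L) (j : 'I_D) : (l * D + j < L * D)%N.
Proof.
have lL := ltn_ord l; have jD := ltn_ord j.
by apply: (@leq_trans (l.+1 * D)); rewrite ?leq_mul2r ?lL ?orbT// mulSn addnC ltn_add2r.
Qed.

(* Digits are listed level by level: i_1^1, ..., i_D^1, i_1^2, ..., i_D^L. *)
Definition flat L (l : 'I_L) (j : 'I_D) : 'I_(L * D) :=
  Ordinal (flat_subproof l j).

Definition digits L := {ffun 'I_(L * D) -> 'I_b}.

Definition tmap L (i : digits L) (x : D.-tuple TR) : D.-tuple TR :=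
  [tuple tmap1 (fun l => i (flat l j)) (tnth x j) | j < D].

Definition tensorize L (f : LD D) (i : digits L) (x : D.-tuple TR) : R :=
  f (tmap i x).

(* The algebraic tensor product of R^(I_b^(LD)) with D copies of S: finite sums
   of elementary tensors, as classes in the continuous variables. *)
Definition tensor_space (S : set L1) L (g : digits L -> D.-tuple TR -> R) :
    Prop :=
  exists (M : nat) (c : 'I_M -> digits L -> R) (s : 'I_M -> 'I_D -> L1),
    (forall m j, S (s m j)) /\
    forall i, \forall x \ae cube R D,
      g i x = \sum_(m < M) c m i * \prod_(j < D) s m j (tnth x j).

Definition V_bS (S : set L1) : set (LD D) :=
  [set f | exists L, tensor_space S (@tensorize L f)].

Section tensor_train.
Variable d : nat.
Variable phi : 'I_d -> L1.

Definition tt_ranks L (r : nat -> nat) : Prop :=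
  r 0%N = 1%N /\ r (L.+1 * D)%N = 1%N.

(* Only the values r 0, ..., r ((L + 1) D) matter. *)
Record ttrain (L : nat) (r : nat -> nat) := TTrain {
  tt_digit : forall v : 'I_(L * D), 'I_(r v) -> 'I_b -> 'I_(r v.+1) -> R ;
  tt_var : forall v : 'I_D,
    'I_(r (L * D + v)%N) -> 'I_d -> 'I_(r (L * D + v)%N.+1) -> R
}.

Arguments tt_digit {L r} U v : rename.
Arguments tt_var {L r} U v : rename.

Lemma tt_digit_subproof L (v : 'I_(L * D)) : (v.+1 < (L.+1 * D).+1)%N.
Proof. by rewrite ltnS mulSn (leq_trans (ltn_ord v))// leq_addl. Qed.

Lemma tt_var_subproof L (v : 'I_D) : ((L * D + v).+1 < (L.+1 * D).+1)%N.
Proof. by rewrite ltnS mulSn addnC ltn_add2r. Qed.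

Definition tt_eval L r (U : ttrain L r) (i : digits L) (x : D.-tuple TR) : R :=
  \sum_(k : {dffun forall v : 'I_(L.+1 * D).+1, 'I_(r v)})
  \sum_(n : {ffun 'I_D -> 'I_d})
    (\prod_(v < L * D)
       tt_digit U v (k (Ordinal (ltnW (tt_digit_subproof v)))) (i v)
                  (k (Ordinal (tt_digit_subproof v)))) *
    \prod_(v < D)
      (tt_var U v (k (Ordinal (ltnW (tt_var_subproof L v)))) (n v)
                (k (Ordinal (tt_var_subproof L v))) *
       phi (n v) (tnth x v)).

Definition tt_represents L r (U : ttrain L r) (f : LD D) : Prop :=
  forall i, \forall x \ae cube R D, tensorize f i x = tt_eval U i x.

Definition tt_complF L r (U : ttrain L r) : nat :=
  (\sum_(v < L * D) #|{: 'I_(r v) * 'I_b * 'I_(r v.+1)}| +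
   \sum_(v < D) #|{: 'I_(r (L * D + v)%N) * 'I_d * 'I_(r (L * D + v)%N.+1)}|)%N.

Definition tt_complS L r (U : ttrain L r) : nat :=
  (\sum_(v < L * D) #|[set e : 'I_(r v) * 'I_b * 'I_(r v.+1) |
                       tt_digit U v e.1.1 e.1.2 e.2 != 0%R]%SET| +
   \sum_(v < D)
     #|[set e : 'I_(r (L * D + v)%N) * 'I_d * 'I_(r (L * D + v)%N.+1) |
        tt_var U v e.1.1 e.1.2 e.2 != 0%R]%SET|)%N.

(* An infimum of natural numbers, hence a minimum as soon as f is
   representable (and +oo otherwise). *)
Definition compl (c : forall L r, ttrain L r -> nat) (f : LD D) : \bar R :=
  ereal_inf [set y | exists L r (U : ttrain L r),
    [/\ tt_ranks L r, tt_represents U f & y = (c L r U)%:R%:E]].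

Definition Phi_compl (c : forall L r, ttrain L r -> nat) (S : set L1) (n : nat) :
    set (LD D) :=
  [set f | V_bS S f /\ (compl c f <= n%:R%:E)%E].

Definition PhiF := Phi_compl tt_complF.
Definition PhiS := Phi_compl tt_complS.

Definition normF S (p : \bar R) :=
  approx_norm (Lpnorm (cube R D) p) (PhiF S).
Definition normS S (p : \bar R) :=
  approx_norm (Lpnorm (cube R D) p) (PhiS S).

Definition classF S (p : \bar R) :=
  approx_class (Lp (cube R D) p) (Lpnorm (cube R D) p) (PhiF S).
Definition classS S (p : \bar R) :=
  approx_class (Lp (cube R D) p) (Lpnorm (cube R D) p) (PhiS S).

End tensor_train.
End fixed_dims.
End tensor.

Arguments normF {R} b D {d} phi S p alpha q f.
Arguments normS {R} b D {d} phi S p alpha q f.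
Arguments classF {R} b D {d} phi S p alpha q.
Arguments classS {R} b D {d} phi S p alpha q.

(* Main.v *)
Require Import Defs.
From HB Require Import structures.
From mathcomp Require Import all_boot all_order all_algebra.
From mathcomp Require Import all_classical all_reals.
From mathcomp Require Import ereal topology normedtype sequences derive exp measure
  numfun.
From mathcomp Require Import measurable_realfun lebesgue_measure.
From mathcomp Require Import lebesgue_integral ess_sup_inf hoelder probability.
From mathcomp Require Import ring lra zify.

(* The classes are approximation spaces of families Phi_n with Phi_0 = {0},
   closed under scaling and with Phi_n + Phi_n in Phi_(c n); for such families
   the quasi-norm axioms and completeness follow from those of L^p by grouping
   n into blocks of length c, and Phi^S_n in Phi^F_(c n^2) gives the second
   embedding by grouping into the blocks between c n^2 and c (n + 1)^2.

   A tensor train is a layered weighted automaton reading the digits and the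
   indices of basis functions.  Two functions are added by first bringing them
   to the same level: dilation invariance refines a train at constant cost per
   new core, and the number of cores of a non-zero function is bounded by its
   complexity.  Then the direct sum of the automata is taken; for the dense
   complexity the ranks are first reduced so that neighbouring ranks are
   comparable.  Deleting the unreachable states of a sparse train leaves ranks
   bounded by numbers of non-zero entries, whence the square.

   The cube with its measure is self-similar, so null sets correspond under the
   digit maps; this makes tensorization well defined on classes and shows that
   a function with vanishing coefficients is zero. *)

Set Implicit Arguments.
Unset Strict Implicit.
Unset Printing Implicit Defensive.
Import Order.TTheory GRing.Theory Num.Theory.
Import numFieldNormedType.Exports.

Local Open Scope classical_set_scope.
Local Open Scope ring_scope.

(** * Weighted sequence norms *)

(** The number of levels is controlled through non-vanishing: a non-zero function has a word of
    non-zero value, a core without non-zero entries would kill every value, and so (L + 1) D is at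
    most the number of non-zero entries. The zero function escapes this bound at every level and is
    split off wherever it can occur; its dense cost is 0 because inner ranks may be 0. Once the
    number of cores is at most n, moving the coarser summand to the finer level is paid for by n, as
    each new core has boundedly many entries. In the dense direct sum the ranks of one summand meet
    neighbouring ranks of the other. These cross terms are at most sums of squares of ranks, and a
    train can charge squares to its own cost only if neighbouring ranks are comparable. Since p and
    q may be below 1, all triangle inequalities carry a constant. Arguments that would sum
    infinitely many of them are replaced by almost-everywhere limits with Fatou in L^p, and by
    truncation of the error sequence in the classes. *)

Section extended_reals.
Context {R : realType}.
Implicit Types x y : \bar R.
Local Open Scope ereal_scope.

Lemma lee_poweR (r : R) x y : (0 <= r)%R -> 0 <= x -> x <= y -> x `^ r <= y `^ r.
Proof.
move=> r0 x0 xy; apply: gt0_ler_poweR => //; rewrite in_itv /= leey andbT //.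
exact: le_trans xy.
Qed.

Lemma poweRK (r : R) x : (0 < r)%R -> 0 <= x -> (x `^ r) `^ r^-1 = x.
Proof. by move=> r0 x0; rewrite -poweRrM mulfV ?gt_eqF// poweRe1. Qed.

Lemma poweRVK (r : R) x : (0 < r)%R -> 0 <= x -> (x `^ r^-1) `^ r = x.
Proof. by move=> r0 x0; rewrite -poweRrM mulVf ?gt_eqF// poweRe1. Qed.

Lemma poweRV_le (r : R) x y : (0 < r)%R -> 0 <= x -> 0 <= y ->
  (x `^ r^-1 <= y) = (x <= y `^ r).
Proof.
move=> r0 x0 y0; apply/idP/idP => h.
  by rewrite -(poweRVK r0 x0); apply: lee_poweR => //; [exact: ltW|exact: poweR_ge0].
by rewrite -(poweRK r0 y0); apply: lee_poweR => //; rewrite invr_ge0 ltW.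
Qed.

(** The sum is at most twice the larger summand. The crude constant is the price for covering
    exponents on both sides of 1 at once. *)
Lemma poweRD_le (r : R) x y : (0 <= r)%R -> 0 <= x -> 0 <= y ->
  (x + y) `^ r <= (2 `^ r)%R%:E * (x `^ r + y `^ r).
Proof.
move=> r0; wlog xy : x y / x <= y => [hw x0 y0|x0 y0].
  have [xy|/ltW yx] := leP x y; first exact: hw.
  by rewrite addeC [X in _ <= _ * X]addeC; exact: hw.
have : x + y <= 2%:E * y by rewrite mule_natl mule2n leeD2r.
move=> /(lee_poweR r0 (adde_ge0 x0 y0))/le_trans; apply.
rewrite poweRM ?lee_fin// poweR_EFin lee_wpmul2l ?lee_fin ?powR_ge0//.
by rewrite leeDr// poweR_ge0.
Qed.

Lemma sume_const_nat (m n : nat) x :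
  \sum_(m <= i < n) x = ((n - m)%:R)%:E * x.
Proof.
transitivity (\sum_(m <= i < n) 1%:E * x); first by apply: eq_bigr => i _; rewrite mul1e.
by rewrite -ge0_sume_distrl// sumEFin sumr_const_nat.
Qed.

Lemma nneseries_leP (u : nat -> \bar R) m x : (forall n, 0 <= u n) ->
  (\sum_(m <= n <oo) u n <= x) <-> forall M, \sum_(m <= n < M) u n <= x.
Proof.
move=> u0; split=> [h M|h].
  by apply: le_trans h; apply: nneseries_lim_ge => *; exact: u0.
apply: lime_le; first by apply: is_cvg_nneseries => *; exact: u0.
exact: nearW.
Qed.

End extended_reals.

Section weighted_sequence_norm.
Context {R : realType}.
Implicit Types (e : nat -> \bar R) (alpha : R) (q : \bar R).
Local Open Scope ereal_scope.

(* [approx_norm] is this functional applied to the sequence of best errors. *)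
Definition seq_norm alpha q e : \bar R :=
  match q with
  | r%:E => (\sum_(1 <= n <oo)
      ((n%:R `^ alpha)%:E * e n.-1) `^ r * (n%:R^-1)%R%:E) `^ r^-1%R
  | +oo => ereal_sup [set (n%:R `^ alpha)%:E * e n.-1 | n in [set n | (0 < n)%N]]
  | -oo => 0
  end.

Lemma seq_norm_term_ge0 alpha (r : R) e n : (forall n, 0 <= e n) ->
  0 <= ((n%:R `^ alpha)%:E * e n.-1) `^ r * (n%:R^-1)%R%:E.
Proof. by move=> e0; rewrite mule_ge0 ?poweR_ge0// lee_fin invr_ge0. Qed.

(** Reduces bounds on the norm to finite partial sums, so that later estimates do not rearrange
    series. *)
Lemma seq_norm_finP alpha (r : R) e (x : \bar R) : (0 < r)%R -> (forall n, 0 <= e n) ->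
  0 <= x ->
  (seq_norm alpha r%:E e <= x) <-> forall M, \sum_(1 <= n < M)
     ((n%:R `^ alpha)%:E * e n.-1) `^ r * (n%:R^-1)%R%:E <= x `^ r.
Proof.
move=> r0 e0 x0; rewrite /seq_norm poweRV_le//; last first.
  by apply: nneseries_ge0 => n _ _; exact: seq_norm_term_ge0.
by apply: nneseries_leP => n; exact: seq_norm_term_ge0.
Qed.

Lemma seq_norm_inftyP alpha e (x : \bar R) :
  (seq_norm alpha +oo e <= x) <-> forall n, ((n.+1)%:R `^ alpha)%:E * e n <= x.
Proof.
split=> [h n|h]; last by apply: ge_ereal_sup => _ [[//|n] _ <-]; exact: h.
by apply: le_trans h; apply: ereal_sup_ubound; exists n.+1.
Qed.

Lemma seq_norm_ge0 alpha q e : (forall n, 0 <= e n) -> 0 <= seq_norm alpha q e.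
Proof.
move=> e0; case: q => [r| |]//=; first exact: poweR_ge0.
apply: ereal_sup_ge; exists ((1%:R `^ alpha)%:E * e 0%N); first by exists 1%N.
by rewrite mule_ge0 ?lee_fin ?powR_ge0.
Qed.

Lemma seq_norm_fin_ub alpha (r : R) e M : (0 < r)%R -> (forall n, 0 <= e n) ->
  \sum_(1 <= n < M) ((n%:R `^ alpha)%:E * e n.-1) `^ r * (n%:R^-1)%R%:E <=
  seq_norm alpha r%:E e `^ r.
Proof. by move=> r0 e0; move: M; apply/seq_norm_finP => //; exact: seq_norm_ge0. Qed.

Lemma seq_norm_infty_ub alpha e n :
  ((n.+1)%:R `^ alpha)%:E * e n <= seq_norm alpha +oo e.
Proof. by move: n; apply/seq_norm_inftyP. Qed.

Lemma le_seq_norm alpha q e f : 0 < q -> (forall n, 0 <= e n) ->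
  (forall n, e n <= f n) -> seq_norm alpha q e <= seq_norm alpha q f.
Proof.
move=> q0 e0 ef; have f0 n : 0 <= f n by exact: le_trans (ef n).
case: q q0 => [r| |]//; last first.
  move=> _; apply/seq_norm_inftyP => n.
  have := seq_norm_infty_ub alpha f n.
  by apply: le_trans; rewrite lee_wpmul2l ?lee_fin ?powR_ge0.
rewrite lte_fin => r0; apply/seq_norm_finP => //; first exact: seq_norm_ge0.
move=> M; apply: le_trans (seq_norm_fin_ub alpha M r0 f0).
apply: lee_sum => n _; apply: lee_wpmul2r; rewrite ?lee_fin ?invr_ge0//.
apply: lee_poweR; [exact: ltW| |];
  by rewrite ?mule_ge0 ?lee_wpmul2l ?lee_fin ?powR_ge0.
Qed.

Lemma seq_normZ alpha q (a : R) e : 0 < q -> (0 <= a)%R -> (forall n, 0 <= e n) ->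
  seq_norm alpha q (fun n => a%:E * e n) = a%:E * seq_norm alpha q e.
Proof.
move=> q0 a0 e0.
(* This inequality for every factor suffices: the reverse one for [a] is the same statement for the
   factor [a^-1], and a = 0 is direct. *)
have leZ (c : R) f : (0 <= c)%R -> (forall n, 0 <= f n) ->
    seq_norm alpha q (fun n => c%:E * f n) <= c%:E * seq_norm alpha q f.
  move=> c0 f0; have N0 := seq_norm_ge0 alpha q f0.
  case: q q0 N0 => [r| |]// q0 N0; last first.
    apply/seq_norm_inftyP => n; rewrite muleCA lee_wpmul2l//.
    by have := seq_norm_infty_ub alpha f n.
  have r0 : (0 < r)%R by rewrite -lte_fin.
  apply/seq_norm_finP => //; [by move=> n; rewrite mule_ge0|by rewrite mule_ge0|move=> M].
  have h := seq_norm_fin_ub alpha M r0 f0.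
  rewrite poweRM//; apply: le_trans (lee_wpmul2l _ h); rewrite ?poweR_ge0//.
  rewrite ge0_sume_distrr; last by move=> i _; exact: seq_norm_term_ge0.
  apply: lee_sum => n _; by rewrite muleCA [X in X * _]poweRM ?mule_ge0 ?lee_fin
    ?powR_ge0// muleA.
apply/eqP; rewrite eq_le leZ//=.
have [->|an0] := eqVneq a 0%R.
  by rewrite mul0e seq_norm_ge0// => n; rewrite mul0e.
have {an0}a0 : (0 < a)%R by rewrite lt_neqAle eq_sym an0.
rewrite -lee_pdivlMl//; apply: le_trans (leZ _ _ _ _); first last.
- by move=> n; rewrite mule_ge0// lee_fin ltW.
- by rewrite invr_ge0 ltW.
apply: le_seq_norm => // n.
by rewrite muleA -EFinM mulVf ?gt_eqF// mul1e.
Qed.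

Lemma seq_normD alpha q : 0 < q -> exists2 C : R, (0 <= C)%R & forall e f,
  (forall n, 0 <= e n) -> (forall n, 0 <= f n) ->
  seq_norm alpha q (fun n => e n + f n) <=
  C%:E * (seq_norm alpha q e + seq_norm alpha q f).
Proof.
case: q => [r| |] // q0; last first.
  exists 1%R => // e f e0 f0; rewrite mul1e; apply/seq_norm_inftyP => n.
  rewrite ge0_muleDr//; apply: leeD.
    by have := seq_norm_infty_ub alpha e n.
  by have := seq_norm_infty_ub alpha f n.
have r0 : (0 < r)%R by rewrite -lte_fin.
have ri0 : (0 <= r^-1)%R by rewrite invr_ge0 ltW.
(* Splitting the r-th power of each term costs 2^r, which the root turns into 2; splitting the root
   of the two series costs 2^(1/r). *)
exists (2 * 2 `^ r^-1)%R => [|e f e0 f0]; first by rewrite mulr_ge0 ?powR_ge0.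
have ef0 n : 0 <= e n + f n by rewrite adde_ge0.
set A := \sum_(1 <= n <oo) ((n%:R `^ alpha)%:E * e n.-1) `^ r * (n%:R^-1)%R%:E.
set B := \sum_(1 <= n <oo) ((n%:R `^ alpha)%:E * f n.-1) `^ r * (n%:R^-1)%R%:E.
have A0 : 0 <= A by apply: nneseries_ge0 => n _ _; exact: seq_norm_term_ge0.
have B0 : 0 <= B by apply: nneseries_ge0 => n _ _; exact: seq_norm_term_ge0.
rewrite -[seq_norm _ _ e]/(A `^ r^-1) -[seq_norm _ _ f]/(B `^ r^-1).
have AB : (A + B) `^ r^-1 <= (2 `^ r^-1)%R%:E * (A `^ r^-1 + B `^ r^-1) by exact:
  poweRD_le.
rewrite EFinM -muleA; apply: le_trans (lee_wpmul2l _ AB); last by rewrite lee_fin.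
apply/seq_norm_finP => //; first by rewrite mule_ge0 ?poweR_ge0 ?lee_fin.
move=> M; rewrite poweRM ?poweR_ge0 ?lee_fin// poweRVK ?adde_ge0// poweR_EFin.
apply: (@le_trans _ _ ((2 `^ r)%:E * (\sum_(1 <= n < M)
    ((n%:R `^ alpha)%:E * e n.-1) `^ r * (n%:R^-1)%R%:E + \sum_(1 <= n < M)
    ((n%:R `^ alpha)%:E * f n.-1) `^ r * (n%:R^-1)%R%:E))).
  rewrite -big_split/= ge0_sume_distrr; last first.
    by move=> i _; rewrite adde_ge0 ?seq_norm_term_ge0.
  apply: lee_sum => n _; rewrite -ge0_muleDl ?poweR_ge0// muleA.
  rewrite lee_wpmul2r ?lee_fin ?invr_ge0// (ge0_muleDr _ (e0 _) (f0 _)).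
  by apply: poweRD_le; [exact: ltW| |]; rewrite ?mule_ge0 ?lee_fin ?powR_ge0.
rewrite lee_wpmul2l ?lee_fin ?powR_ge0// leeD//.
  by apply: nneseries_lim_ge => n _ _; exact: seq_norm_term_ge0.
by apply: nneseries_lim_ge => n _ _; exact: seq_norm_term_ge0.
Qed.

(** The term n = 1 has weight 1. As the best error at 0 is the norm itself, this makes the classes
    embed into the ambient space. *)
Lemma seq_norm_ge_head alpha q e : 0 < q -> (forall n, 0 <= e n) ->
  e 0%N <= seq_norm alpha q e.
Proof.
case: q => [r| |]// q0 e0; last first.
  have := seq_norm_infty_ub alpha e 0%N.
  by rewrite powR1 mul1e.
have r0 : (0 < r)%R by rewrite -lte_fin.
have := seq_norm_fin_ub alpha 2 r0 e0.
rewrite big_nat1 powR1 mul1e invr1 mule1 /= => h.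
rewrite -(poweRK r0 (e0 0%N)) poweRV_le ?poweR_ge0 ?seq_norm_ge0//.
Qed.

(** In the completeness proof an auxiliary index can be chosen after the truncation length, so an
    error that is merely constant in n does no harm. *)
Lemma seq_norm_trunc alpha q e (x : \bar R) : 0 < q -> (forall n, 0 <= e n) -> 0 <= x ->
  (forall N, seq_norm alpha q (fun n => if (n < N)%N then e n else 0) <= x) ->
  seq_norm alpha q e <= x.
Proof.
case: q => [r| |]// q0 e0 x0 h; last first.
  by apply/seq_norm_inftyP => n; have /seq_norm_inftyP/(_ n) := h n.+1; rewrite ltnSn.
have r0 : (0 < r)%R by rewrite -lte_fin.
apply/seq_norm_finP => // M; have e'0 n : 0 <= (if (n < M)%N then e n else 0) by case:
  ifP.
apply: le_trans (iffLR (seq_norm_finP alpha r0 e'0 x0) (h M) M).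
rewrite le_eqVlt; apply/orP; left; apply/eqP; apply: eq_big_nat => -[//|n] /andP[_ nM].
by rewrite /= ltnW.
Qed.

Lemma seq_norm_trunc1_lty alpha q N : 0 < q ->
  seq_norm alpha q (fun n => if (n < N)%N then 1 else 0) < +oo.
Proof.
pose u n : \bar R := if (n < N)%N then 1 else 0.
have u0 n : 0 <= u n by rewrite /u; case: ifP.
case: q => [r| |] // q0; last first.
  suff [x hx] : exists x : R, forall n, ((n.+1)%:R `^ alpha)%:E * u n <= x%:E.
    by apply: (@le_lt_trans _ _ x%:E); [exact/seq_norm_inftyP|exact: ltry].
  exists (\sum_(n < N) ((n.+1)%:R `^ alpha))%R => n; rewrite /u.
  case: ifP => nN; last by rewrite mule0 lee_fin sumr_ge0.
  rewrite mule1 lee_fin (bigD1 (Ordinal nN))//= lerDl sumr_ge0//.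
have r0 : (0 < r)%R by rewrite -lte_fin.
rewrite /seq_norm; apply: poweR_lty.
have : \sum_(1 <= n <oo) ((n%:R `^ alpha)%:E * u n.-1) `^ r * (n%:R^-1)%R%:E <=
    \sum_(1 <= n < N.+1) ((n%:R `^ alpha)%:E * u n.-1) `^ r * (n%:R^-1)%R%:E.
  apply/nneseries_leP => [n|M]; first exact: seq_norm_term_ge0.
  have [MN|/ltnW NM] := leqP M N.+1.
    have [M1|/ltnW M1] := leqP 1 M; last first.
      by rewrite big_geq// sume_ge0// => *; exact: seq_norm_term_ge0.
    rewrite [leRHS](big_cat_nat (n := M))//=.
    by rewrite leeDl// sume_ge0// => *; exact: seq_norm_term_ge0.
  rewrite (big_cat_nat (n := N.+1))//= [X in _ + X]big1_seq ?adde0// => n.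
  rewrite mem_index_iota => /and3P[_]; case: n => [//|n] Nn _ /=.
  by rewrite /u ltnNge; move: Nn; rewrite ltnS => ->;
    rewrite /= mulr0 powR0 ?gt_eqF// mul0e.
move=> /le_lt_trans; apply; rewrite ltey_eq; apply/orP; left.
rewrite sum_fin_num; apply/allP => _ /mapP[n _ ->].
apply: fin_numM => //; apply: fin_num_poweR; apply: fin_numM => //.
by rewrite /u; case: ifP.
Qed.

(* Condensation: on the block [g n, g n.+1) the sequence [e'] is at most [e n]. *)
Lemma seq_norm_block alpha beta q (g : nat -> nat) (c1 c2 : R) : 0 < q ->
  {homo g : m n / (m < n)%N} -> g 0%N = 0%N -> (0 <= beta)%R -> (0 <= c1)%R ->
  (forall n, (g n.+1)%:R `^ beta <= c1 * n.+1%:R `^ alpha)%R ->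
  (forall n, (g n.+1 - g n)%:R * n.+1%:R <= c2 * (g n).+1%:R)%R ->
  exists2 C : R, (0 <= C)%R & forall e e', (forall n, 0 <= e n) ->
    (forall n, 0 <= e' n) ->
    (forall n m, (g n <= m)%N -> e' m <= e n) ->
    seq_norm beta q e' <= C%:E * seq_norm alpha q e.
Proof.
move=> q0 gmono g00 beta0 c10 hc1 hc2.
have gleq m n : (m <= n)%N -> (g m <= g n)%N by move=> mn; exact: (ltnW_homo gmono).
have gid n : (n <= g n)%N.
  by elim: n => // n IH; rewrite (leq_ltn_trans IH)// gmono.
have c20 : (0 <= c2)%R.
  have := hc2 0%N; rewrite g00 subn0 !mulr1; apply: le_trans; exact: ler0n.
have term (e e' : nat -> \bar R) n m : (forall n, 0 <= e n) -> (forall n, 0 <= e' n) ->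
    (forall n m, (g n <= m)%N -> e' m <= e n) -> (g n <= m < g n.+1)%N ->
    (m.+1%:R `^ beta)%:E * e' m <= c1%:E * ((n.+1%:R `^ alpha)%:E * e n).
  move=> e0 e'0 h /andP[gm mg]; rewrite muleA -EFinM.
  apply: lee_pmul; rewrite ?lee_fin ?powR_ge0//; last exact: h.
  by apply: le_trans (hc1 n); apply: ge0_ler_powR; rewrite ?nnegrE ?ler_nat.
case: q q0 => [r| |]// q0; last first.
  exists c1 => // e e' e0 e'0 h; apply/seq_norm_inftyP => m.
  have [n /andP[gm mg]] : exists n, (g n <= m < g n.+1)%N.
    have ex : exists n, (m < g n)%N by exists m.+1.
    case: (ex_minnP ex) => -[|n]; rewrite ?g00// => mg hmin.
    by exists n; rewrite mg andbT leqNgt; apply/negP => /hmin; rewrite ltnn.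
  apply: (le_trans (term e e' n m e0 e'0 h _)); first by rewrite gm mg.
  rewrite lee_wpmul2l//.
  by have := seq_norm_infty_ub alpha e n.
have r0 : (0 < r)%R by rewrite -lte_fin.
have K0 : (0 <= c2 * c1 `^ r)%R by rewrite mulr_ge0 ?powR_ge0.
(* The factor c1^r compares the weights on a block; [c2] compares the total mass of 1/m on the block
   with 1/(n + 1). *)
exists ((c2 * c1 `^ r) `^ r^-1)%R => [|e e' e0 e'0 h]; first exact: powR_ge0.
have N0 := seq_norm_ge0 alpha r%:E e0.
apply/seq_norm_finP => // [|M]; first by rewrite mule_ge0// lee_fin powR_ge0.
rewrite poweRM// ?lee_fin ?powR_ge0// poweR_EFin -powRrM mulVf ?gt_eqF// powRr1//.
have := seq_norm_fin_ub alpha M.+1 r0 e0.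
move=> /(lee_wpmul2l (_ : 0 <= (c2 * c1 `^ r)%:E)) => /(_ K0); apply: le_trans.
(* The range is enlarged to a union of whole blocks, using M <= g M, so that an induction over
   blocks applies. *)
apply: (@le_trans _ _ (\sum_(1 <= m < (g M).+1)
    ((m%:R `^ beta)%:E * e' m.-1) `^ r * (m%:R^-1)%R%:E)).
  have [M1|/ltnW M1] := leqP 1 M; last first.
    by rewrite big_geq// sume_ge0// => *; exact: seq_norm_term_ge0.
  rewrite [leRHS](big_cat_nat (n := M))//=; last exact: leqW.
  by rewrite leeDl// sume_ge0// => *; exact: seq_norm_term_ge0.
elim: M => [|M IH]; first by rewrite g00 !big_geq// mule0.
rewrite (big_cat_nat (n := (g M).+1))//=; last by rewrite ltnS ltnW// gmono.
rewrite [in leRHS]big_nat_recr//= ge0_muleDr; last 2 first.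
- by apply: sume_ge0 => n _; exact: seq_norm_term_ge0.
- exact: seq_norm_term_ge0.
apply: leeD => //.
set t := ((M.+1%:R `^ alpha)%:E * e M) `^ r.
have t0 : 0 <= t by exact: poweR_ge0.
(* Series indices are shifted by one against the errors, so this is the block from [g M] to
   [g M.+1]. There 1/m is replaced by its largest value, and the number of terms is left to
   [hc2]. *)
apply: (@le_trans _ _ (\sum_((g M).+1 <= m < (g M.+1).+1)
   ((c1 `^ r)%:E * t * ((g M).+1%:R^-1)%R%:E))).
  rewrite big_seq [leRHS]big_seq; apply: lee_sum => -[|m].
    by rewrite mem_index_iota.
  rewrite mem_index_iota !ltnS => /andP[gm mg].
  apply: lee_pmul; rewrite ?poweR_ge0 ?lee_fin ?invr_ge0//.
    rewrite -poweR_EFin -poweRM ?lee_fin// ?mule_ge0 ?lee_fin ?powR_ge0//.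
    apply: lee_poweR; [exact: ltW|by rewrite ?mule_ge0 ?lee_fin ?powR_ge0|].
    by apply: term => //; rewrite gm mg.
  by rewrite lef_pV2 ?posrE ?ltr0n// ler_nat.
rewrite sume_const_nat subSS.
rewrite (muleC _ (_^-1)%:E) (muleA _ _ ((c1 `^ r)%:E * t)) -EFinM.
rewrite (EFinM c2) -muleA (muleA (c1 `^ r)%:E) (muleC ((c1 `^ r)%:E * t)) (muleA c2%:E)
  -EFinM.
rewrite lee_wpmul2r ?mule_ge0 ?lee_fin ?powR_ge0//.
by rewrite ler_pdivrMr ?ltr0n// mulrAC ler_pdivlMr ?ltr0n.
Qed.

End weighted_sequence_norm.

(** * Approximation spaces *)

(** Lets one summand of a quasi-triangle inequality pass to its infimum, which need not be attained.
    An infinite [y] is separated because subtraction needs a finite one. *)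
Lemma ereal_inf_affine {R : realType} (A : set (\bar R)) (x y : \bar R) (K : R) :
  (0 < K)%R -> (0 <= y)%E -> (forall z, A z -> 0 <= z)%E ->
  (forall z, A z -> x <= K%:E * (z + y))%E -> (x <= K%:E * (ereal_inf A + y))%E.
Proof.
move=> K0 y0 A0 h.
have infA0 : (0 <= ereal_inf A)%E by apply: le_ereal_inf_tmp => z /A0.
have [->|yoo] := eqVneq y +oo%E.
  by rewrite addey ?gt0_muley ?lte_fin ?leey// gt_eqF// (lt_le_trans _ infA0).
have yfin : y \is a fin_num by rewrite ge0_fin_numE// lt_neqAle yoo leey.
rewrite -lee_pdivrMl// -leeBlDr//; apply: le_ereal_inf_tmp => z Az.
by rewrite leeBlDr// lee_pdivrMl//; exact: h.
Qed.

Record approx_family (R : realType) (E : lmodType R) (Phi : nat -> set E) : Prop := {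
  approx_family0 : Phi 0%N = [set 0] ;
  approx_familyS : forall m n, (m <= n)%N -> Phi m `<=` Phi n ;
  approx_familyZ : forall n (a : R) f, Phi n f -> Phi n (a *: f) ;
  approx_familyD : exists c, forall n f g,
    Phi n f -> Phi n g -> Phi (c * n)%N (f + g) }.

Section approximation_spaces.
Context {R : realType} {E : lmodType R} (N : E -> \bar R) (K : R).
Hypothesis N_ge0 : forall f, (0 <= N f)%E.
Hypothesis N_eq0 : forall f, N f = 0%E -> f = 0.
Hypothesis NZ : forall (a : R) f, N (a *: f) = (`|a|%:E * N f)%E.
Hypothesis K_gt0 : 0 < K.
Hypothesis ND : forall f g, (N (f + g)%R <= K%:E * (N f + N g))%E.
Hypothesis N_complete : forall u : nat -> E,
  (forall e : R, 0 < e -> exists n0, forall m n, (n0 <= m)%N -> (n0 <= n)%N ->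
    (N (u m - u n)%R < e%:E)%E) ->
  exists f, N (u n - f) @[n --> \oo] --> (0%E : \bar R).

Local Notation err := (best_error N).
Local Notation X := [set f | (N f < +oo)%E].

Let N0 : N 0 = 0%E.
Proof. by rewrite -(scale0r (0 : E)) NZ normr0 mul0e. Qed.

Lemma best_error_ge0 (Phi : nat -> set E) n f : (0 <= err Phi n f)%E.
Proof. by apply: le_ereal_inf_tmp => _ [g _ <-]. Qed.

Lemma best_error_le (Phi : nat -> set E) n f g : Phi n g -> (err Phi n f <= N (f -
  g)%R)%E.
Proof. by move=> ?; apply: ereal_inf_lbound; exists g. Qed.

Lemma best_error_sub (Phi Psi : nat -> set E) m n f : Phi m `<=` Psi n ->
  (err Psi n f <= err Phi m f)%E.
Proof. by move=> PP; apply: le_ereal_inf_tmp => _ [g /PP ? <-]; exact: best_error_le. Qed.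

Section family.
Variable Phi : nat -> set E.
Hypothesis PhiF : approx_family Phi.

Lemma best_error0 f : err Phi 0 f = N f.
Proof.
rewrite /best_error (approx_family0 PhiF) image_set1 ereal_inf1 subr0//.
Qed.

Lemma best_error_leN n f : (err Phi n f <= N f)%E.
Proof. by rewrite -best_error0; apply: best_error_sub; exact: approx_familyS. Qed.

Lemma best_errorZ n a f : err Phi n (a *: f) = (`|a|%:E * err Phi n f)%E.
Proof.
have [->|a0] := eqVneq a 0.
  rewrite scale0r normr0 mul0e; apply/eqP; rewrite eq_le best_error_ge0 andbT.
  by apply: le_trans (best_error_leN n 0) _; rewrite N0.
have le b g : b != 0 -> (err Phi n (b *: g) <= `|b|%:E * err Phi n g)%E.
  move=> b0; rewrite -lee_pdivrMl ?normr_gt0//; apply: le_ereal_inf_tmp => _ [h Ph <-].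
  rewrite lee_pdivrMl ?normr_gt0// -NZ scalerBr; apply: best_error_le.
  exact: approx_familyZ.
apply/eqP; rewrite eq_le le//= -lee_pdivlMl ?normr_gt0//.
have := le (a^-1) (a *: f); rewrite invr_eq0 => /(_ a0).
by rewrite scalerA mulVf// scale1r normfV.
Qed.

(** Charging [g] its full norm keeps the index [n]; the symmetric version below inflates it. *)
Lemma best_errorDN n f g : (err Phi n (f + g)%R <= K%:E * (err Phi n f + N g))%E.
Proof.
apply: ereal_inf_affine => //; first by move=> _ [h _ <-].
move=> _ [h Ph <-]; apply: le_trans (best_error_le _ Ph) _.
by rewrite addrAC; exact: ND.
Qed.

Lemma best_errorD c : (forall n f g, Phi n f -> Phi n g -> Phi (c * n)%N (f + g)) ->
  forall n f g, (err Phi (c * n) (f + g)%R <= K%:E * (err Phi n f + err Phi n g))%E.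
Proof.
move=> hc n f g; apply: ereal_inf_affine; rewrite ?best_error_ge0//.
  by move=> _ [h _ <-].
move=> _ [h Ph <-]; rewrite addeC; apply: ereal_inf_affine => //.
  by move=> _ [k _ <-].
move=> _ [k Pk <-]; rewrite addeC; apply: le_trans (ND _ _).
rewrite addrACA -opprD; apply: best_error_le; exact: hc.
Qed.

Section norm.
Variables (alpha : R) (q : \bar R).
Hypothesis alpha_ge0 : 0 <= alpha.
Hypothesis q_gt0 : (0 < q)%E.

Local Notation normA := (approx_norm N Phi alpha q).

Lemma approx_normE f : normA f = seq_norm alpha q (fun n => err Phi n f).
Proof. by []. Qed.

Lemma approx_norm_ge0 f : (0 <= normA f)%E.
Proof. by rewrite approx_normE; apply: seq_norm_ge0 => n; exact: best_error_ge0. Qed.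

Lemma approx_norm_geN f : (N f <= normA f)%E.
Proof.
rewrite -best_error0 approx_normE.
by apply: (seq_norm_ge_head _ (e := fun n => err Phi n f)) => // n; exact: best_error_ge0.
Qed.

Lemma approx_normZ a f : normA (a *: f) = (`|a|%:E * normA f)%E.
Proof.
rewrite !approx_normE -seq_normZ//; last by move=> n; exact: best_error_ge0.
by congr seq_norm; apply/funext => n; exact: best_errorZ.
Qed.

Lemma approx_normD : exists2 C : R, 0 <= C & forall f g,
  (normA (f + g)%R <= C%:E * (normA f + normA g))%E.
Proof.
have [c hc'] := approx_familyD PhiF.
(* The successor makes the block boundaries strictly increasing even when c = 0. *)
have hc n f g : Phi n f -> Phi n g -> Phi (c.+1 * n)%N (f + g).
  by move=> Pf Pg; apply: (approx_familyS PhiF _ (hc' _ _ _ Pf Pg));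
    rewrite leq_mul2r leqnSn orbT.
have [||||||C C0 hC] := @seq_norm_block _ alpha alpha q (fun n => c.+1 * n)%N
  (c.+1%:R `^ alpha) c.+1%:R q_gt0.
- by move=> m n mn; rewrite ltn_pmul2l.
- by rewrite muln0.
- by [].
- exact: powR_ge0.
- by move=> n; rewrite natrM powRM.
- by move=> n; rewrite -mulnBr subSnn muln1 -!natrM ler_nat leq_mul2l ltnS leq_pmull.
have [C' C'0 hC'] := seq_normD alpha q_gt0.
exists (C * (K * C')) => [|f g]; first by rewrite !mulr_ge0// ltW.
have e0 h n : (0 <= err Phi n h)%E by exact: best_error_ge0.
apply: (@le_trans _ _ (C%:E * seq_norm alpha q
    (fun n => K%:E * (err Phi n f + err Phi n g)))%E).
  rewrite approx_normE; apply: (hC _ (fun n => err Phi n (f + g))) => //.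
    by move=> n; rewrite mule_ge0 ?adde_ge0// lee_fin ltW.
  move=> n m nm; apply: le_trans (best_errorD hc n f g).
  by apply: best_error_sub; exact: approx_familyS.
rewrite seq_normZ//; last 2 first.
- exact: ltW.
- by move=> n; rewrite adde_ge0.
rewrite !EFinM -!muleA !lee_wpmul2l ?lee_fin ?(ltW K_gt0)//.
exact: (hC' (fun n => err Phi n f) (fun n => err Phi n g)).
Qed.

(** The limit f exists for the ambient norm. Each error of u_m - f is bounded through u_m - u_l,
    which the Cauchy property controls, plus the norm of u_l - f, which is small for large l but
    does not decay in n; the latter is summed only over a truncation. *)
Lemma approx_norm_complete : quasinorm_complete (approx_class X N Phi alpha q) normA.
Proof.
move=> u Au cauchy.
have [|f uf] := N_complete (u := u).
  move=> e e0; have [n0 h] := cauchy e e0; exists n0 => m n mn0 nn0.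
  exact: le_lt_trans (approx_norm_geN _) (h _ _ mn0 nn0).
have [C C0 hC] := seq_normD alpha q_gt0.
have [C' C'0 hC'] := approx_normD.
have close (e : R) : 0 < e -> exists n0, forall m, (n0 <= m)%N ->
    (normA (u m - f)%R <= (K * (C * (e + e)))%:E)%E.
  move=> e0; have [n0 h] := cauchy e e0; exists n0 => m mn0.
  have b0 : 0 <= K * (C * (e + e)).
    by rewrite !mulr_ge0// ?addr_ge0// ltW.
  rewrite approx_normE; apply: seq_norm_trunc => //.
    by move=> n; exact: best_error_ge0.
  move=> M; set one := fun n => if (n < M)%N then 1%E else 0%E : \bar R.
  have one0 n : (0 <= one n)%E by rewrite /one; case: ifP.
  have Tfin := seq_norm_trunc1_lty alpha M q_gt0; rewrite -/one in Tfin.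
  have T0 : (0 <= seq_norm alpha q one)%E by exact: seq_norm_ge0.
  set T := fine (seq_norm alpha q one).
  have TE : seq_norm alpha q one = T%:E by rewrite fineK// ge0_fin_numE.
  have {}T0 : 0 <= T by rewrite -lee_fin -TE.
  (* The index l depends on the truncation length through [T], the norm of the truncated constant 1;
     adding 1 avoids a division by 0. *)
  have [l ln0 hl] : exists2 l, (n0 <= l)%N & (N (u l - f)%R <= (e / (T + 1))%:E)%E.
    have d0 : (0 < (e / (T + 1))%:E)%E by rewrite lte_fin divr_gt0// ltr_wpDl.
    have /fine_cvgP[ufin /cvgrPdist_le/(_ (e / (T + 1)))] := uf.
    rewrite -lte_fin => /(_ d0) ucvg.
    have [k _ /= hk] : \forall n \near \oo, (N (u n - f)%R <= (e / (T + 1))%:E)%E.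
      near=> n; have : N (u n - f) \is a fin_num by near: n.
      move=> /fineK <-; rewrite lee_fin.
      suff: `|0 - fine (N (u n - f))| <= e / (T + 1).
        by rewrite sub0r normrN ger0_norm// fine_ge0.
      by near: n.
    exists (maxn n0 k); first exact: leq_maxl.
    by apply: hk; rewrite /= leq_maxr.
  apply: (@le_trans _ _ (seq_norm alpha q (fun n =>
     K%:E * (err Phi n (u m - u l)%R + (e / (T + 1))%:E * one n))%E)).
    apply: le_seq_norm => // [n|n].
      by case: ifP => // _; exact: best_error_ge0.
    rewrite /one; case: ifP => _; last first.
      rewrite mule0 adde0 mule_ge0 ?best_error_ge0// lee_fin ltW//.
    rewrite mule1 -(subrK (u l) (u m)) -addrA addrK.
    apply: le_trans (best_errorDN _ _ _) _.
    by rewrite lee_wpmul2l ?leeD2l// lee_fin ltW.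
  have h1 n : (0 <= err Phi n (u m - u l)%R)%E by exact: best_error_ge0.
  have h2 n : (0 <= (e / (T + 1))%:E * one n)%E.
    by rewrite mule_ge0// lee_fin divr_ge0 ?addr_ge0// ltW.
  rewrite seq_normZ//; [|exact: ltW|by move=> n; rewrite adde_ge0].
  rewrite !EFinM lee_wpmul2l ?lee_fin ?(ltW K_gt0)//.
  apply: le_trans (hC _ _ h1 h2) _; rewrite lee_wpmul2l// EFinD leeD//.
    by rewrite -approx_normE ltW// h.
  rewrite seq_normZ//; last by rewrite divr_ge0 ?addr_ge0// ltW.
  rewrite TE -EFinM lee_fin mulrAC ler_pdivrMr ?ltr_wpDl//.
  by rewrite ler_wpM2l ?(ltW e0)// lerDl.
have [m0 hm0] := close 1 ltr01.
have Nuf : (normA (u m0 - f)%R < +oo)%E by exact: le_lt_trans (hm0 _ (leqnn _)) (ltry _).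
have Af : approx_class X N Phi alpha q f.
  have fin : (normA f < +oo)%E.
    rewrite -(subrK (u m0) f) -opprB -scaleN1r addrC; apply: le_lt_trans (hC' _ _) _.
    have [_ /= ufin] := Au m0.
    rewrite approx_normZ normrN1 mul1e lte_mul_pinfty ?lee_fin// lte_add_pinfty//.
  by split => //; exact: le_lt_trans (approx_norm_geN f) fin.
exists f => //; apply/fine_cvgP; split.
  exists m0 => // n /= mn; rewrite ge0_fin_numE ?approx_norm_ge0//.
  exact: le_lt_trans (hm0 _ mn) (ltry _).
apply/cvgrPdist_le => e e0.
(* [C] may be 0, hence C + 1 in the divisor. *)
have KC : 0 < K * ((C + 1) * 2) by rewrite !mulr_gt0// ltr_wpDl.
have [n0 h] := close (e / (K * ((C + 1) * 2))) (divr_gt0 e0 KC).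
exists n0 => // n /= nn0; rewrite sub0r normrN ger0_norm ?fine_ge0 ?approx_norm_ge0//.
have hn := h n nn0.
have fin : normA (u n - f) \is a fin_num.
  by rewrite ge0_fin_numE ?approx_norm_ge0//; exact: le_lt_trans hn (ltry _).
rewrite -lee_fin fineK//; apply: le_trans hn _; rewrite lee_fin.
set d := e / _; have d0 : 0 < d by exact: divr_gt0.
have -> : e = d * (K * ((C + 1) * 2)) by rewrite /d divfK// gt_eqF.
have -> : K * (C * (d + d)) = d * (K * (C * 2)) by ring.
by rewrite ler_wpM2l ?(ltW d0)// ler_wpM2l ?(ltW K_gt0)// ler_wpM2r// lerDl.
Unshelve. all: by end_near. Qed.

Theorem approx_quasi_banach : quasi_banach (approx_class X N Phi alpha q) normA.
Proof.
have [C C0 hC] := approx_normD.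
have classP f : approx_class X N Phi alpha q f <-> (normA f < +oo)%E.
  by split=> [[]//|fin]; split => //; exact: le_lt_trans (approx_norm_geN f) fin.
split; last exact: approx_norm_complete.
- split=> [|a f g]; rewrite ?inE; rewrite -?[(_ \in mem _)]/(_ \in _) ?inE.
    apply/classP; rewrite -(scale0r (0 : E)) approx_normZ normr0 mul0e//.
  move=> /classP fA /classP gA; apply/classP; apply: le_lt_trans (hC _ _) _.
  by rewrite lte_mul_pinfty ?lee_fin// lte_add_pinfty// approx_normZ lte_mul_pinfty
    ?lee_fin.
- split.
  + by move=> f [_ /=]; rewrite approx_norm_ge0.
  + move=> f _ f0; apply: N_eq0; apply/eqP; rewrite eq_le N_ge0 andbT -f0.
    exact: approx_norm_geN.
  + by move=> a f _; exact: approx_normZ.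
  + by exists C => f g _ _; exact: hC.
Qed.

End norm.
End family.

Lemma approx_embedding_sub (Phi Psi : nat -> set E) alpha q : (0 < q)%E ->
  (forall n, Phi n `<=` Psi n) ->
  continuous_embedding (approx_class X N Phi alpha q) (approx_norm N Phi alpha q)
    (approx_class X N Psi alpha q) (approx_norm N Psi alpha q).
Proof.
move=> q0 PP.
have le f : (approx_norm N Psi alpha q f <= approx_norm N Phi alpha q f)%E.
  apply: (@le_seq_norm _ alpha q (fun n => err Psi n f) (fun n => err Phi n f)) => //.
    by move=> n; exact: best_error_ge0.
  by move=> n; exact: best_error_sub.
split; first by move=> f [Xf /= ffin]; split => //=; exact: le_lt_trans ffin.
by exists 1 => f _; rewrite mul1e.
Qed.

Lemma approx_embedding_sqr (Phi Psi : nat -> set E) alpha q c : (0 < q)%E ->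
  0 <= alpha -> (forall m n, (m <= n)%N -> Psi m `<=` Psi n) ->
  (forall n, Phi n `<=` Psi (c * n ^ 2)%N) ->
  continuous_embedding (approx_class X N Phi alpha q) (approx_norm N Phi alpha q)
    (approx_class X N Psi (alpha / 2) q) (approx_norm N Psi (alpha / 2) q).
Proof.
move=> q0 a0 mono PP.
(* Halving alpha undoes the square in the block boundaries. The constant 6 absorbs (2n + 1)(n + 1)
   into a multiple of n^2 + 1. *)
have [||||||C C0 hC] := @seq_norm_block _ alpha (alpha / 2) q (fun n => c.+1 * n ^ 2)%N
  (c.+1%:R `^ (alpha / 2)) (6 * c.+1)%:R q0.
- by move=> m n mn; rewrite ltn_pmul2l// ltn_exp2r.
- by rewrite exp0n// muln0.
- by rewrite divr_ge0.
- exact: powR_ge0.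
- move=> n; rewrite natrM powRM// natrX -powR_mulrn// -powRrM.
  by rewrite [_ * (alpha / 2)]mulrC divfK.
- by move=> n; rewrite -!natrM ler_nat; clear K_gt0; nia.
have le f : (approx_norm N Psi (alpha / 2) q f <= C%:E * approx_norm N Phi alpha q f)%E.
  apply: (hC (fun n => err Phi n f) (fun n => err Psi n f)).
  - by move=> n; exact: best_error_ge0.
  - by move=> n; exact: best_error_ge0.
  - move=> n m nm; apply: best_error_sub => g /PP; apply: mono.
    by apply: leq_trans nm; rewrite leq_mul2r leqnSn orbT.
split; last by exists C.
move=> f [Xf /= ffin]; split => //=; apply: le_lt_trans (le f) _.
rewrite lte_mul_pinfty ?lee_fin//.
Qed.

End approximation_spaces.

(** * L^p spaces for all positive exponents *)

Section lp_spaces.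
Context d (T : measurableType d) (R : realType) (mu : {measure set T -> \bar R}).
Implicit Types (f g : L0 mu) (p : \bar R).

Lemma L0_measurable f : measurable_fun setT (f : T -> R).
Proof. exact: measurable_funPT. Qed.

Lemma L0_measurable_poweR f (r : R) :
  measurable_fun setT (fun x => `|(f x)%:E| `^ r)%E.
Proof.
apply: (@measurableT_comp _ _ _ _ _ _ (fun x => x `^ r)%E); first exact: measurable_poweR.
by apply: measurableT_comp => //; apply/measurable_EFinP; exact: L0_measurable.
Qed.

Lemma L0D_ae f g : \forall x \ae mu, (f + g : L0 mu) x = f x + g x.
Proof. exact: L0_addE. Qed.

Lemma L0Z_ae (a : R) f : \forall x \ae mu, (a *: f : L0 mu) x = a * f x.
Proof. exact: L0_scaleE. Qed.

Lemma L0B_ae f g : \forall x \ae mu, (f - g : L0 mu) x = f x - g x.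
Proof.
apply: filterS2 (L0D_ae f (- g)) (L0_oppE g) => x ->.
by rewrite -[L0_opp g]/(- g) => ->.
Qed.

Lemma L0_0_ae : \forall x \ae mu, (0 : L0 mu) x = 0.
Proof. exact: L0_zeroE. Qed.

Lemma L0_sum_ae (I : Type) (s : seq I) (F : I -> L0 mu) :
  \forall x \ae mu, (\sum_(i <- s) F i : L0 mu) x = \sum_(i <- s) F i x.
Proof.
elim: s => [|i s IH].
  by apply: filterS L0_0_ae => x; rewrite !big_nil.
rewrite big_cons; apply: filterS2 (L0D_ae (F i) (\sum_(i <- s) F i)) IH => x -> ->.
by rewrite big_cons.
Qed.

Lemma LpnormE (r : R) f :
  Lpnorm mu r%:E f = ((\int[mu]_x (`|(f x)%:E| `^ r)) `^ r^-1)%E.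
Proof. by rewrite /Lpnorm unlock. Qed.

Lemma Lpnorm_inftyE f : (0 < mu setT)%E ->
  Lpnorm mu +oo f = ess_sup mu (abse \o (EFin \o f)).
Proof. by rewrite /Lpnorm unlock => ->. Qed.

Lemma Lpnorm_finP (r : R) f (c : \bar R) : 0 < r -> (0 <= c)%E ->
  (Lpnorm mu r%:E f <= c)%E = (\int[mu]_x (`|(f x)%:E| `^ r) <= c `^ r)%E.
Proof.
move=> r0 c0; rewrite LpnormE poweRV_le//.
by apply: integral_ge0 => x _; exact: poweR_ge0.
Qed.

Lemma Lpnorm_inftyP f (c : \bar R) : (0 < mu setT)%E ->
  (Lpnorm mu +oo f <= c)%E <-> \forall x \ae mu, (`|(f x)%:E| <= c)%E.
Proof. by move=> mu0; rewrite Lpnorm_inftyE//; split => /ess_supP. Qed.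

Lemma Lpnorm_eq0 p f : (0 < p)%E -> Lpnorm mu p f = 0%E -> f = 0.
Proof.
move=> p0 /Lnorm_eq0_eq0 => /(_ _ p0) h.
have {}h : (EFin \o f) = \0%E %[ae mu].
  by apply: h; apply/measurable_EFinP; exact: L0_measurable.
apply: L0_eqP; apply: filterS2 h L0_0_ae => x /(_ I) [fx] -> _.
exact: fx.
Qed.

Lemma LpnormZ p (a : R) f : (0 < mu setT)%E -> (0 < p)%E ->
  Lpnorm mu p (a *: f) = (`|a|%:E * Lpnorm mu p f)%E.
Proof.
move=> mu0; case: p => [r| |]// p0; last first.
  rewrite !Lpnorm_inftyE// -ess_supZl//; apply: eq_ess_sup.
  by apply: filterS (L0Z_ae a f) => x /= ->; rewrite normrM ?EFinM.
have r0 : 0 < r by rewrite -lte_fin.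
rewrite !LpnormE -(@poweRK _ r `|a|%:E)// -poweRM ?poweR_ge0//; last first.
  by apply: integral_ge0 => x _; exact: poweR_ge0.
rewrite -ge0_integralZl//; first last.
- by rewrite poweR_ge0.
- by move=> x _; exact: poweR_ge0.
- exact: L0_measurable_poweR.
congr (_ `^ _)%E; apply: ge0_ae_eq_integral => //.
- exact: L0_measurable_poweR.
- by apply: measurable_funeM; exact: L0_measurable_poweR.
- by move=> x _; exact: poweR_ge0.
- by move=> x _; rewrite mule_ge0 ?poweR_ge0.
- by apply: filterS (L0Z_ae a f) => x -> _; rewrite EFinM abseM poweRM.
Qed.

Lemma LpnormD p : (0 < mu setT)%E -> (0 < p)%E -> exists2 K : R, 0 < K &
  forall f g, (Lpnorm mu p (f + g)%R <= K%:E * (Lpnorm mu p f + Lpnorm mu p g))%E.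
Proof.
move=> mu0; case: p => [r| |]// p0; last first.
  exists 1 => // f g; rewrite mul1e !Lpnorm_inftyE//;
    apply: le_trans (ess_sup_absD _ _ _).
  by apply: le_ess_sup; apply: filterS (L0D_ae f g) => x /= ->.
have r0 : 0 < r by rewrite -lte_fin.
(* One bound for all finite r, from splitting the power under the integral and then the root;
   Minkowski fails for r < 1. *)
exists (2 * 2 `^ r^-1) => [|f g]; first by rewrite mulr_gt0 ?powR_gt0.
rewrite EFinM -muleA Lpnorm_finP//; last first.
  by rewrite mule_ge0// ?lee_fin// mule_ge0 ?adde_ge0 ?lee_fin ?powR_ge0 ?Lnorm_ge0.
have mf := L0_measurable_poweR f r; have mg := L0_measurable_poweR g r.
set A := (\int[mu]_x (`|(f x)%:E| `^ r))%E; set B := (\int[mu]_x (`|(g x)%:E| `^ r))%E.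
have A0 : (0 <= A)%E by apply: integral_ge0 => x _; exact: poweR_ge0.
have B0 : (0 <= B)%E by apply: integral_ge0 => x _; exact: poweR_ge0.
apply: (@le_trans _ _ ((2 `^ r)%:E * (A + B))%E).
  rewrite -ge0_integralD//; [|by move=> x _; exact: poweR_ge0..].
  rewrite -ge0_integralZl//; last 2 first.
  - exact: emeasurable_funD.
  - by move=> x _; rewrite adde_ge0 ?poweR_ge0.
  apply: ae_ge0_le_integral => //.
  - by move=> x _; exact: poweR_ge0.
  - exact: L0_measurable_poweR.
  - by move=> x _; rewrite mule_ge0 ?adde_ge0 ?poweR_ge0 ?lee_fin ?powR_ge0.
  - by apply: measurable_funeM; exact: emeasurable_funD.
  - apply: filterS (L0D_ae f g) => x -> _; rewrite EFinD.
    apply: le_trans (poweRD_le (ltW r0) (abse_ge0 _) (abse_ge0 _)).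
    by apply: lee_poweR; [exact: ltW|exact: abse_ge0|exact: lee_abs_add].
rewrite poweRM ?lee_fin//; last first.
  by rewrite mule_ge0 ?adde_ge0 ?lee_fin ?powR_ge0 ?Lnorm_ge0.
rewrite poweR_EFin lee_wpmul2l ?lee_fin ?powR_ge0//.
rewrite -(poweRVK r0 (adde_ge0 A0 B0)); apply: lee_poweR; [exact: ltW|exact: poweR_ge0|].
by rewrite !LpnormE -/A -/B; apply: poweRD_le; rewrite ?invr_ge0 ?(ltW r0).
Qed.

Lemma Lpnorm_fatou p (h : nat -> L0 mu) f (c : \bar R) :
  (0 < mu setT)%E -> (0 < p)%E -> (0 <= c)%E ->
  (\forall x \ae mu, h n x @[n --> \oo] --> f x) ->
  (forall n, Lpnorm mu p (h n) <= c)%E -> (Lpnorm mu p f <= c)%E.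
Proof.
move=> mu0 + c0 hf; case: p => [r| |]// p0 hc; last first.
  have /ae_foralln hc' n := iffLR (Lpnorm_inftyP _ _ mu0) (hc n).
  apply/Lpnorm_inftyP => //; apply: filterS2 hf hc' => x hx hcx.
  have : `|h n x|%:E @[n --> \oo] --> `|f x|%:E.
    by apply: cvg_EFin; [exact: nearW|exact: cvg_norm].
  by apply: cvge_le; exact: nearW.
have r0 : 0 < r by rewrite -lte_fin.
rewrite Lpnorm_finP//.
have hc' n : (\int[mu]_x (`|(h n x)%:E| `^ r) <= c `^ r)%E by rewrite -Lpnorm_finP.
have := @fatou _ _ _ mu setT measurableT (fun n x => `|(h n x)%:E| `^ r)%E
  (fun n => L0_measurable_poweR (h n) r) (fun n x _ => poweR_ge0 _ _).
move=> fat; apply: (@le_trans _ _ (limn_einf (fun n => \int[mu]_x (`|(h n x)%:E| `^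
  r))%E)).
  apply: le_trans fat; apply: ae_ge0_le_integral => //.
  - by move=> x _; exact: poweR_ge0.
  - exact: L0_measurable_poweR.
  - move=> x _; rewrite limn_einf_lim; apply: lime_ge; first exact: is_cvg_einfs.
    apply: nearW => n; apply: le_ereal_inf_tmp => _ [k _ <-]; exact: poweR_ge0.
  - rewrite (_ : (fun x => limn_einf _) =
        (fun x => - limn_esup (fun n => - (`|(h n x)%:E| `^ r))%E))%E.
      apply: measurableT_comp => //; apply: measurable_fun_limn_esup => n.
      by apply: measurableT_comp => //; exact: L0_measurable_poweR.
    by apply/funext => x; rewrite /limn_einf.
  - apply: filterS hf => x hx _.
    (* Continuity of the power is taken from its derivability, which holds at positive points; at 0
       the left side vanishes. *)
    have [fx0|fx0] := eqVneq (f x) 0.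
      rewrite fx0 abse0 poweR0r ?gt_eqF// limn_einf_lim; apply: lime_ge.
        exact: is_cvg_einfs.
      apply: nearW => n; apply: le_ereal_inf_tmp => _ [k _ <-]; exact: poweR_ge0.
    suff /cvg_limn_einf_sup[-> _] :
      (`|(h n x)%:E| `^ r)%E @[n --> \oo] --> (`|(f x)%:E| `^ r)%E by [].
    apply: cvg_EFin; first exact: nearW.
    have cont : {for `|f x|, continuous (@powR R ^~ r)}.
      apply: differentiable_continuous; apply/derivable1_diffP.
      by apply: derivable_powR; rewrite in_itv/= andbT normr_gt0.
    exact: (cvg_comp _ _ (cvg_norm hx) cont).
rewrite limn_einf_lim; apply: lime_le; first exact: is_cvg_einfs.
apply: nearW => n; apply: le_trans (hc' n); apply: ereal_inf_lbound.
by exists n => /=.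
Qed.

Lemma L0_of_measurable (f : T -> R) : measurable_fun setT f ->
  exists g : L0 mu, \forall x \ae mu, g x = f x.
Proof.
move=> mf; pose F := HB.pack_for {mfun T >-> R} f (isMeasurableFun.Build _ _ _ _ f mf).
by exists (L0_class mu F); apply: filterS (L0_classK mu F) => x /(_ I).
Qed.

(** Multiplying by the indicator of the complement of a null set turns almost-everywhere into
    everywhere convergence, so the pointwise limit is measurable. *)
Lemma L0_ae_limit (w : nat -> L0 mu) :
  (\forall x \ae mu, cvgn (fun n => w n x)) ->
  exists f : L0 mu, \forall x \ae mu, w n x @[n --> \oo] --> f x.
Proof.
move=> -[B [mB B0 subB]].
pose w' n x := w n x * \1_(~` B) x.
have w'w x : ~ B x -> (fun n => w' n x) = (fun n => w n x).
  by move=> Bx; apply/funext => n; rewrite /w' indicE mem_set ?mulr1.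
have cvgw x : ~ B x -> cvgn (fun n => w n x).
  by move=> Bx; apply: contrapT => /subB.
have w'cvg x : cvgn (fun n => w' n x).
  have [Bx|Bx] := pselect (B x); last by rewrite w'w//; exact: cvgw.
  rewrite (_ : (fun n => w' n x) = cst 0); first exact: is_cvg_cst.
  by apply/funext => n; rewrite /w' indicE memNset ?mulr0// => /(_ Bx).
have mw' n : measurable_fun setT (w' n).
  apply: measurable_funM; first exact: L0_measurable.
  by apply: measurable_indic; exact: measurableC.
have [|f hf] := @L0_of_measurable (fun x => limn (fun n => w' n x)).
  by apply: (@measurable_fun_cvg _ _ _ setT w') => // x _; exact: w'cvg.
exists f; have notB : \forall x \ae mu, ~ B x.
  by exists B; split => // x /= /contrapT.
apply: filterS2 hf notB => x -> Bx.
by rewrite w'w//; exact: cvgw.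
Qed.

Lemma cvgn_geometric_increments (w : nat -> R) (M : R) :
  (forall k, `|w k.+1 - w k| <= M * 2^-1 ^+ k) -> cvgn w.
Proof.
move=> hM; rewrite (_ : w = (fun n => w 0%N + series (telescope w) n)); last first.
  by apply/funext => n; exact: eq_sum_telescope.
apply: is_cvgD; first exact: is_cvg_cst.
apply: normed_cvg; apply: (@series_le_cvg _ _ (geometric M 2^-1)).
- by move=> n; exact: normr_ge0.
- by move=> n; exact: le_trans (hM n).
- exact: hM.
- by apply: is_cvg_geometric_series; rewrite ger0_norm// invf_lt1// ltr1n.
Qed.

(* For finite p = r, increments v_k of this size satisfy
   \int (2^k |v_k|)^r <= 2^-k, so that sum_k (2^k |v_k|)^r is finite a.e. *)
Definition rapid_rate p (k : nat) : R :=
  match p with r%:E => 2^-1 ^+ k * (2^-1 ^+ k) `^ r^-1 | _ => 2^-1 ^+ k end.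

Lemma ae_geometric_increments p (w : nat -> L0 mu) :
  (0 < mu setT)%E -> (0 < p)%E ->
  (forall k, Lpnorm mu p (w k.+1 - w k)%R <= (rapid_rate p k)%:E)%E ->
  \forall x \ae mu, cvgn (fun n => w n x).
Proof.
move=> mu0 + hw.
have wB : \forall x \ae mu, forall k, (w k.+1 - w k : L0 mu) x = w k.+1 x - w k x.
  by apply: ae_foralln => k; exact: L0B_ae.
have half0 k : (0 : R) <= 2^-1 ^+ k by rewrite exprn_ge0.
case: p hw => [r| |]// hw p0; last first.
  have hw' : \forall x \ae mu, forall k, (`|((w k.+1 - w k : L0 mu)%R x)%:E| <= (2^-1
    ^+ k)%:E)%E.
    by apply: ae_foralln => k; exact/Lpnorm_inftyP.
  apply: filterS2 wB hw' => x wBx hx; apply: (@cvgn_geometric_increments _ 1) => k.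
  by rewrite mul1r -wBx -lee_fin; exact: hx.
have r0 : 0 < r by rewrite -lte_fin.
pose F k x := (((2 ^+ k) `^ r)%R%:E * (`|((w k.+1 - w k : L0 mu)%R x)%:E| `^ r))%E.
have mF k : measurable_fun setT (F k).
  by apply: measurable_funeM; exact: L0_measurable_poweR.
have F0 k x : (0 <= F k x)%E by rewrite mule_ge0 ?poweR_ge0// lee_fin powR_ge0.
have intF k : (\int[mu]_x F k x <= (2^-1 ^+ k)%:E)%E.
  rewrite ge0_integralZl//; last 2 first.
  - exact: L0_measurable_poweR.
  - by move=> x _; exact: poweR_ge0.
  have := hw k; rewrite Lpnorm_finP//; last by rewrite lee_fin mulr_ge0 ?powR_ge0.
  move=> /(lee_wpmul2l (_ : 0 <= ((2 ^+ k) `^ r)%:E))%E => /(_ _)/le_trans; apply.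
    by rewrite lee_fin powR_ge0.
  rewrite /rapid_rate poweR_EFin -EFinM lee_fin powRM ?powR_ge0// -powRrM mulVf
    ?gt_eqF// powRr1//.
  by rewrite mulrA -powRM ?exprn_ge0// -exprMn mulfV// expr1n powR1 mul1r.
have intS : (\int[mu]_x (\sum_(k <oo) F k x) < +oo)%E.
  rewrite integral_nneseries//.
  apply: (@le_lt_trans _ _ (\sum_(k <oo) (2^-1 ^+ k)%:E)%E).
    apply: lee_nneseries => [k _ _|k _]; first by apply: integral_ge0.
    exact: intF.
  have := @cvg_geometric_eseries_half R 2 0.
  rewrite (_ : eseries _ = (fun n => \sum_(0 <= k < n) (2^-1 ^+ k)%:E)%E); last first.
    apply/funext => n; apply: eq_bigr => k _; congr _%:E.
    by rewrite addn1 natrX exprS exprVn invfM mulrA mulfV// mul1r.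
  by move=> /cvg_lim ->//; exact: ltry.
have mS : measurable_fun setT (fun x => \sum_(k <oo) F k x)%E.
  exact: ge0_emeasurable_sum.
have S0 x : (0 <= \sum_(k <oo) F k x)%E by exact: nneseries_ge0.
have /integrable_ae : mu.-integrable setT (fun x => \sum_(k <oo) F k x)%E.
  apply/integrableP; split => //.
  by under eq_integral do rewrite gee0_abs//.
move=> /(_ measurableT); apply: filterS2 wB => x wBx /(_ I) Sfin.
have G0 : 0 <= fine (\sum_(k <oo) F k x)%E by rewrite fine_ge0.
(* Each term is below the finite sum G at x, which gives |v_k(x)| <= G^(1/r) 2^-k, hence geometric
   increments. *)
have FG k : (F k x <= (fine (\sum_(k <oo) F k x))%:E)%E.
  rewrite fineK//; apply: le_trans (nneseries_lim_ge k.+1 _) => //.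
  by rewrite big_nat_recr//= leeDr// sume_ge0.
move: (fine _) G0 FG => G G0 FG {Sfin}.
apply: (@cvgn_geometric_increments _ (G `^ r^-1)) => k.
rewrite -wBx; have := FG k; rewrite /F -[`|_|%E]/(`|_|%R%:E).
set v := `|_|; have v_ge0 : 0 <= v by exact: normr_ge0.
rewrite poweR_EFin -EFinM lee_fin -powRM ?exprn_ge0// => h.
rewrite exprVn ler_pdivlMr ?exprn_gt0// mulrC.
have v0 : 0 <= 2 ^+ k * v by rewrite mulr_ge0 ?exprn_ge0.
rewrite [leLHS](_ : _ = ((2 ^+ k * v) `^ r) `^ r^-1); last first.
  by rewrite -powRrM mulfV ?powRr1// gt_eqF.
by apply: ge0_ler_powR; rewrite ?nnegrE ?invr_ge0 ?powR_ge0 ?(ltW r0).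
Qed.

Theorem Lpnorm_complete p (u : nat -> L0 mu) : (0 < mu setT)%E -> (0 < p)%E ->
  (forall e : R, 0 < e -> exists n0, forall m n, (n0 <= m)%N -> (n0 <= n)%N ->
    (Lpnorm mu p (u m - u n)%R < e%:E)%E) ->
  exists f, Lpnorm mu p (u n - f) @[n --> \oo] --> (0%E : \bar R).
Proof.
move=> mu0 p0 cauchy.
have c0 k : 0 < rapid_rate p k.
  by rewrite /rapid_rate; case: (p) => [r||]; rewrite ?mulr_gt0 ?powR_gt0 ?exprn_gt0.
have [h hc] := choice (fun k => cauchy (rapid_rate p k) (c0 k)).
(* Partial sums of the Cauchy thresholds make the subsequence monotone and above every [h k]; the
   summand [k] sends it to infinity. *)
pose s k := (\sum_(i < k.+1) h i + k)%N.
have hs k : (h k <= s k)%N by rewrite /s big_ord_recr/= -addnA addnCA leq_addr.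
have sS k : (s k <= s k.+1)%N.
  by rewrite /s [in leqRHS]big_ord_recr/= -addnA leq_add2l addnS leqW// leq_addl.
have ks k : (k <= s k)%N by exact: leq_addl.
have [f hf] : exists f : L0 mu, \forall x \ae mu, u (s n) x @[n --> \oo] --> f x.
  apply: (@L0_ae_limit (fun n => u (s n))).
  apply: (@ae_geometric_increments p (fun n => u (s n))) => // k.
  by apply/ltW/hc => //; exact: leq_trans (hs k) _.
have close (e : R) : 0 < e -> exists n0, forall m, (n0 <= m)%N ->
    (Lpnorm mu p (u m - f)%R <= e%:E)%E.
  move=> e0; have [n0 hn0] := cauchy e e0; exists n0 => m mn0.
  (* Fatou in the second index bounds the distance from the whole sequence to f, not only from the
     subsequence; the shift by [n0] keeps both indices in the Cauchy range. *)
  apply: (@Lpnorm_fatou p (fun k => u m - u (s (n0 + k)%N))) => //.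
  - by rewrite lee_fin ltW.
  - have hB : \forall x \ae mu, forall k,
        (u m - u (s (n0 + k)%N) : L0 mu) x = u m x - u (s (n0 + k)%N) x.
      by apply: ae_foralln => k; exact: L0B_ae.
    apply: filterS3 hf hB (L0B_ae (u m) f) => x hx hBx ->.
    under eq_fun do rewrite hBx.
    apply: cvgB; first exact: cvg_cst.
    under eq_fun do rewrite addnC.
    by rewrite -(cvg_shiftn n0) in hx.
  - move=> k; apply: ltW; apply: hn0 => //.
    exact: leq_trans (leq_addr k n0) (ks _).
exists f; apply/fine_cvgP; split.
  have [n0 h0] := close 1 ltr01.
  exists n0 => // n /= nn; rewrite ge0_fin_numE ?Lnorm_ge0//.
  exact: le_lt_trans (h0 _ nn) (ltry _).
apply/cvgrPdist_le => e e0; have [n0 h0] := close e e0.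
exists n0 => // n /= nn; rewrite sub0r normrN ger0_norm ?fine_ge0 ?Lnorm_ge0//.
rewrite -lee_fin fineK; first exact: h0.
by rewrite ge0_fin_numE ?Lnorm_ge0//; exact: le_lt_trans (h0 _ nn) (ltry _).
Qed.

End lp_spaces.

(** * Null sets of the cube under digit maps *)

Section affine_null_sets.
Context {R : realType}.
Local Notation TR := (measurableTypeR R).

Lemma measurable_affine (a c : R) :
  measurable_fun (setT : set TR) (fun x => a * x + c : TR).
Proof. by apply: measurable_funD => //; exact: measurable_funM. Qed.

(** The rescaled push-forward agrees with Lebesgue measure on half-open intervals, hence everywhere
    by uniqueness. *)
Lemma lebesgue_measure_affine (a c : R) (A : set TR) : 0 < a -> measurable A ->
  lebesgue_measure A =
  (a%:E * lebesgue_measure ((fun x : TR => (a * x + c)%R : TR) @^-1` A))%E.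
Proof.
move=> a0 mA.
have a0' : 0 <= a by exact: ltW.
pose f := (fun x => a * x + c) : TR -> TR.
have mf : measurable_fun setT f by exact: measurable_affine.
pose nu' := mscale (NngNum a0') (pushforward lebesgue_measure f) :
  {measure set TR -> \bar R}.
pose nu := nu' mf.
rewrite (@lebesgue_measure_unique _ nu) => // X [[u v] _ <-].
change (lebesgue_measure `]u, v]%classic =
  a%:E * lebesgue_measure (f @^-1` `]u, v]%classic))%E.
rewrite (_ : _ @^-1` _ = `](u - c) / a, (v - c) / a]%classic); last first.
  apply/seteqP; split => x /=; rewrite !in_itv/= ltr_pdivrMr// ler_pdivlMr//;
    rewrite ltrBlDr lerBrDr (mulrC x); exact.
rewrite !lebesgue_measure_itv/= !lte_fin ltr_pM2r ?invr_gt0// ltrD2r.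
case: ifP => _; last by rewrite mule0.
by rewrite -!EFinB -EFinM; congr _%:E; field; rewrite gt_eqF.
Qed.

Lemma affine_preimage_null (a c : R) (A : set TR) : 0 < a -> measurable A ->
  lebesgue_measure A = 0%E ->
  lebesgue_measure ((fun x : TR => (a * x + c)%R : TR) @^-1` A) = 0%E.
Proof.
move=> a0 mA; rewrite (lebesgue_measure_affine c a0 mA) => /eqP.
by rewrite mule_eq0 eqe gt_eqF//= => /eqP.
Qed.

Section step.
Variable b : nat.
Hypothesis b_gt0 : (0 < b)%N.

Definition step1 (k : nat) (x : R) : R := b%:R^-1 * (x + k%:R).

Lemma step1E k : step1 k = (fun x => b%:R^-1 * x + b%:R^-1 * k%:R).
Proof. by apply/funext => x; rewrite /step1 mulrDr. Qed.

Lemma measurable_step1 k : measurable_fun (setT : set TR) (step1 k : TR -> TR).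
Proof. by rewrite step1E; exact: measurable_affine. Qed.

Lemma measurable_step1_preimage k (A : set TR) : measurable A ->
  measurable (step1 k @^-1` A : set TR).
Proof. by move=> mA; rewrite -[X in measurable X]setTI; exact: measurable_step1. Qed.

(** Each step map sends [0,1) into itself, and conversely x in [0,1) is the image of bx - k with k
    the integer part of bx; affine maps preserve null sets. *)
Lemma leb01_step (A : set TR) : measurable A ->
  leb01 R A = 0%E <-> forall k : 'I_b, leb01 R (step1 k @^-1` A) = 0%E.
Proof.
move=> mA; have b0 : 0 < b%:R :> R by rewrite ltr0n.
have m01 := @measurable_unit_itv R.
have ms k := measurable_step1_preimage k mA.
rewrite /leb01 /mrestr; split=> [A0 k|h].
  apply/eqP; rewrite -measure_le0.
  have mA01 : measurable (A `&` `[0%R, 1%R[ : set TR) by exact: measurableI.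
  have := @affine_preimage_null b%:R^-1 (b%:R^-1 * k%:R) _ _ mA01 A0.
  rewrite invr_gt0 b0 -step1E => /(_ isT) <-.
  apply: le_measure; rewrite ?inE; first exact: measurableI.
    exact: measurable_step1_preimage.
  move=> x [Ax /=]; rewrite in_itv/= => /andP[x0 x1]; split => //=.
  rewrite in_itv/= /step1; apply/andP; split.
    by rewrite mulr_ge0 ?invr_ge0 ?addr_ge0 ?ler0n.
  rewrite mulrC ltr_pdivrMr// mul1r.
  have : k.+1%:R <= b%:R :> R by rewrite ler_nat.
  by rewrite -natr1; lra.
have mI k : measurable ((step1 k @^-1` A) `&` `[0%R, 1%R[ : set TR) by exact: measurableI.
have cover : A `&` `[0%R, 1%R[ `<=`
    \bigcup_(k in `I_b) ((fun x : TR => (b%:R * x + - k%:R)%R : TR) @^-1`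
      ((step1 k @^-1` A) `&` `[0%R, 1%R[)).
  move=> x [Ax /=]; rewrite in_itv/= => /andP[x0 x1].
  have bx0 : 0 <= b%:R * x by rewrite mulr_ge0 ?ler0n.
  have /andP[tl tu] := Num.Theory.truncn_itv bx0.
  exists (Num.truncn (b%:R * x)) => /=.
    rewrite -(ltr_nat R); apply: le_lt_trans tl _.
    by rewrite gtr_pMr.
  split=> /=; first by rewrite /step1 subrK mulrA mulVf ?gt_eqF// mul1r.
  by rewrite in_itv/= subr_ge0 tl ltrBlDr addrC natr1 tu.
apply/negligibleP; first exact: measurableI.
apply: negligibleS cover _.
rewrite bigcup_mkcond; apply: negligible_bigcup => k.
case: ifPn => [|_]; last exact: negligible_set0.
rewrite inE/= => kb; apply/negligibleP.
  rewrite -[X in measurable X]setTI.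
  exact: (measurable_affine b%:R (- k%:R)).
exact: (affine_preimage_null _ b0 (mI k) (h (Ordinal kb))).
Qed.

End step.
End affine_null_sets.

Section cube_null_sets.
Context {R : realType}.
Local Notation TR := (measurableTypeR R).

Lemma measurable_tcons_section n (A : set (n.+1.-tuple TR)) (x : TR) : measurable A ->
  measurable [set y : n.-tuple TR | A (tcons (x, y))].
Proof.
move=> mA; have : measurable (@tcons R n @^-1` A).
  by rewrite -[X in measurable X]setTI; exact: measurable_tcons.
move=> /(measurable_xsection x); rewrite /xsection.
by under eq_set do rewrite inE.
Qed.

Lemma cube_section_measurable n (A : set (n.+1.-tuple TR)) : measurable A ->
  measurable_fun setT (fun x : TR => cube R n [set y | A (tcons (x, y))]).
Proof.
move=> mA; have mA' : measurable (@tcons R n @^-1` A).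
  by rewrite -[X in measurable X]setTI; exact: measurable_tcons.
have := measurable_fun_xsection (cube R n) mA'.
by congr measurable_fun; apply/funext => x /=; congr (cube R n _);
  apply/seteqP; split => y; rewrite /xsection/= inE.
Qed.

Lemma cubeS_null n (A : set (n.+1.-tuple TR)) : measurable A ->
  cube R n.+1 A = 0%E <->
  \forall x \ae leb01 R, cube R n [set y | A (tcons (x, y))] = 0%E.
Proof.
move=> mA.
have -> : cube R n.+1 A = (\int[leb01 R]_x `|cube R n [set y | A (tcons (x, y))]|)%E.
  rewrite /= /distribution /pushforward /= /prod_prob /product_measure1.
  apply: eq_integral => x _ /=; rewrite gee0_abs//; congr (cube R n _).
  by apply/seteqP; split => y; rewrite /xsection/= inE.
have := ae_eq_integral_abs (leb01 R) measurableT (cube_section_measurable mA).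
by move=> ->; split; apply: filterS => x; [move=> /(_ I)|move=> h _].
Qed.

Section step.
Variable b : nat.
Hypothesis b_gt0 : (0 < b)%N.

Definition step D (k : nat -> nat) (x : D.-tuple TR) : D.-tuple TR :=
  [tuple step1 b (k j) (tnth x j) | j < D].

Lemma measurable_step D k : measurable_fun setT (@step D k).
Proof.
apply/measurable_fun_tnthP => j.
rewrite (_ : _ \o _ = step1 b (k j) \o (fun x : D.-tuple TR => tnth x j)); last first.
  by apply/funext => x /=; rewrite tnth_mktuple.
apply: measurableT_comp; first exact: measurable_step1.
exact: measurable_tnth.
Qed.

Lemma measurable_step_preimage D k (A : set (D.-tuple TR)) : measurable A ->
  measurable (@step D k @^-1` A).
Proof. by move=> mA; rewrite -[X in measurable X]setTI; exact: measurable_step. Qed.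

Lemma step_tcons n k (x : TR) (y : n.-tuple TR) :
  step k (tcons (x, y)) = tcons (step1 b (k 0%N) x : TR, step (fun j => k j.+1) y).
Proof.
apply: eq_from_tnth => i; rewrite tnth_mktuple.
have [->|[j ->]] : i = ord0 \/ exists j, i = lift ord0 j.
  by case: (unliftP ord0 i) => [j ->|->]; [right; exists j|left].
- by rewrite !(tnth_nth 0)/=.
- by rewrite /tcons !tnthS tnth_mktuple.
Qed.

Lemma ae_step1 (P : TR -> Prop) (k : 'I_b) :
  (\forall x \ae leb01 R, P x) -> \forall x \ae leb01 R, P (step1 b k x).
Proof.
move=> [B [mB B0 PB]]; exists (step1 b k @^-1` B); split.
- exact: measurable_step1_preimage.
- exact: (iffLR (leb01_step b_gt0 mB) B0 k).
- by move=> x /= ?; exact: PB.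
Qed.

(** Induction on the dimension by Fubini: null sets are those with almost all sections null. The
    first coordinate uses the one-dimensional statement, the section the induction hypothesis. *)
Lemma cube_step_null D (A : set (D.-tuple TR)) : measurable A ->
  cube R D A = 0%E <->
  forall k, (forall j, (k j < b)%N) -> cube R D (@step D k @^-1` A) = 0%E.
Proof.
elim: D A => [|n IH] A mA.
  have stepE k : @step 0 k @^-1` A = A.
    by apply/seteqP; split => x /=; rewrite (tuple0 (step k x)) (tuple0 x).
  by split=> [A0 k _|/(_ (fun=> 0%N) (fun=> b_gt0))]; rewrite stepE.
have msec x := measurable_tcons_section x mA.
have secE k x : [set y : n.-tuple TR | (@step n.+1 k @^-1` A) (tcons (x, y))] =
    @step n (fun j => k j.+1) @^-1` [set y | A (tcons (step1 b (k 0%N) x : TR, y))].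
  by apply/seteqP; split => y /=; rewrite step_tcons.
split=> [/(cubeS_null mA) A0 k kb|h].
  apply/cubeS_null; first exact: measurable_step_preimage.
  apply: (@filterS _ (almost_everywhere (leb01 R)) _ _ _ _ (ae_step1 (Ordinal (kb 0%N))
    A0)) => x /= Ax0.
  by rewrite secE; apply: (iffLR (IH _ _) Ax0) => // j; exact: kb.
apply/cubeS_null => //.
(* Restricting to finitely many digit vectors allows one exceptional null set of x for all of
   them. *)
pose ext (k : {ffun 'I_n -> 'I_b}) (j : nat) := oapp (fun i => nat_of_ord (k i)) 0%N
  (insub j).
have : \forall x \ae leb01 R, forall k : {ffun 'I_n -> 'I_b},
    cube R n (@step n (ext k) @^-1` [set y | A (tcons (x, y))]) = 0%E.
  apply: filter_forall => k; set k' := ext k.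
  have mk : measurable_fun setT (fun x : TR => cube R n (@step n k' @^-1`
      [set y | A (tcons (x, y))])).
    (* For measurability the preimages are written as sections of a single set: the preimage of [A]
       under the step acting on all coordinates but the first. *)
    rewrite (_ : (fun x : TR => _) = (fun x : TR => cube R n
      [set y | [set z | A (tcons (thead z : TR, step k' (behead_tuple z)))] (tcons (x,
        y))])).
      apply: cube_section_measurable.
      rewrite -[X in measurable X]setTI.
      suff : measurable_fun setT (fun z : n.+1.-tuple TR =>
          tcons (thead z : TR, step k' (behead_tuple z))) by exact.
      apply: measurable_cons; first exact: (@measurable_tnth _ TR n.+1 ord0).
      rewrite /=; apply: (@measurableT_comp _ _ _ _ _ _ (@step n k') _ (fun z :
        n.+1.-tuple TR => behead_tuple z)); first exact: measurable_step.
      apply/measurable_fun_tnthP => j.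
      rewrite (_ : _ \o _ = (fun z : n.+1.-tuple TR => tnth z (lift ord0 j))).
        exact: measurable_tnth.
      by apply/funext => z /=; rewrite tnth_behead; congr tnth; apply: val_inj;
        rewrite /= inordK// ltnS.
    apply/funext => x; congr (cube R n _).
    have bE (y : n.-tuple TR) : behead_tuple (tcons (x, y)) = y by apply: val_inj.
    have tE (y : n.-tuple TR) : thead (tcons (x, y)) = x by exact: theadE.
    by apply/seteqP; split => y; rewrite /= bE tE.
  pose B : set TR := [set x | cube R n (@step n k' @^-1` [set y | A (tcons (x, y))]) !=
    0%E].
  have mB : measurable B by rewrite -[B]setTI; exact: emeasurable_neq.
  exists B; split => //; last by move=> x /= /eqP.
  apply/(leb01_step b_gt0 mB) => k0.
  pose kk j := if j is j'.+1 then k' j' else k0 : nat.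
  have kkb j : (kk j < b)%N.
    by case: j => [|j] /=; [exact: ltn_ord|rewrite /k' /ext; case: insubP => //= i _ _;
      exact: ltn_ord].
  have /(cubeS_null (measurable_step_preimage kk mA)) := h kk kkb.
  move=> hk; apply/negligibleP; first exact: measurable_step1_preimage.
  apply: negligibleS hk => x /=; rewrite /B /= => /eqP Bx.
  by rewrite secE.
apply: filterS => x hx; apply/IH => // k kb.
have := hx [ffun j : 'I_n => Ordinal (kb j)].
congr (cube R n _ = _); apply/seteqP; split => y /=;
  congr A; congr (tcons (_, _)); apply: eq_mktuple => j;
  by rewrite /ext insubT ?ltn_ord//= => jn; rewrite ffunE.
Qed.

Lemma ae_step D (P : D.-tuple TR -> Prop) k : (forall j, (k j < b)%N) ->
  (\forall x \ae cube R D, P x) -> \forall x \ae cube R D, P (step k x).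
Proof.
move=> kb [B [mB B0 PB]]; exists (@step D k @^-1` B); split.
- exact: measurable_step_preimage.
- exact: (iffLR (cube_step_null mB) B0 k kb).
- by move=> x /= ?; exact: PB.
Qed.

(* [tmap] with digits read off an infinite word, so that levels can be
   composed without casts. *)
Definition wmap D L (w : nat -> nat) (x : D.-tuple TR) : D.-tuple TR :=
  [tuple b%:R ^- L *
     (\sum_(l < L) (w (l * D + j)%N)%:R * b%:R ^+ (L - l.+1) + tnth x j : R) | j < D].

Lemma tmapE D L (i : digits b D L) (w : nat -> nat) (x : D.-tuple TR) :
  (forall v, w (nat_of_ord v) = i v :> nat) -> tmap i x = wmap L w x.
Proof.
move=> wi; apply: eq_mktuple => j; rewrite /tmap1; congr (_ * (_ + _)).
by apply: eq_bigr => l _; rewrite -wi.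
Qed.

Lemma wmap0 D w (x : D.-tuple TR) : wmap 0 w x = x.
Proof.
apply: eq_from_tnth => j; rewrite tnth_mktuple.
by rewrite expr0 invr1 mul1r big_ord0 add0r.
Qed.

Lemma wmapS D L w (x : D.-tuple TR) :
  wmap L.+1 w x = wmap L w (step (fun j => w (L * D + j)%N) x).
Proof.
have b0 : b%:R != 0 :> R by rewrite pnatr_eq0 -lt0n.
apply: eq_mktuple => j; rewrite tnth_mktuple /step1 big_ord_recr/= subnn expr0 mulr1.
rewrite exprSr invfM -mulrA; congr (_ * _); rewrite -addrA mulrDr; congr (_ + _).
  rewrite mulr_sumr; apply: eq_bigr => l _.
  by rewrite mulrCA subSn//; congr (_ * _); rewrite exprS mulKf.
by rewrite addrC.
Qed.

Lemma measurable_wmap D L w : measurable_fun setT (@wmap D L w).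
Proof.
elim: L => [|L IH].
  by rewrite (_ : wmap 0 w = id)//; apply/funext => x; rewrite wmap0.
rewrite (_ : wmap L.+1 w = wmap L w \o @step D (fun j => w (L * D + j)%N)).
  by apply: measurableT_comp => //; exact: measurable_step.
by apply/funext => x; exact: wmapS.
Qed.

Lemma ae_wmap D L w (P : D.-tuple TR -> Prop) : (forall v, (w v < b)%N) ->
  (\forall x \ae cube R D, P x) -> \forall x \ae cube R D, P (wmap L w x).
Proof.
move=> wb; elim: L P => [|L IH] P aeP.
  by under eq_near do rewrite wmap0.
under eq_near do rewrite wmapS.
by apply: (@ae_step D (fun y => P (wmap L w y))) => //; exact: IH.
Qed.

Lemma wmap_null D L (A : set (D.-tuple TR)) : measurable A ->
  (forall w, (forall v, (w v < b)%N) -> cube R D (wmap L w @^-1` A) = 0%E) ->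
  cube R D A = 0%E.
Proof.
elim: L A => [|L IH] A mA h.
  have := h (fun=> 0%N) (fun=> b_gt0).
  by congr (cube R D _ = _); apply/seteqP; split => x /=; rewrite wmap0.
have mw w : measurable (@wmap D L w @^-1` A).
  by rewrite -[X in measurable X]setTI; exact: measurable_wmap.
apply: IH => // w wb; apply/cube_step_null => // k kb.
(* The digits [k] of the innermost step form the last level of the longer word. *)
pose w' v := if (v < L * D)%N then w v else k (v - L * D)%N.
have w'b v : (w' v < b)%N by rewrite /w'; case: ifP.
have := h w' w'b; congr (cube R D _ = _); apply/seteqP; split => x /=; rewrite wmapS;
  (suff -> : wmap L w' (step (fun j => w' (L * D + j)%N) x) = wmap L w (step k x) by []);
  apply: eq_mktuple => j; congr (_ * (_ + _));
  rewrite ?tnth_mktuple /w' ?ltnNge ?leq_addr/= ?addKn//;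
  apply: eq_bigr => l _; rewrite (_ : (_ < L * D)%N = true)//;
  by apply: (@leq_trans (l.+1 * D));
    rewrite ?leq_mul2r ?ltn_ord ?orbT// mulSn addnC ltn_add2r.
Qed.

End step.

Lemma ae_tnth D (P : TR -> Prop) (j : 'I_D) :
  (\forall x \ae leb01 R, P x) -> \forall x \ae cube R D, P (tnth x j).
Proof.
move=> [B [mB B0 PB]]; exists ((fun x : D.-tuple TR => tnth x j) @^-1` B); split;
  last 2 first.
- have mpre n (i : 'I_n) : measurable ((fun x : n.-tuple TR => tnth x i) @^-1` B).
    by rewrite -[X in measurable X]setTI; exact: measurable_tnth.
  elim: D j => [[]//|n IH] j.
  apply/cubeS_null => //.
  have [->|[i ->]] : j = ord0 \/ exists i, j = lift ord0 i.
    by case: (unliftP ord0 j) => [i ->|->]; [right; exists i|left].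
  + exists B; split => // x /= Bx; apply: contrapT => nBx; apply: Bx.
    rewrite (_ : [set _ | _] = set0) ?measure0//.
    by apply/seteqP; split => // y /=; rewrite (tnth_nth 0)/=.
  + apply: aeW => x; rewrite -[RHS](IH i); congr (cube R n _).
    by apply/seteqP; split => y /=; rewrite /tcons tnthS.
- by move=> x /= ?; exact: PB.
- by rewrite -[X in measurable X]setTI; exact: measurable_tnth.
Qed.

End cube_null_sets.

(** * Layered weighted automata *)

Section automata.
Context {R : comNzRingType}.

(* A layered weighted automaton: the states of layer [v] are [bond v], and
   reading the letter [j] at position [v] moves from [k] to [k'] with weight
   [core v k j k'].  A tensor train is such an automaton, with the entries of
   its cores as weights. *)
Record automaton := Automaton {
  state : finType ;
  bond : nat -> {set state} ;
  core : nat -> state -> nat -> state -> R }.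

Implicit Types (A B : automaton) (w : nat -> nat) (m : nat -> nat).

Fixpoint run A v w (g : state A -> R) t : state A -> R :=
  if t is t'.+1 then
    fun k' => \sum_(k in bond A (v + t')) run v w g t' k * core (v + t') k (w (v +
      t')%N) k'
  else g.

Definition forward A w := run 0 w (fun _ : state A => 1).

Definition value A N w := \sum_(k in bond A N) forward w N k.

Lemma forwardS A w v k' :
  @forward A w v.+1 k' = \sum_(k in bond A v) forward w v k * core v k (w v) k'.
Proof. by []. Qed.

Lemma run_add A v w (g : state A -> R) s t : run v w g (s + t) = run (v + s) w (run v w
  g s) t.
Proof.
elim: t => [|t IH]; first by rewrite addn0.
by rewrite addnS /= addnA IH.
Qed.

(** Linearity in the initial weights. For t = 0 it would fail at states outside the bond, where
    [run] still returns [g]. *)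
Lemma run_sum A v w (g : state A -> R) t : (0 < t)%N ->
  forall k', run v w g t k' = \sum_(k in bond A v) g k * run v w (fun x => (x == k)%:R)
    t k'.
Proof.
case: t => // t _; elim: t => [|t IH] k' /=.
  rewrite addn0; apply: eq_bigr => k kb; rewrite (bigD1 k)//= eqxx mul1r big1 ?addr0//.
  by move=> i /andP[_ /negPf ->]; rewrite mul0r.
under eq_bigr => k _ do rewrite [X in X * _]IH mulr_suml.
rewrite exchange_big/=; apply: eq_bigr => k _; rewrite mulr_sumr.
by apply: eq_bigr => i _; rewrite mulrA.
Qed.

Lemma eq_run A v w w' (g g' : state A -> R) t :
  (forall i, (v <= i < v + t)%N -> w i = w' i) -> g =1 g' ->
  run v w g t =1 run v w' g' t.
Proof.
elim: t => [|t IH] ww gg' k //=; apply: eq_bigr => i _; rewrite IH//; last first.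
  by move=> j /andP[vj jt]; apply: ww; rewrite vj addnS ltnS ltnW.
by rewrite ww// leq_addr addnS ltnSn.
Qed.

Lemma eq_value A N w w' : (forall v, (v < N)%N -> w v = w' v) -> value A N w = value A
  N w'.
Proof.
by move=> ww; apply: eq_bigr => k _; apply: eq_run => // i /andP[_]; exact: ww.
Qed.

Definition edges A m v : {set state A * 'I_(m v) * state A} :=
  [set e : state A * 'I_(m v) * state A | [&& e.1.1 \in bond A v, e.2 \in bond A v.+1 &
    core v e.1.1 e.1.2 e.2 != 0]]%SET.

Definition full_cost A m N : nat := (\sum_(v < N) #|bond A v| * m v * #|bond A v.+1|)%N.
Definition sparse_cost A m N : nat := (\sum_(v < N) #|edges A m v|)%N.

Lemma card_edges_le A m v : (#|edges A m v| <= #|bond A v| * m v * #|bond A v.+1|)%N.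
Proof.
apply: (@leq_trans #|finset.setX (finset.setX (bond A v) [set: 'I_(m v)]%SET) (bond A
  v.+1)|).
  by apply: subset_leq_card; apply/fintype.subsetP => e; rewrite !inE => /and3P[-> ->].
by rewrite !cardsX cardsT card_ord.
Qed.

Lemma sparse_le_full A m N : (sparse_cost A m N <= full_cost A m N)%N.
Proof. by apply: leq_sum => v _; exact: card_edges_le. Qed.

Definition valid m N w := forall v, (v < N)%N -> (w v < m v)%N.

(** A layer without edges annihilates the forward weights from there on. Counting one edge per layer
    then bounds the number of cores. *)
Lemma value_neq0_edge A m N w v : valid m N w -> value A N w != 0 -> (v < N)%N ->
  (0 < #|edges A m v|)%N.
Proof.
move=> wm nz vN; rewrite lt0n; apply: contra nz; rewrite cards_eq0 => /eqP e0.
have fz k' : k' \in bond A v.+1 -> forward w v.+1 k' = 0.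
  move=> k'b; rewrite forwardS big1// => k kb.
  have /setP/(_ (k, Ordinal (wm v vN), k')) := e0.
  by rewrite !inE kb k'b /= => /negbFE/eqP ->; rewrite mulr0.
have fz' t k' : k' \in bond A (v.+1 + t) -> forward w (v.+1 + t) k' = 0.
  elim: t k' => [|t IH] k'; first by rewrite addn0; exact: fz.
  by rewrite addnS => _; rewrite forwardS big1// => k /IH ->; rewrite mul0r.
by apply/eqP; rewrite /value big1// => k; rewrite -(subnKC vN); exact: fz'.
Qed.

Lemma edges_gt0_bond A m v : (0 < #|edges A m v|)%N ->
  [/\ (0 < #|bond A v|)%N, (0 < m v)%N & (0 < #|bond A v.+1|)%N].
Proof. by move=> /leq_trans/(_ (card_edges_le A m v));
  rewrite !muln_gt0 => /andP[/andP[]]. Qed.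

Lemma leq_sparse_cost A m N w : valid m N w -> value A N w != 0 -> (N <= sparse_cost A
  m N)%N.
Proof.
move=> wm nz; rewrite -[leqLHS]card_ord -sum1_card; apply: leq_sum => v _.
exact: value_neq0_edge wm nz _.
Qed.

Section sum.
Variables A B : automaton.

Definition sum_automaton : automaton := {|
  state := (state A + state B)%type ;
  bond v := inl @: bond A v :|: inr @: bond B v ;
  core v x j y := match x, y with
    | inl k, inl k' => core v k j k'
    | inr k, inr k' => core v k j k'
    | _, _ => 0 end |}.

Lemma in_sum_bondl v k : (inl k \in bond sum_automaton v) = (k \in bond A v).
Proof.
rewrite !inE mem_imset; last by move=> ? ? [].
by rewrite orbC; case: imsetP => // -[].
Qed.

Lemma in_sum_bondr v k : (inr k \in bond sum_automaton v) = (k \in bond B v).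
Proof.
rewrite !inE mem_imset; last by move=> ? ? [].
by case: imsetP => // -[].
Qed.

Lemma big_sum_bond v (F : state sum_automaton -> R) :
  \sum_(x in bond sum_automaton v) F x =
  \sum_(k in bond A v) F (inl k) + \sum_(k in bond B v) F (inr k).
Proof.
by rewrite big_sumType; congr (_ + _); apply: eq_bigl => k;
  rewrite ?in_sum_bondl ?in_sum_bondr.
Qed.

Lemma card_sum_bond v : #|bond sum_automaton v| = (#|bond A v| + #|bond B v|)%N.
Proof.
rewrite /= cardsU !card_imset; try by move=> x y [].
rewrite (_ : _ :&: _ = finset.set0) ?cards0 ?subn0//; apply/setP => x; rewrite !inE.
by apply/negP => /andP[/imsetP[k _ ->]] /imsetP[].
Qed.

Lemma value_sum N w : value sum_automaton N w = value A N w + value B N w.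
Proof.
have fE v : (forall k, @forward sum_automaton w v (inl k) = forward w v k) /\
            (forall k, @forward sum_automaton w v (inr k) = forward w v k).
  elim: v => [//|v [IHA IHB]].
  split=> k; rewrite !forwardS big_sum_bond/=.
    under eq_bigr do rewrite IHA.
    by rewrite [X in _ + X]big1 ?addr0// => i _; rewrite mulr0.
  under [X in _ + X]eq_bigr do rewrite IHB.
  by rewrite [X in X + _]big1 ?add0r// => i _; rewrite mulr0.
rewrite /value big_sum_bond; have [fA fB] := fE N.
by congr (_ + _); apply: eq_bigr => k _; rewrite ?fA ?fB.
Qed.

Lemma sparse_cost_sum m N :
  (sparse_cost sum_automaton m N <= sparse_cost A m N + sparse_cost B m N)%N.
Proof.
rewrite -big_split/=; apply: leq_sum => v _.
pose fA (e : state A * 'I_(m v) * state A) : state sum_automaton * 'I_(m v) * state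
  sum_automaton :=
  (inl e.1.1, e.1.2, inl e.2).
pose fB (e : state B * 'I_(m v) * state B) : state sum_automaton * 'I_(m v) * state
  sum_automaton :=
  (inr e.1.1, e.1.2, inr e.2).
apply: (@leq_trans #|fA @: edges A m v :|: fB @: edges B m v|).
  apply: subset_leq_card; apply/fintype.subsetP => -[[[k|k] j] [k'|k']];
    rewrite inE /= ?in_sum_bondl ?in_sum_bondr => /and3P[kb k'b]; rewrite ?eqxx// => nz;
    apply/finset.setUP; [left|right]; apply/imsetP; exists (k, j, k') => //;
    by rewrite inE /= kb k'b.
apply: leq_trans (leq_card_setU _ _) _.
by apply: leq_add; exact: leq_imset_card.
Qed.

End sum.

(* The cost of a direct sum contains cross terms #|bond A v| * #|bond B v.+1|,
   which are controlled by the costs of [A] and [B] only when neighbouring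
   bonds have comparable sizes. *)
Definition balanced A m N := forall v, (v < N)%N ->
  (#|bond A v.+1| <= m v * #|bond A v|)%N /\ (#|bond A v| <= m v * #|bond A v.+1|)%N.

Lemma full_cost_sum A B m M N : (forall v, (v < N)%N -> (m v <= M)%N) ->
  balanced A m N -> balanced B m N ->
  (full_cost (sum_automaton A B) m N <= (2 * M).+1 * (full_cost A m N + full_cost B m
    N))%N.
Proof.
move=> mM bA bB; rewrite -big_split/= big_distrr/=; apply: leq_sum => v _.
rewrite !card_sum_bond.
have [A1 A2] := bA v (ltn_ord v); have [B1 B2] := bB v (ltn_ord v).
have mv := mM v (ltn_ord v).
set r1 := #|bond A v| in A1 A2 *; set s1 := #|bond A v.+1| in A1 A2 *.
set r2 := #|bond B v| in B1 B2 *; set s2 := #|bond B v.+1| in B1 B2 *.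
(* Each cross term becomes two squares, and balance bounds a square by [M] times the product of the
   bonds of its own summand. Every one of the four squares occurs once, whence 2M + 1. *)
have amgm x y : (x * y <= x * x + y * y)%N by nia.
have h1 : (r1 * r1 <= M * (r1 * s1))%N.
  rewrite mulnCA leq_mul2l; apply/orP; right.
  by apply: leq_trans A2 _; rewrite leq_mul2r mv orbT.
have h2 : (s1 * s1 <= M * (r1 * s1))%N.
  rewrite mulnA leq_mul2r; apply/orP; right.
  by apply: leq_trans A1 _; rewrite leq_mul2r mv orbT.
have h3 : (r2 * r2 <= M * (r2 * s2))%N.
  rewrite mulnCA leq_mul2l; apply/orP; right.
  by apply: leq_trans B2 _; rewrite leq_mul2r mv orbT.
have h4 : (s2 * s2 <= M * (r2 * s2))%N.
  rewrite mulnA leq_mul2r; apply/orP; right.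
  by apply: leq_trans B1 _; rewrite leq_mul2r mv orbT.
have h5 := amgm r1 s2; have h6 := amgm r2 s1.
have -> : ((r1 + r2) * m v * (s1 + s2) = m v * (r1 * s1 + r2 * s2 + r1 * s2 + r2 *
  s1))%N by lia.
have -> : ((2 * M).+1 * (r1 * m v * s1 + r2 * m v * s2) =
  m v * (r1 * s1 + r2 * s2 + M * (r1 * s1) + M * (r2 * s2) + M * (r1 * s1) + M * (r2 *
    s2)))%N by lia.
rewrite leq_mul2l; apply/orP; right; lia.
Qed.

Section replace_bond.
Variables (A : automaton) (v : nat) (Y : finType).
Variables (C : state A -> nat -> Y -> R) (C' : Y -> nat -> state A -> R).

Definition replace_bond : automaton := {|
  state := (state A + Y)%type ;
  bond u := if u == v.+1 then inr @: [set: Y]%SET else inl @: bond A u ;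
  core u x j y := match x, y with
    | inl k, inl k' => core u k j k'
    | inl k, inr y => C k j y
    | inr y, inl k => C' y j k
    | _, _ => 0 end |}.

Lemma card_replace_bond u :
  #|bond replace_bond u| = if u == v.+1 then #|Y| else #|bond A u|.
Proof.
by rewrite /=; case: ifP => _; rewrite card_imset ?cardsT//; move=> x y [].
Qed.

Lemma big_replace_bond u (F : state replace_bond -> R) :
  \sum_(x in bond replace_bond u) F x =
  if u == v.+1 then \sum_y F (inr y) else \sum_(k in bond A u) F (inl k).
Proof.
rewrite /=; case: ifP => _; rewrite big_imset//=; try by move=> x y _ _ [].
by apply: eq_bigl => y; rewrite inE.
Qed.

(** Values see two adjacent cores only through their product, so the bond between them can be
    changed as long as that product is kept. *)
Lemma value_replace_bond N w : (v.+1 < N)%N ->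
  (forall k k', k \in bond A v -> k' \in bond A v.+2 ->
    \sum_(l in bond A v.+1) core v k (w v) l * core v.+1 l (w v.+1) k' =
    \sum_y C k (w v) y * C' y (w v.+1) k') ->
  value replace_bond N w = value A N w.
Proof.
move=> vN hC.
have fE u : u != v.+1 -> forall k, k \in bond A u ->
    @forward replace_bond w u (inl k) = forward w u k.
  elim/ltn_ind: u => -[//|u] IH uv k kb; rewrite !forwardS big_replace_bond.
  case: ifPn => [/eqP uE|uv']; last first.
    by apply: eq_bigr => l lb; rewrite IH.
  rewrite uE in kb *; transitivity (\sum_y \sum_(l in bond A v)
      forward w v l * (C l (w v) y * C' y (w v.+1) k)).
    apply: eq_bigr => y _; rewrite forwardS big_replace_bond ltn_eqF// mulr_suml.
    by apply: eq_bigr => l lb; rewrite /= IH ?uE ?ltn_eqF// mulrA.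
  rewrite exchange_big/=.
  transitivity (\sum_(i in bond A v) forward w v i *
      \sum_(l in bond A v.+1) core v i (w v) l * core v.+1 l (w v.+1) k).
    by apply: eq_bigr => i ib; rewrite hC// mulr_sumr.
  under [RHS]eq_bigr => l _ do rewrite forwardS mulr_suml.
  rewrite [RHS]exchange_big/=; apply: eq_bigr => i ib; rewrite mulr_sumr.
  by apply: eq_bigr => l _; rewrite mulrA.
rewrite /value big_replace_bond gtn_eqF//; apply: eq_bigr => k kb.
by rewrite fE// gtn_eqF.
Qed.

Lemma full_cost_replace_bond m N : (#|Y| <= #|bond A v.+1|)%N ->
  (full_cost replace_bond m N <= full_cost A m N)%N.
Proof.
move=> Yb; have le u : (#|bond replace_bond u| <= #|bond A u|)%N.
  by rewrite card_replace_bond; case: ifP => // /eqP ->.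
by apply: leq_sum => u _; rewrite !leq_mul.
Qed.

End replace_bond.

(* A bond wider than the number of incoming (letter, state) pairs can be
   replaced by these pairs, and symmetrically for outgoing pairs. *)
Lemma balance A m N w0 : valid m N w0 -> value A N w0 != 0 ->
  #|bond A 0| = 1%N -> #|bond A N| = 1%N ->
  exists B, [/\ #|bond B 0| = 1%N, #|bond B N| = 1%N,
    forall w, valid m N w -> value B N w = value A N w,
    (full_cost B m N <= full_cost A m N)%N & balanced B m N].
Proof.
(* Induction on the total bond size, which drops at each replacement. *)
move=> w0m; move: {2}(\sum_(u < N.+1) #|bond A u|)%N (leqnn (\sum_(u < N.+1) #|bond A
  u|)%N) => s.
elim: s A => [|s IH] A As nz A0 AN.
  move: As; rewrite leqn0 sum_nat_eq0 => /forallP/(_ ord0).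
  by rewrite /= A0.
have reduce (v : nat) (Y : finType) (C : state A -> nat -> Y -> R) C' :
    (v.+1 < N)%N -> (#|Y| < #|bond A v.+1|)%N ->
    (forall w, valid m N w -> forall k k', k \in bond A v -> k' \in bond A v.+2 ->
      \sum_(l in bond A v.+1) core v k (w v) l * core v.+1 l (w v.+1) k' =
      \sum_y C k (w v) y * C' y (w v.+1) k') ->
    exists B, [/\ #|bond B 0| = 1%N, #|bond B N| = 1%N,
      forall w, valid m N w -> value B N w = value A N w,
      (full_cost B m N <= full_cost A m N)%N & balanced B m N].
  move=> vN Yb hC; pose A' := replace_bond v C C'.
  have valE w : valid m N w -> value A' N w = value A N w.
    by move=> wm; apply: value_replace_bond => //; exact: hC.
  have [||||B [B0 BN Bval Bcost Bbal]] := IH A'.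
  - rewrite -ltnS; apply: leq_trans As.
    have vN' : (v.+1 < N.+1)%N by exact: ltnW.
    rewrite (bigD1 (Ordinal vN'))// [ltnRHS](bigD1 (Ordinal vN'))// card_replace_bond.
    rewrite [X in (X + _ < _)%N]ifT ?eqxx// -addSn leq_add//.
    apply: leq_sum => u uv; rewrite card_replace_bond ifN//.
  - by rewrite valE.
  - by rewrite card_replace_bond.
  - by rewrite card_replace_bond gtn_eqF.
  exists B; split=> //; first by move=> w wm; rewrite Bval ?valE.
  by apply: leq_trans Bcost _; apply: full_cost_replace_bond; exact: ltnW.
have [/existsP[v]|] := boolP [exists v : 'I_N, (v.+1 < N)%N &&
    ((m v * #|bond A v| < #|bond A v.+1|)%N || (m v.+1 * #|bond A v.+2| < #|bond A
      v.+1|)%N)].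
  case/andP=> vN /orP[lt|lt].
  - pose Y : finType := ('I_(#|bond A v|) * 'I_(m v))%type.
    (* The left core only records the pair of state and letter; the right core takes over the
       product of the two old cores. The other case is the mirror image. *)
    apply: (reduce v Y (fun k j y => ((k == enum_val y.1) && (j == y.2 :> nat))%:R)
      (fun y j k' => \sum_(l in bond A v.+1) core v (enum_val y.1) y.2 l * core v.+1 l
        j k')) => //.
      by rewrite card_prod !card_ord mulnC.
    move=> w wm k k' kb k'b; have wv : (w v < m v)%N by apply: wm; exact: ltnW.
    rewrite (bigD1 (enum_rank_in kb k, Ordinal wv))//= enum_rankK_in// !eqxx mul1r.
    rewrite [X in _ = _ + X]big1 ?addr0// => -[a j] /= ne;
      case: andP => [[/eqP ka /eqP wj]|]; last by rewrite mul0r.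
    case/eqP: ne; congr (_, _); last exact: val_inj.
    by apply: enum_val_inj; rewrite enum_rankK_in.
  - pose Y : finType := ('I_(m v.+1) * 'I_(#|bond A v.+2|))%type.
    apply: (reduce v Y (fun k i y => \sum_(l in bond A v.+1) core v k i l * core v.+1 l
      y.1 (enum_val y.2))
      (fun y j k' => ((k' == enum_val y.2) && (j == y.1 :> nat))%:R)) => //.
      by rewrite card_prod !card_ord.
    move=> w wm k k' kb k'b; have wv : (w v.+1 < m v.+1)%N by exact: wm.
    rewrite (bigD1 (Ordinal wv, enum_rank_in k'b k'))//= enum_rankK_in// !eqxx mulr1.
    rewrite [X in _ = _ + X]big1 ?addr0// => -[j a] /= ne;
      case: andP => [[/eqP ka /eqP wj]|]; last by rewrite mulr0.
    case/eqP: ne; congr (_, _); first exact: val_inj.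
    by apply: enum_val_inj; rewrite enum_rankK_in.
(* No inner bond is too wide any more. End bonds are never replaced, but they have size 1, and the
   non-zero value makes every alphabet and bond non-empty. *)
move=> /existsPn red; exists A; split => // v vN.
have [b0 m0 b1] := edges_gt0_bond (value_neq0_edge w0m nz vN).
split.
- have [vN'|] := ltnP v.+1 N.
    by have := red (Ordinal vN); rewrite /= vN' negb_or -!leqNgt => /andP[].
  move=> Nv; have -> : v.+1 = N by apply/eqP; rewrite eqn_leq vN.
  by rewrite AN muln_gt0 m0.
- case: v vN b0 m0 b1 => [|v] vN b0 m0 b1; first by rewrite A0 muln_gt0 m0.
  by have := red (Ordinal (ltnW vN)); rewrite /= vN negb_or -!leqNgt => /andP[].
Qed.

Section merge_ends.
Variables (A : automaton) (N : nat).

Definition rep v (x : option (state A)) : {set state A} :=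
  if x is Some k then [set k]%SET else bond A v.

Definition inner v := (0 < v < N)%N.

(** Restores rank 1 at both ends, where a direct sum has rank 2. As [value] sums over all initial
    and final states, [None] can stand for a whole end layer. *)
Definition merge_ends : automaton := {|
  state := option (state A) ;
  bond v := if inner v then Some @: bond A v else [set None]%SET ;
  core v x j y := \sum_(k in rep v x) \sum_(k' in rep v.+1 y) core v k j k' |}.

Lemma card_merge_ends v :
  #|bond merge_ends v| = if inner v then #|bond A v| else 1%N.
Proof.
by rewrite /=; case: ifP => _; rewrite ?cards1// card_imset//; exact: Some_inj.
Qed.

Lemma big_merge_ends v (F : state merge_ends -> R) :
  \sum_(x in bond merge_ends v) F x =
  if inner v then \sum_(k in bond A v) F (Some k) else F None.
Proof.
rewrite /=; case: ifP => _; last by rewrite big_set1.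
by rewrite big_imset//= => x y _ _ [].
Qed.

Lemma value_merge_ends w : (0 < N)%N -> value merge_ends N w = value A N w.
Proof.
move=> N0.
(* The test function [G] is needed because at layer 0 the two automata agree only after summation
   over the states that [None] represents. *)
have fE v (G : state A -> R) : (v < N)%N ->
    \sum_(x in bond merge_ends v) @forward merge_ends w v x * \sum_(k in rep v x) G k =
    \sum_(k in bond A v) forward w v k * G k.
  elim: v G => [|v IH] G vN; first by rewrite big_merge_ends/= mul1r;
    under [RHS]eq_bigr do rewrite mul1r.
  rewrite big_merge_ends /inner vN/=; apply: eq_bigr => k kb; rewrite big_set1;
    congr (_ * _).
  rewrite [LHS]IH ?(ltnW vN)// forwardS.
  by apply: eq_bigr => l _; rewrite big_set1.
rewrite /value big_merge_ends /inner ltnn andbF.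
case: N N0 fE => // n _ fE; rewrite forwardS fE//=.
under [RHS]eq_bigr do rewrite forwardS.
rewrite [RHS]exchange_big/=; apply: eq_bigr => k _; rewrite mulr_sumr//.
Qed.

Lemma full_cost_merge_ends m : (0 < #|bond A 0|)%N -> (0 < #|bond A N|)%N ->
  (full_cost merge_ends m N <= full_cost A m N)%N.
Proof.
move=> A0 AN; have le v : (v <= N)%N -> (#|bond merge_ends v| <= #|bond A v|)%N.
  rewrite leq_eqVlt card_merge_ends /inner => /predU1P[->|vN];
    first by rewrite ltnn andbF.
  by case: v vN => [|v] ->.
by apply: leq_sum => v _; rewrite !leq_mul// le// ltnW.
Qed.

Lemma sparse_cost_merge_ends m : (sparse_cost merge_ends m N <= sparse_cost A m N)%N.
Proof.
apply: leq_sum => v _.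
pose cl u (k : state A) : state merge_ends := if inner u then Some k else None.
pose f (e : state A * 'I_(m v) * state A) : state merge_ends * 'I_(m v) * state
  merge_ends :=
  (cl v e.1.1, e.1.2, cl v.+1 e.2).
apply: (@leq_trans #|f @: edges A m v|); last exact: leq_imset_card.
apply: subset_leq_card; apply/fintype.subsetP => -[[x j] y];
  rewrite inE /= -/(bond merge_ends v) => /and3P[xb yb nz].
have [k kr [k' k'r nz']] : exists2 k, k \in rep v x & exists2 k', k' \in rep v.+1 y &
  core v k j k' != 0.
  apply: contrapT => h; case/eqP: nz; rewrite big1// => k kr; rewrite big1// => k' k'r.
  by apply/eqP; apply: contrapT => /negP nz; apply: h; exists k => //; exists k'.
have clP u z l : z \in bond merge_ends u -> l \in rep u z -> l \in bond A u /\ z = cl u l.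
  rewrite /= /cl; case: ifP => _.
    by move=> /imsetP[l' l'b ->]; rewrite inE => /eqP ->.
  by rewrite inE => /eqP ->.
have [kb xE] := clP v x k xb kr; have [k'b yE] := clP v.+1 y k' yb k'r; rewrite xE yE.
by apply/imsetP; exists (k, j, k') => //; rewrite inE /= kb k'b.
Qed.

End merge_ends.

Section prune.
Variables (A : automaton) (m : nat -> nat).

Definition prune : automaton := {|
  state := state A ;
  bond v := if v is u.+1 then
      [set k' in bond A v | [exists e : state A * 'I_(m u), (e.1 \in bond A u) &&
        (core u e.1 e.2 k' != 0)]]%SET
    else bond A v ;
  core := @core A |}.

Lemma value_prune N w : valid m N w -> value prune N w = value A N w.
Proof.
move=> wm.
have sub v k : k \in bond prune v -> k \in bond A v.
  by case: v => // v; rewrite inE => /andP[].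
have f0 v k : (v <= N)%N -> k \in bond A v -> k \notin bond prune v -> @forward A w v k
  = 0.
  case: v => [|v] vN kb; first by rewrite /= kb.
  rewrite inE kb/= => /existsPn h; rewrite forwardS big1// => l lb.
  have := h (l, Ordinal (wm v vN)); rewrite /= lb/= => /negPn/eqP ->.
  by rewrite mulr0.
have big v (G : state A -> R) : (v <= N)%N ->
    \sum_(k in bond prune v) @forward A w v k * G k = \sum_(k in bond A v) forward w v
      k * G k.
  move=> vN; pose P k := k \in bond prune v.
    rewrite [RHS](bigID P)/= [X in _ + X]big1 ?addr0.
    apply: (@eq_bigl _ _ _ (state A)) => k; apply/idP/andP => [kp|[]//]; split=> //;
      exact: sub.
  by move=> k /andP[kb kp]; rewrite f0// mul0r.
have fE v : (v <= N)%N -> forall k, @forward prune w v k = @forward A w v k.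
  elim: v => [//|v IH] vN k; rewrite !forwardS.
  under eq_bigr do rewrite IH ?(ltnW vN)//.
  by rewrite big// ltnW.
rewrite /value; transitivity (\sum_(k in bond prune N) @forward A w N k * 1).
  by apply: eq_bigr => k _; rewrite fE// mulr1.
by rewrite (big N (fun=> 1))//; apply: eq_bigr => k _; rewrite mulr1.
Qed.

Lemma card_prune v : (#|bond prune v.+1| <= #|edges A m v|)%N.
Proof.
apply: (@leq_trans #|(fun e => e.2) @: edges A m v|); last exact: leq_imset_card.
apply: subset_leq_card; apply/fintype.subsetP => k;
  rewrite inE => /andP[kb /existsP[[l j] /= /andP[lb nz]]].
by apply/imsetP; exists (l, j, k) => //; rewrite inE /= lb kb.
Qed.

(** One bond of a core is bounded by the whole sparse cost, the other by the edges of that core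
    alone; summing over the cores gives a square, without a factor for their number. *)
Lemma full_cost_prune N M : (forall v, (v < N)%N -> (m v <= M)%N) ->
  #|bond A 0| = 1%N -> (0 < sparse_cost A m N)%N ->
  (full_cost prune m N <= M * sparse_cost A m N ^ 2)%N.
Proof.
move=> mM A0 S0; set n := sparse_cost A m N.
rewrite -mulnn mulnA {2}/n /sparse_cost big_distrr/=; apply: leq_sum => v _.
apply: leq_mul; last exact: card_prune.
rewrite mulnC leq_mul ?mM//; case: v => -[|v] vN /=; first by rewrite A0.
apply: leq_trans (card_prune v) _.
by rewrite /n /sparse_cost (bigD1 (Ordinal (ltnW vN)))//= leq_addr.
Qed.

Lemma prune_ends N w : valid m N w -> value A N w != 0 ->
  #|bond A 0| = 1%N -> #|bond A N| = 1%N ->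
  #|bond prune 0| = 1%N /\ #|bond prune N| = 1%N.
Proof.
move=> wm nz A0 AN; split => //; apply/eqP; rewrite eqn_leq; apply/andP; split.
  rewrite -AN; apply: subset_leq_card; apply/fintype.subsetP => k.
  by case: (N) => // v; rewrite inE => /andP[].
rewrite lt0n; apply: contra nz; rewrite cards_eq0 -value_prune// => /eqP e0.
by rewrite /value e0 big_set0.
Qed.

End prune.

End automata.

(** * Refinement of an automaton to a finer level *)

Section extend.
Context {R : comNzRingType}.
Variables (D d : nat) (a : nat -> nat -> nat -> R).
Hypothesis D_gt0 : (0 < D)%N.
Local Notation X := {ffun 'I_D -> 'I_d}.

Definition letters (n : X) (j : nat) : nat := oapp (fun i => nat_of_ord (n i)) 0%N
  (insub j).

Lemma lettersE (n : X) (j : 'I_D) : letters n j = n j.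
Proof. by rewrite /letters valK. Qed.

Definition wcat P (w : nat -> nat) (n : X) v := if (v < P)%N then w v else letters n (v
  - P).

Lemma wcat_addl P w n j : wcat P w n (P + j)%N = letters n j.
Proof. by rewrite /wcat ltnNge leq_addr addKn. Qed.

(** The matrix that re-expands factor [j] of a product of basis functions after the dilation with
    digit [i], where [a] holds the coefficients of a dilated basis function. *)
Definition refine1 (i j : nat) (n q : X) : R :=
  \prod_(j' < D) (if j' == j :> nat then a i (n j') (q j') else (n j' == q j')%:R).

Definition refine (w : nat -> nat) t (n q : X) : R :=
  \prod_(j' < D) (if (j' < t)%N then a (w j') (n j') (q j') else (n j' == q j')%:R).

Lemma refine0 w (n q : X) : refine w 0 n q = (n == q)%:R.
Proof.
rewrite /refine; have [->|nq] := eqVneq n q.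
  by rewrite big1// => j _; rewrite eqxx.
have [j nqj] : exists j, n j != q j.
  by apply/existsP; apply: contraNT nq => /existsPn h; apply/eqP/ffunP => j;
    apply/eqP/negPn.
by rewrite (bigD1 j)//= (negPf nqj) mul0r.
Qed.

Lemma refineS w t (n q : X) :
  refine w t.+1 n q = \sum_p refine w t n p * refine1 (w t) t p q.
Proof.
rewrite /refine /refine1; under [RHS]eq_bigr => p _ do rewrite -big_split/=.
rewrite -(bigA_distr_bigA (fun (j' : 'I_D) (p' : 'I_d) =>
  (if (j' < t)%N then a (w j') (n j') p' else (n j' == p')%:R) *
  (if j' == t :> nat then a (w t) p' (q j') else (p' == q j')%:R))).
apply: eq_bigr => j _; rewrite ltnS leq_eqVlt.
have [->/=|jt/=] := eqVneq (j : nat) t.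
  rewrite ltnn (bigD1 (n j))//= eqxx mul1r big1 ?addr0// => p /negPf pn.
  by rewrite eq_sym pn mul0r.
rewrite (bigD1 (q j))//= eqxx mulr1 big1 ?addr0// => p /negPf pq.
by rewrite pq mulr0.
Qed.

Section automaton.
Variables (A : automaton (R := R)) (P P' : nat).
Hypothesis PP' : (P < P')%N.
Hypothesis DP : (D %| P)%N.

Definition tail (k : state A) (n : X) : R :=
  \sum_(k' in bond A (P + D)) run P (wcat P (fun=> 0%N) n) (fun x => (x == k)%:R) D k'.

(* The first new digit core absorbs all the variable cores of [A]; from there
   on the state is the multi-index of the current product of basis functions,
   which each digit core refines in one coordinate and which the final cores
   compare with the letters read. *)
Definition extend : automaton := {|
  state := (state A + X)%type ;
  bond v := if (v <= P)%N then inl @: bond A v else inr @: [set: X]%SET ;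
  core v x j y := match x, y with
    | inl k, inl k' => core v k j k'
    | inl k, inr q => \sum_n tail k n * refine1 j 0 n q
    | inr n, inr q => if (v < P')%N then refine1 j (v %% D) n q
                      else ((n == q) && (letters n (v - P') == j))%:R
    | _, _ => 0 end |}.

Lemma card_extend v : #|bond extend v| = if (v <= P)%N then #|bond A v| else #|{: X}|.
Proof.
by rewrite /=; case: ifP => _; rewrite card_imset ?cardsT//; move=> x y [].
Qed.

Lemma big_extend v (F : state extend -> R) :
  \sum_(x in bond extend v) F x =
  if (v <= P)%N then \sum_(k in bond A v) F (inl k) else \sum_n F (inr n).
Proof.
rewrite /=; case: ifP => _; rewrite big_imset//=; try by move=> x y _ _ [].
by apply: eq_bigl => y; rewrite inE.
Qed.

(* [coefs w t] are the coefficients, in products of basis functions, of the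
   tensorization after [t] digits beyond position [P]. *)
Fixpoint coefs (w : nat -> nat) t : X -> R :=
  if t is t'.+1 then
    fun q => \sum_n coefs w t' n * refine1 (w (P + t')%N) ((P + t') %% D) n q
  else fun n => value A (P + D) (wcat P w n).

Lemma value_tail w n :
  value A (P + D) (wcat P w n) = \sum_(k in bond A P) forward w P k * tail k n.
Proof.
rewrite /value /forward run_add add0n.
under eq_bigr => k _ do rewrite run_sum//.
rewrite exchange_big/=; apply: eq_bigr => k _; rewrite /tail mulr_sumr.
apply: eq_bigr => k' _; congr (_ * _).
  by apply: eq_run => // i /andP[_ iP]; rewrite /wcat iP.
by apply: eq_run => // i /andP[iP _]; rewrite /wcat ltnNge iP.
Qed.

(** As D divides both [P] and [t], the next D digits refine the coordinates 0, ..., D - 1 once each,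
    which amounts to one dilation of all factors. *)
Lemma coefs_level w t : (D %| t)%N -> forall q,
  coefs w (t + D) q = \sum_n coefs w t n * \prod_(j < D) a (w (P + t + j)%N) (n j) (q j).
Proof.
move=> Dt.
have h s q : (s <= D)%N -> coefs w (t + s) q =
    \sum_n coefs w t n * refine (fun j => w (P + t + j)%N) s n q.
  elim: s q => [|s IH] q sD.
    rewrite addn0 (bigD1 q)//= refine0 eqxx mulr1 big1 ?addr0// => n /negPf nq.
    by rewrite refine0 nq mulr0.
  rewrite addnS /=.
  have -> : ((P + (t + s)) %% D = s)%N.
    by rewrite addnA -modnDml (eqP (dvdn_add DP Dt)) add0n modn_small.
  under eq_bigr => n _ do rewrite IH ?(ltnW sD)// mulr_suml.
  rewrite exchange_big/=; apply: eq_bigr => n _.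
  rewrite refineS mulr_sumr; apply: eq_bigr => p _.
  by rewrite -mulrA addnA.
move=> q; rewrite h//; apply: eq_bigr => n _; congr (_ * _).
by apply: eq_bigr => j _; rewrite ltn_ord.
Qed.

Lemma value_extend w n :
  value extend (P' + D) (wcat P' w n) = coefs w (P' - P) n.
Proof.
set w' := wcat P' w n.
have w'w v : (v < P')%N -> w' v = w v by rewrite /w' /wcat => ->.
have fl v k : (v <= P)%N -> @forward _ extend w' v (inl k) = forward w v k.
  elim: v k => [//|v IH] k vP; rewrite !forwardS big_extend (ltnW vP)/=.
  apply: eq_bigr => l _; rewrite IH ?(ltnW vP)// w'w//.
  exact: ltn_trans vP PP'.
have fr t q : (P + t.+1 <= P')%N -> @forward _ extend w' (P + t.+1) (inr q) = coefs w
  t.+1 q.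
  elim: t q => [|t IH] q tP'; rewrite addnS forwardS big_extend.
    rewrite addn0 leqnn /= addn0.
    have -> : (P %% D = 0)%N by exact/eqP.
    under eq_bigr => k _ do rewrite fl// mulr_sumr.
    rewrite exchange_big/=; apply: eq_bigr => m _.
    rewrite value_tail mulr_suml; apply: eq_bigr => k _.
    by rewrite w'w// mulrA.
  rewrite leqNgt addnS ltnS leq_addr/= -addnS.
  have lt : (P + t.+1 < P')%N by rewrite addnS in tP' *.
  apply: eq_bigr => m _; rewrite IH ?(ltnW lt)//= lt w'w//.
have P'E : (P + (P' - P).-1.+1 = P')%N by rewrite prednK ?subn_gt0// subnKC// ltnW.
(* The variable cores keep the multi-index and check one entry each, so after s of them the first s
   entries of [q] have been matched with [n]. *)
have rd s q : (s <= D)%N -> @forward _ extend w' (P' + s) (inr q) =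
    coefs w (P' - P) q * \prod_(j < D | (j < s)%N) (q j == n j)%:R.
  elim: s q => [|s IH] q sD.
    rewrite addn0 big_pred0// mulr1 -{1}P'E fr ?P'E// prednK// subn_gt0//.
  rewrite addnS forwardS big_extend leqNgt ltn_addr//=.
  rewrite (bigD1 q)//= IH ?(ltnW sD)// ltnNge leq_addr/= eqxx/= [X in _ + X]big1
    ?addr0; last first.
    by move=> m mq; rewrite (negbTE mq) mulr0.
  rewrite -mulrA; congr (_ * _).
  rewrite [RHS](bigD1 (Ordinal sD))//= mulrC addKn /w' wcat_addl.
  rewrite -[s in letters q s]/(nat_of_ord (Ordinal sD)) lettersE.
  rewrite -[s in letters n s]/(nat_of_ord (Ordinal sD)) lettersE; congr (_ * _).
  apply: eq_bigl => j; rewrite ltnS [(j <= s)%N]leq_eqVlt -val_eqE /=.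
  by case: ltngtP.
rewrite /value big_extend leqNgt ltn_addr//= (bigD1 n)//= rd// big1 ?mulr1; last first.
  by move=> j _; rewrite eqxx.
rewrite big1 ?addr0// => q qn; rewrite rd//.
have [j nqj] : exists j, q j != n j.
  by apply/existsP; apply: contraNT qn => /existsPn h; apply/eqP/ffunP => j;
    apply/eqP/negPn.
by rewrite (bigD1 j)//= (negPf nqj) mul0r mulr0.
Qed.

Variable b : nat.

Definition alphabet Q v := if (v < Q)%N then b else d.

Definition extend_const : nat := ((b + d) * #|{: X}| * #|{: X}|)%N.

Lemma extend_cost_sum (c c' : nat -> nat) Q : (P < P' + D)%N ->
  (forall v, (v < P)%N -> (c' v <= c v)%N) -> (c' P <= Q)%N ->
  (forall v, (P < v)%N -> (c' v <= extend_const)%N) ->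
  (\sum_(v < P' + D) c' v <= \sum_(v < P + D) c v + Q + (P' + D) * extend_const)%N.
Proof.
move=> PN c1 c2 c3.
rewrite -(big_mkord xpredT c') -(big_mkord xpredT c).
rewrite (big_cat_nat (n := P))//=; last exact: ltnW.
rewrite (big_ltn PN) /= addnA; apply: leq_add; first apply: leq_add => //.
  rewrite [leqRHS](big_cat_nat (n := P))//= ?leq_addr//.
  apply: leq_trans (leq_addr _ _).
  by rewrite !big_mkord; apply: leq_sum => v _; exact: c1.
apply: (@leq_trans (\sum_(P.+1 <= v < P' + D) extend_const)%N).
  by rewrite big_nat_cond [leqRHS]big_nat_cond;
    apply: leq_sum => v /andP[/andP[Pv _] _]; exact: c3.
by rewrite sum_nat_const_nat leq_mul2r leq_subr orbT.
Qed.

Lemma full_cost_extend :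
  (full_cost extend (alphabet P') (P' + D) <=
   full_cost A (alphabet P) (P + D) + #|bond A P| * b * #|{: X}| + (P' + D) *
     extend_const)%N.
Proof.
apply: (extend_cost_sum (c := fun v => (#|bond A v| * alphabet P v * #|bond A v.+1|)%N)
  (c' := fun v => (#|bond extend v| * alphabet P' v * #|bond extend v.+1|)%N)).
- exact: ltn_addr.
- by move=> v vP; rewrite !card_extend vP (ltnW vP) /alphabet vP (ltn_trans vP PP').
- by rewrite !card_extend leqnn ltnn /alphabet PP'.
- move=> v Pv; rewrite !card_extend (leqNgt v) Pv (leqNgt v.+1) ltnS (ltnW Pv)/=.
  rewrite [X in (X * _ <= _)%N]mulnC !leq_mul//.
  by rewrite /alphabet; case: ifP => _; rewrite ?leq_addr ?leq_addl.
Qed.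

(** The absorbing core at [P] is the delicate one, since the bond there is not bounded by non-zero
    entries. A state with a non-zero row has a non-zero [tail], hence an old edge leaving it at
    layer [P], and this edge pays for the row. *)
Lemma sparse_cost_extend :
  (sparse_cost extend (alphabet P') (P' + D) <=
   sparse_cost A (alphabet P) (P + D) + #|edges A (alphabet P) P| * b * #|{: X}| +
   (P' + D) * extend_const)%N.
Proof.
have inl_bond v k : (v <= P)%N -> (inl k \in bond extend v) = (k \in bond A v).
  by move=> vP; rewrite /= vP mem_imset// => ? ? [].
have inr_bond v n : (v <= P)%N -> (inr n \in bond extend v) = false.
  by move=> vP; rewrite /= vP; apply/negbTE/negP => /imsetP[].
have inl_bond' v k : (P < v)%N -> (inl k \in bond extend v) = false.
  by move=> vP; rewrite /= leqNgt vP; apply/negbTE/negP => /imsetP[].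
apply: (extend_cost_sum (c := fun v => #|edges A (alphabet P) v|)
  (c' := fun v => #|edges extend (alphabet P') v|)).
- exact: ltn_addr.
- move=> v vP; have Ev : alphabet P' v = alphabet P v.
    by rewrite /alphabet vP (ltn_trans vP PP').
  pose f (e : state A * 'I_(alphabet P v) * state A) :
      state extend * 'I_(alphabet P' v) * state extend :=
    (inl e.1.1, cast_ord (esym Ev) e.1.2, inl e.2).
  apply: (@leq_trans #|f @: edges A (alphabet P) v|); last exact: leq_imset_card.
  apply: subset_leq_card; apply/fintype.subsetP => -[[[k|n] j] [k'|n']];
    rewrite inE -/(bond extend) ?inl_bond ?inr_bond ?(ltnW vP)//= ?andbF// => /and3P[kb
      k'b nz].
  apply/imsetP; exists (k, cast_ord Ev j, k'); rewrite ?inE /= ?kb ?k'b//.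
  by rewrite /f /=; congr (_, _, _); apply: val_inj.
- pose f (e : (state A * 'I_(alphabet P P) * state A) * 'I_b * X) :
      state extend * 'I_(alphabet P' P) * state extend :=
    (inl e.1.1.1.1, cast_ord (esym (ifT _ _ PP')) e.1.2, inr e.2).
  apply: (@leq_trans #|f @: (finset.setX (finset.setX (edges A (alphabet P) P) [set:
    'I_b]%SET) [set: X]%SET)|).
    apply: subset_leq_card; apply/fintype.subsetP => -[[[k|n] j] [k'|q]];
      rewrite inE -/(bond extend) ?(inl_bond P) ?(inr_bond P) ?(inl_bond' P.+1)//=
        ?andbF// => /and3P[kb _ nz].
    have [n nzn] : exists n, tail k n != 0.
      apply/existsP; apply: contraNT nz => /existsPn h.
      by rewrite big1// => n _; rewrite (eqP (negPn (h n))) mul0r.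
    have [e eE ek] : exists2 e, e \in edges A (alphabet P) P & e.1.1 = k.
      apply: contrapT => h; case/negP: nzn; apply/eqP.
      rewrite /tail big1// => l' l'b.
      have jP : (letters n 0 < alphabet P P)%N.
        by rewrite /alphabet ltnn -[0%N]/(nat_of_ord (Ordinal D_gt0)) lettersE.
      have z l : l \in bond A P.+1 -> core P k (letters n 0) l = 0.
        move=> lb; apply/eqP; apply: contrapT => /negP nz'; apply: h.
        by exists (k, Ordinal jP, l) => //; rewrite inE /= kb lb.
      have z1 l : l \in bond A P.+1 ->
          run P (wcat P (fun=> 0%N) n) (fun x => (x == k)%:R) 1 l = 0.
        move=> lb; rewrite /= addn0 big1// => x xb.
        have [->|] := eqVneq x k; last by rewrite mul0r.
        by rewrite /wcat ltnn subnn z// mulr0.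
      have zt t l : l \in bond A (P + t.+1) ->
          run P (wcat P (fun=> 0%N) n) (fun x => (x == k)%:R) t.+1 l = 0.
        elim: t l => [|t IH] l; first by rewrite addn1; exact: z1.
        by move=> _; rewrite /= big1// => x xb; rewrite [X in X * _]IH// mul0r.
      by have := zt D.-1 l'; rewrite prednK//; apply.
    apply/imsetP; exists (e, cast_ord (ifT _ _ PP') j, q);
      first by rewrite !finset.in_setX eE !finset.in_setT.
    by rewrite /f /= ek; congr (_, _, _); apply: val_inj.
  apply: leq_trans (leq_imset_card _ _) _.
  by rewrite !cardsX !cardsT card_ord.
- move=> v Pv; apply: leq_trans (card_edges_le _ _ _) _.
  rewrite !card_extend (leqNgt v) Pv (leqNgt v.+1) ltnS (ltnW Pv)/=.
  rewrite [X in (X * _ <= _)%N]mulnC !leq_mul//.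
  by rewrite /alphabet; case: ifP => _; rewrite ?leq_addr ?leq_addl.
Qed.

End automaton.
End extend.

(** * Tensor trains as automata *)

Section paths.
Context {R : comNzRingType} (A : automaton (R := R)).

Definition path_ok N (f : {ffun 'I_N.+1 -> state A}) := [forall v, f v \in bond A v].

Lemma forward_paths N w (G : state A -> R) :
  \sum_(k in bond A N) forward w N k * G k =
  \sum_(f : {ffun 'I_N.+1 -> state A} | path_ok f)
    (\prod_(v < N) core v (f (inord v)) (w v) (f (inord v.+1))) * G (f ord_max).
Proof.
elim: N G => [|N IH] G.
  pose cst (k : state A) : {ffun 'I_1 -> state A} := [ffun _ => k].
  rewrite [RHS](reindex cst)/=; last first.
    exists (fun f : {ffun 'I_1 -> state A} => f ord_max) => [k _|f _];
      first by rewrite ffunE.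
    by apply/ffunP => i; rewrite ffunE; congr (f _); apply: val_inj; case: i => -[].
  apply: eq_big => [k|k _]; last by rewrite big_ord0 ffunE.
  by apply/idP/forallP => [kb v|/(_ ord0)]; rewrite ffunE// (ord1 v).
pose pack (p : {ffun 'I_N.+1 -> state A} * state A) : {ffun 'I_N.+2 -> state A} :=
  [ffun v => oapp p.1 p.2 (unlift ord_max v)].
have pack_max p : pack p ord_max = p.2 by rewrite ffunE unlift_none.
have pack_lift p v : pack p (lift ord_max v) = p.1 v by rewrite ffunE liftK.
have liftE (v : nat) : (v < N.+1)%N -> (inord v : 'I_N.+2) = lift ord_max (inord v :
  'I_N.+1).
  by move=> vN; apply: val_inj; rewrite [RHS]lift_max /= !inordK// ltnW.
have maxE : (inord N.+1 : 'I_N.+2) = ord_max by apply: val_inj; rewrite /= inordK.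
rewrite [RHS](reindex pack)/=; last first.
  exists (fun f => ([ffun v => f (lift ord_max v)], f ord_max)) => [[g k] _|f _].
    rewrite pack_max; congr (_, _); apply/ffunP => v.
    by rewrite ffunE pack_lift.
  apply/ffunP => v; case: (unliftP ord_max v) => [u ->|->]; last by rewrite pack_max.
  by rewrite pack_lift ffunE.
have okE p : path_ok (pack p) = path_ok p.1 && (p.2 \in bond A N.+1).
  apply/forallP/andP => [h|[/forallP h hk] v].
    split; last by have := h ord_max; rewrite pack_max.
    apply/forallP => v; have := h (lift ord_max v).
    by rewrite pack_lift lift_max.
  case: (unliftP ord_max v) => [u ->|->]; last by rewrite pack_max.
  by rewrite pack_lift lift_max; exact: h.
rewrite (eq_bigl _ _ okE) -(pair_big (@path_ok N) (mem (bond A N.+1))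
  (fun f k => (\prod_(v < N.+1) core v (pack (f, k) (inord v)) (w v) (pack (f, k)
    (inord v.+1))) *
     G (pack (f, k) ord_max)))/=.
rewrite [RHS]exchange_big/=; apply: eq_bigr => k kb.
rewrite forwardS IH mulr_suml; apply: eq_bigr => f fok.
rewrite big_ord_recr/= maxE !pack_max liftE// pack_lift/=; congr (_ * _).
congr (_ * _).
  apply: eq_bigr => v _; rewrite !liftE ?ltnS ?(ltnW (ltn_ord v))// !pack_lift//.
by congr (core N (f _) _ _); apply: val_inj; rewrite /= inordK.
Qed.

Lemma value_paths N w : value A N w =
  \sum_(f : {ffun 'I_N.+1 -> state A} | path_ok f)
    \prod_(v < N) core v (f (inord v)) (w v) (f (inord v.+1)).
Proof.
rewrite /value; under eq_bigr do rewrite -[forward _ _ _]mulr1.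
by rewrite forward_paths; under eq_bigr do rewrite mulr1.
Qed.

(** Bridges paths in one state type and the dependent index families, with ranks varying by layer,
    in the definition of a tensor train. *)
Lemma value_dpaths N w (r : nat -> nat) (e : forall v, 'I_(r v) -> state A) :
  (forall v, (v <= N)%N -> injective (e v)) ->
  (forall v, (v <= N)%N -> bond A v = e v @: [set: 'I_(r v)]%SET) ->
  value A N w = \sum_(k : {dffun forall v : 'I_N.+1, 'I_(r v)})
    \prod_(v < N) core v ([ffun u : 'I_N.+1 => e u (k u)] (inord v)) (w v)
                         ([ffun u : 'I_N.+1 => e u (k u)] (inord v.+1)).
Proof.
move=> einj eim.
pose h (k : {dffun forall v : 'I_N.+1, 'I_(r v)}) : {ffun 'I_N.+1 -> state A} :=
  [ffun u : 'I_N.+1 => e u (k u)].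
have hinj : injective h.
  move=> k k' /ffunP hk; apply/ffunP => v; have := hk v; rewrite !ffunE.
  by apply: einj; rewrite -ltnS.
rewrite value_paths.
transitivity (\sum_(f in h @: [set: {dffun forall v : 'I_N.+1, 'I_(r v)}]%SET)
    \prod_(v < N) core v (f (inord v)) (w v) (f (inord v.+1))).
  apply: eq_bigl => f; apply/forallP/imsetP => [fb|[k _ ->] v]; last first.
    by rewrite ffunE (eim _ (ltn_ord v)) imset_f.
  have fb' (v : 'I_N.+1) : exists a, e v a == f v.
    have := fb v; rewrite (eim _ (ltn_ord v)) => /imsetP[a _ ->].
    by exists a.
  exists [ffun v : 'I_N.+1 => xchoose (fb' v)] => //.
  by apply/ffunP => v; rewrite !ffunE; apply/esym/eqP; exact: (xchooseP (fb' v)).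
rewrite big_imset/=; last by move=> k k' _ _; exact: hinj.
by apply: eq_bigl => k; rewrite inE.
Qed.

Lemma card_edges_image m v (r r' q : nat) (e : 'I_r -> state A) (e' : 'I_r' -> state A)
    (T : 'I_r -> 'I_q -> 'I_r' -> R) :
  m v = q -> injective e -> injective e' ->
  bond A v = e @: [set: 'I_r]%SET -> bond A v.+1 = e' @: [set: 'I_r']%SET ->
  (forall a j a', T a j a' = core v (e a) j (e' a')) ->
  #|[set z : 'I_r * 'I_q * 'I_r' | T z.1.1 z.1.2 z.2 != 0]%SET| = #|edges A m v|.
Proof.
move=> mq einj einj' be be' hT; subst q.
pose f (z : 'I_r * 'I_(m v) * 'I_r') := (e z.1.1, z.1.2, e' z.2).
have finj : injective f by move=> [[a j] a'] [[c k] c'] [/einj -> -> /einj' ->].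
rewrite -(card_imset _ finj); apply: eq_card => -[[k j] k'].
apply/imsetP/idP => [[[[a i] a']]|].
  by rewrite inE /= hT => nz [-> -> ->]; rewrite inE /= be be' !imset_f.
rewrite inE /= be be' => /and3P[/imsetP[a _ ->] /imsetP[a' _ ->] nz].
by exists (a, j, a') => //; rewrite inE /= hT.
Qed.

End paths.

Section tensor_trains.
Context {R : realType}.
Local Notation TR := (measurableTypeR R).
Variables (b D d : nat) (phi : 'I_d -> L0 (leb01 R)).
Hypothesis b_gt0 : (0 < b)%N.
Local Notation X := {ffun 'I_D -> 'I_d}.

Definition word_of L (i : digits b D L) (v : nat) : nat :=
  oapp (fun u => nat_of_ord (i u)) 0%N (insub v).

Lemma word_ofE L (i : digits b D L) (v : 'I_(L * D)) : word_of i v = i v.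
Proof. by rewrite /word_of valK. Qed.

Lemma word_of_ltn L (i : digits b D L) v : (word_of i v < b)%N.
Proof. by rewrite /word_of; case: insub => //= u; exact: ltn_ord. Qed.

(** Only the coefficient function on words enters, so automata with equal values on valid words are
    interchangeable. *)
Definition coef_represents L (T : (nat -> nat) -> R) (f : L0 (cube R D)) : Prop :=
  forall w, (forall v, (w v < b)%N) -> \forall x \ae cube R D,
    f (wmap b L w x) =
    \sum_(n : X) T (wcat (L * D) w n) * \prod_(j < D) phi (n j) (tnth x j).

Record represented_by L r (U : ttrain R b D d L r) (A : automaton (R := R))
    (e : forall v, 'I_(r v) -> state A) : Prop := {
  rep_inj : forall v, (v <= L.+1 * D)%N -> injective (e v) ;
  rep_bond : forall v, (v <= L.+1 * D)%N -> bond A v = e v @: [set: 'I_(r v)]%SET ;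
  rep_digit : forall (v : 'I_(L * D)) a i a',
    @tt_digit _ _ _ _ _ _ U v a i a' = core v (e v a) i (e v.+1 a') ;
  rep_var : forall (v : 'I_D) a n a',
    @tt_var _ _ _ _ _ _ U v a n a' = core (L * D + v)%N (e _ a) n (e _ a') }.

Lemma big_levels (M : Type) (idx : M) (op : Monoid.com_law idx) L (F : nat -> M) :
  \big[op/idx]_(v < L.+1 * D) F v =
  op (\big[op/idx]_(v < L * D) F v) (\big[op/idx]_(v < D) F (L * D + v)%N).
Proof. by rewrite -(big_mkord xpredT F) mulSn addnC big_mkord big_split_ord. Qed.

Section represented.
Variables (L : nat) (r : nat -> nat) (U : ttrain R b D d L r) (A : automaton (R := R)).
Variable e : forall v, 'I_(r v) -> state A.
Hypothesis UA : represented_by U e.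

Let card_bond v : (v <= L.+1 * D)%N -> #|bond A v| = r v.
Proof.
by move=> vN; rewrite (rep_bond UA vN) card_imset ?cardsT ?card_ord//;
  exact: rep_inj UA _ vN.
Qed.

Let digit_le (v : 'I_(L * D)) : (v < L.+1 * D)%N.
Proof. exact: (@tt_digit_subproof D L v). Qed.

Let var_le (v : 'I_D) : (L * D + v < L.+1 * D)%N.
Proof. exact: (@tt_var_subproof D L v). Qed.

Lemma tt_eval_value i x : tt_eval phi U i x =
  \sum_(n : X) value A (L.+1 * D) (wcat (L * D) (word_of i) n) *
    \prod_(j < D) phi (n j) (tnth x j).
Proof.
rewrite /tt_eval exchange_big/=; apply: eq_bigr => n _.
rewrite (value_dpaths _ (rep_inj UA) (rep_bond UA)) mulr_suml.
apply: eq_bigr => k _; set f := [ffun u => _].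
rewrite (big_levels _ _ (fun v => core v (f (inord v)) (wcat (L * D) (word_of i) n v)
  (f (inord v.+1)))) -mulrA big_split/= mulrA.
have fE (v : nat) (vN : (v < (L.+1 * D).+1)%N) : f (inord v) = e (k (Ordinal vN)).
  by rewrite (_ : inord v = Ordinal vN) ?ffunE//; apply: val_inj; rewrite /= inordK.
rewrite -!mulrA; congr (_ * _).
  apply: eq_bigr => v _; rewrite (rep_digit UA) (fE _ (ltnW (@tt_digit_subproof D L
    v))) (fE _ (@tt_digit_subproof D L v)).
  congr (core v _ _ _).
  by rewrite /wcat ltn_ord word_ofE.
congr (_ * _); apply: eq_bigr => v _; rewrite (rep_var UA).
rewrite (fE _ (ltnW (@tt_var_subproof D L v))) (fE _ (@tt_var_subproof D L v)).
by congr (core _ _ _ _); rewrite wcat_addl lettersE.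
Qed.

Lemma tt_represents_coef f :
  tt_represents phi U f <-> coef_represents L (value A (L.+1 * D)) f.
Proof.
have iE (w : nat -> nat) (wb : forall v, (w v < b)%N) (n : X) v :
    wcat (L * D) (word_of [ffun u : 'I_(L * D) => Ordinal (wb u)]) n v = wcat (L * D) w
      n v.
  rewrite /wcat; case: ifPn => // vL.
  by rewrite -[v in word_of _ v]/(nat_of_ord (Ordinal vL)) word_ofE ffunE.
split=> [h w wb|h i].
  have := h [ffun u : 'I_(L * D) => Ordinal (wb u)].
  apply: filterS => x; rewrite /tensorize (@tmapE _ _ _ _ _ w); last by move=> v;
    rewrite ffunE.
  move=> ->; rewrite tt_eval_value; apply: eq_bigr => n _; congr (_ * _).
  by apply: eq_value => v _; exact: iE.
have := h (word_of i) (word_of_ltn i); apply: filterS => x.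
rewrite /tensorize (@tmapE _ _ _ _ _ (word_of i)); last by move=> v; rewrite word_ofE.
by move=> ->; rewrite tt_eval_value.
Qed.

Lemma tt_complF_cost : tt_complF U = full_cost A (alphabet d b (L * D)) (L.+1 * D).
Proof.
rewrite /full_cost (big_levels _ _ (fun v => #|bond A v| * alphabet d b (L * D) v *
  #|bond A v.+1|)%N) /tt_complF; congr (_ + _)%N; apply: eq_bigr => v _.
  by rewrite !card_prod !card_ord (card_bond (ltnW (digit_le v))) (card_bond (digit_le
    v)) /alphabet ltn_ord.
by rewrite !card_prod !card_ord (card_bond (ltnW (var_le v))) (card_bond (var_le v))
  /alphabet ltnNge leq_addr.
Qed.

Lemma tt_complS_cost : tt_complS U = sparse_cost A (alphabet d b (L * D)) (L.+1 * D).
Proof.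
rewrite /sparse_cost (big_levels _ _ (fun v => #|edges A (alphabet d b (L * D)) v|))
  /tt_complS.
congr (_ + _)%N; apply: eq_bigr => v _.
  apply: (card_edges_image _ _ _ _ _ (@rep_digit _ _ _ _ _ UA v)).
  - by rewrite /alphabet ltn_ord.
  - exact/(rep_inj UA)/ltnW.
  - exact: rep_inj UA _ (digit_le v).
  - exact/(rep_bond UA)/ltnW.
  - exact: rep_bond UA _ (digit_le v).
apply: (card_edges_image _ _ _ _ _ (@rep_var _ _ _ _ _ UA v)).
- by rewrite /alphabet ltnNge leq_addr.
- exact/(rep_inj UA)/ltnW.
- exact: rep_inj UA _ (var_le v).
- exact/(rep_bond UA)/ltnW.
- exact: rep_bond UA _ (var_le v).
Qed.

End represented.

Lemma automaton_of_ttrain L r (U : ttrain R b D d L r) :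
  exists A (e : forall v, 'I_(r v) -> state A), represented_by U e.
Proof.
pose M := (\max_(v < (L.+1 * D).+1) r v)%N.
have rM v : (v <= L.+1 * D)%N -> (r v <= M)%N.
  by move=> vN; exact: (leq_bigmax (Ordinal (vN : (v < (L.+1 * D).+1)%N))).
pose K : finType := 'I_M.+1.
pose e v (a : 'I_(r v)) : K := inord a.
have einj v : (v <= L.+1 * D)%N -> injective (e v).
  move=> /rM vM a a' /(congr1 (@nat_of_ord _)).
  by rewrite !inordK ?(leq_trans (ltn_ord _) (leqW vM))// => /val_inj.
(* Sums of indicators extend the cores to a common state type and natural-number positions without
   transport along equalities; [collapse] below recovers the entries. *)
pose cD v (k : K) j (k' : K) : R := \sum_(u < L * D) if u == v :> nat then
   \sum_(a < r u) \sum_(i < b) \sum_(a' < r u.+1)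
     [&& e u a == k, i == j :> nat & e u.+1 a' == k']%:R * @tt_digit _ _ _ _ _ _ U u a
       i a' else 0.
pose cV v (k : K) j (k' : K) : R := \sum_(u < D) if (L * D + u == v)%N then
   \sum_(a < r (L * D + u)%N) \sum_(i < d) \sum_(a' < r (L * D + u).+1)
     [&& e _ a == k, i == j :> nat & e _ a' == k']%:R * @tt_var _ _ _ _ _ _ U u a i a'
       else 0.
pose A : automaton (R := R) := {| state := K ; bond v := e v @: [set: 'I_(r v)]%SET ;
  core v k j k' := cD v k j k' + cV v k j k' |}.
have collapse r1 q r2 (f1 : 'I_r1 -> K) (f2 : 'I_r2 -> K) (T : 'I_r1 -> 'I_q -> 'I_r2
  -> R) a (i : 'I_q) a' :
    injective f1 -> injective f2 ->
    \sum_(x < r1) \sum_(y < q) \sum_(z < r2)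
      [&& f1 x == f1 a, y == i :> nat & f2 z == f2 a']%:R * T x y z = T a i a'.
  move=> i1 i2.
  rewrite (bigD1 a)//= [X in _ + X]big1 ?addr0; last first.
    by move=> x xa; rewrite big1// => y _; rewrite big1// => z _;
      rewrite (inj_eq i1) (negPf xa) mul0r.
  rewrite (bigD1 i)//= [X in _ + X]big1 ?addr0; last first.
    by move=> y yi; rewrite big1// => z _;
      rewrite -[y == i :> nat]/(y == i) (negPf yi) andbF mul0r.
  rewrite (bigD1 a')//= [X in _ + X]big1 ?addr0; last first.
    by move=> z za; rewrite (inj_eq i2) (negPf za) !andbF mul0r.
  by rewrite !eqxx mul1r.
exists A, e; split => //.
- move=> v a i a'; rewrite /= /cV [X in _ + X]big1 ?addr0; last first.
    by move=> u _; rewrite gtn_eqF// ltn_addr.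
  rewrite /cD (bigD1 v)//= eqxx [X in _ + X]big1 ?addr0; last first.
    by move=> u uv; rewrite -[u == v :> nat]/(u == v) (negPf uv).
  rewrite collapse//; apply: einj; first exact/ltnW/(@tt_digit_subproof D L v).
  exact: (@tt_digit_subproof D L v).
- move=> v a i a'; rewrite /= /cD [X in X + _]big1 ?add0r; last first.
    by move=> u _; rewrite ltn_eqF// ltn_addr.
  rewrite /cV (bigD1 v)//= eqxx [X in _ + X]big1 ?addr0; last first.
    by move=> u uv; rewrite eqn_add2l -[u == v :> nat]/(u == v) (negPf uv).
  rewrite collapse//; apply: einj; first exact/ltnW/(@tt_var_subproof D L v).
  exact: (@tt_var_subproof D L v).
Qed.

Lemma ttrain_of_automaton L (A : automaton (R := R)) :
  exists (U : ttrain R b D d L (fun v => #|bond A v|)),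
    represented_by U (fun v a => enum_val a).
Proof.
exists {| tt_digit := fun v a i a' => core v (enum_val a) i (enum_val a') ;
  tt_var := fun v a n a' => core (L * D + v)%N (enum_val a) n (enum_val a') |}.
split => // v _; first exact: enum_val_inj.
apply/setP => k; apply/idP/imsetP => [kb|[a _ ->]]; last exact: enum_valP.
by exists (enum_rank_in kb k); rewrite ?enum_rankK_in.
Qed.

End tensor_trains.

(** * Operations on functions of bounded cost *)

Section scale.
Context {R : comNzRingType} (A : automaton (R := R)) (c : R).

Definition scale_automaton : automaton := {|
  state := state A ; bond := bond A ;
  core v k j k' := (if v == 0%N then c else 1) * core v k j k' |}.

Lemma value_scale N w : (0 < N)%N -> value scale_automaton N w = c * value A N w.
Proof.
case: N => // N _; rewrite /value mulr_sumr; apply: eq_bigr => k _.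
elim: N k => [|N IH] k; rewrite !forwardS mulr_sumr; apply: eq_bigr => l _ /=.
  by rewrite !mul1r.
by rewrite -/(forward w N.+1 l) -/(@forward _ scale_automaton w N.+1 l) IH mul1r mulrA.
Qed.

Lemma sparse_cost_scale m N : (sparse_cost scale_automaton m N <= sparse_cost A m N)%N.
Proof.
apply: leq_sum => v _; apply: subset_leq_card; apply/fintype.subsetP => e.
rewrite !inE /= => /and3P[-> ->]; apply: contraNneq => ->.
by rewrite mulr0.
Qed.

End scale.

Section zero.
Context {R : comNzRingType}.

(** Empty inner bonds make every core empty as soon as there are at least two cores, while the end
    bonds keep size 1. *)
Definition zero_automaton (N : nat) : automaton (R := R) := {|
  state := unit ;
  bond v := if (0 < v < N)%N then finset.set0 else [set tt]%SET ;
  core v k j k' := 0 |}.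

Lemma value_zero N w : (0 < N)%N -> value (zero_automaton N) N w = 0.
Proof.
case: N => // N _; rewrite /value big1// => k _.
by rewrite forwardS big1// => l _; rewrite /= mulr0.
Qed.

Lemma full_cost_zero m N : (1 < N)%N -> full_cost (zero_automaton N) m N = 0%N.
Proof.
move=> N1; apply/eqP; rewrite sum_nat_eq0; apply/forallP => -[[|v] vN] /=.
  by rewrite N1 cards0 muln0.
by rewrite vN cards0.
Qed.

End zero.

Section representations.
Context {R : realType}.
Local Notation TR := (measurableTypeR R).
Variables (b D d : nat) (phi : 'I_d -> L0 (leb01 R)).
Hypotheses (b_gt0 : (0 < b)%N) (D_gt0 : (0 < D)%N).
Local Notation X := {ffun 'I_D -> 'I_d}.
Local Notation LD := (L0 (cube R D)).
Local Notation represents := (coef_represents b phi).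

(** The set where f is non-zero has null preimage under every digit map, and self-similarity of the
    cube makes it null. *)
Lemma coef_represents0 L T (f : LD) : represents L T f ->
  (forall w (n : X), (forall v, (w v < b)%N) -> T (wcat (L * D) w n) = 0) -> f = 0.
Proof.
move=> fT T0.
have mf : measurable [set x | f x != 0].
  rewrite (_ : [set x | f x != 0] = f @^-1` (~` [set 0])).
    rewrite -[X in measurable X]setTI; apply: L0_measurable => //.
    by apply: measurableC; exact: measurable_set1.
  by apply/seteqP; split => x /= /eqP.
apply: L0_eqP; apply: filterS2 (L0_0_ae (cube R D)) (_ : \forall x \ae cube R D, f x = 0).
  by move=> x -> ->.
exists [set x | f x != 0]; split => //; last by move=> x /= /eqP.
apply: (wmap_null b_gt0 (L := L)) => // w wb.
apply/negligibleP.
  by rewrite -[X in measurable X]setTI; apply: measurable_wmap.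
have := fT w wb => -[B [mB B0 PB]]; exists B; split => // x /= fx.
apply: PB => /= fxE; case/eqP: fx; rewrite fxE big1// => n _.
by rewrite T0// mul0r.
Qed.

Lemma wcat_valid L w (n : X) : (forall v, (w v < b)%N) ->
  valid (alphabet d b (L * D)) (L.+1 * D) (wcat (L * D) w n).
Proof.
move=> wb v vN; rewrite /alphabet /wcat; case: (ltnP v (L * D)) => // Lv.
have vD : (v - L * D < D)%N by rewrite ltn_subLR//; move: vN; rewrite mulSn addnC.
by rewrite -[(v - L * D)%N]/(nat_of_ord (Ordinal vD)) lettersE.
Qed.

Lemma represents_neq0 L A (f : LD) : represents L (value A (L.+1 * D)) f -> f != 0 ->
  exists2 w, valid (alphabet d b (L * D)) (L.+1 * D) w & value A (L.+1 * D) w != 0.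
Proof.
move=> fA f0; apply: contrapT => h; case/eqP: f0; apply: (coef_represents0 fA) => w n wb.
apply/eqP; apply: contrapT => /negP nz; apply: h.
by exists (wcat (L * D) w n) => //; exact: wcat_valid.
Qed.

Lemma representsD L T T' (f g : LD) : represents L T f -> represents L T' g ->
  represents L (fun w => T w + T' w) (f + g).
Proof.
move=> fT gT w wb; have fg := ae_wmap b_gt0 L wb (L0D_ae f g).
apply: filterS3 fg (fT w wb) (gT w wb) => x -> -> ->.
by rewrite -big_split/=; apply: eq_bigr => n _; rewrite mulrDl.
Qed.

Lemma representsZ L T (c : R) (f : LD) : represents L T f ->
  represents L (fun w => c * T w) (c *: f).
Proof.
move=> fT w wb; have cf := ae_wmap b_gt0 L wb (L0Z_ae c f).
apply: filterS2 cf (fT w wb) => x -> ->.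
by rewrite mulr_sumr; apply: eq_bigr => n _; rewrite mulrA.
Qed.

Lemma eq_represents L T T' (f : LD) :
  (forall w, (valid (alphabet d b (L * D)) (L.+1 * D) w) -> T w = T' w) ->
  represents L T f -> represents L T' f.
Proof.
move=> TT fT w wb; apply: filterS (fT w wb) => x ->.
by apply: eq_bigr => n _; rewrite TT//; exact: wcat_valid.
Qed.

Section refinement.
Variable a : nat -> nat -> nat -> R.
Hypothesis phi_step : forall (i : 'I_b) (n : 'I_d), \forall x \ae leb01 R,
  phi n (step1 b i x) = \sum_(q < d) a i n q * phi q x.

Lemma represents_refine L (C : (nat -> nat) -> X -> R) (f : LD) :
  (forall w, (forall v, (w v < b)%N) -> \forall x \ae cube R D,
    f (wmap b L w x) = \sum_(n : X) C w n * \prod_(j < D) phi (n j) (tnth x j)) ->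
  forall w, (forall v, (w v < b)%N) -> \forall x \ae cube R D,
    f (wmap b L.+1 w x) = \sum_(q : X)
      (\sum_(n : X) C w n * \prod_(j < D) a (w (L * D + j)%N) (n j) (q j)) *
      \prod_(j < D) phi (q j) (tnth x j).
Proof.
move=> fC w wb.
have h1 := ae_step b_gt0 (fun j => wb (L * D + j)%N) (fC w wb).
have h2 : \forall x \ae cube R D, forall jn : 'I_D * 'I_d,
    phi jn.2 (step1 b (w (L * D + jn.1)%N) (tnth x jn.1)) =
    \sum_(q < d) a (w (L * D + jn.1)%N) jn.2 q * phi q (tnth x jn.1).
  apply: filter_forall => -[j n] /=.
  exact: (ae_tnth j (phi_step (Ordinal (wb (L * D + j)%N)) n)).
apply: filterS2 h1 h2 => x fx phix; rewrite wmapS// fx.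
under [RHS]eq_bigr => q _ do rewrite mulr_suml.
rewrite [RHS]exchange_big/=; apply: eq_bigr => n _.
under [RHS]eq_bigr => q _ do rewrite -mulrA.
rewrite -mulr_sumr; congr (_ * _).
transitivity (\prod_(j < D) \sum_(q < d) a (w (L * D + j)%N) (n j) q * phi q (tnth x j)).
  by apply: eq_bigr => j _; rewrite tnth_mktuple; exact: (phix (j, n j)).
rewrite bigA_distr_bigA/=; apply: eq_bigr => q _.
by rewrite big_split.
Qed.

Lemma represents_extend L L' A (f : LD) : (L < L')%N ->
  represents L (value A (L.+1 * D)) f ->
  represents L' (value (extend D d a A (L * D) (L' * D)) (L'.+1 * D)) f.
Proof.
move=> LL' fA.
have DL : (D %| L * D)%N by exact: dvdn_mull.
have h t w : (forall v, (w v < b)%N) -> \forall x \ae cube R D, f (wmap b (L + t) w x) =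
    \sum_(n : X) coefs a A (L * D) w (t * D) n * \prod_(j < D) phi (n j) (tnth x j).
  elim: t w => [|t IH] w wb.
    rewrite addn0; apply: filterS (fA w wb) => x ->.
    by apply: eq_bigr => n _; rewrite /= addnC -mulSn.
  rewrite addnS; apply: filterS (represents_refine IH wb) => x ->.
  apply: eq_bigr => q _; congr (_ * _).
  rewrite mulSnr coefs_level ?dvdn_mull//; apply: eq_bigr => n _; congr (_ * _).
  by apply: eq_bigr => j _; rewrite mulnDl.
move=> w wb; have := h (L' - L)%N w wb; rewrite subnKC; last exact: ltnW.
apply: filterS => x ->; apply: eq_bigr => n _; congr (_ * _).
by rewrite [(L'.+1 * D)%N]mulSn [(D + _)%N]addnC value_extend ?ltn_pmul2r// mulnBl.
Qed.

End refinement.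

Local Notation cost_function := (automaton (R := R) -> (nat -> nat) -> nat -> nat).

Definition has_cost (cost : cost_function) (n L : nat) (f : LD) := exists A,
  [/\ #|bond A 0| = 1%N, #|bond A (L.+1 * D)| = 1%N,
      (cost A (alphabet d b (L * D)) (L.+1 * D) <= n)%N &
      represents L (value A (L.+1 * D)) f].

Lemma has_cost_sparse n L f : has_cost (@full_cost R) n L f -> has_cost (@sparse_cost
  R) n L f.
Proof.
move=> [A [A0 AN An fA]]; exists A; split => //.
exact: leq_trans (sparse_le_full _ _ _) An.
Qed.

Lemma has_cost_levels n L f : f != 0 -> has_cost (@sparse_cost R) n L f -> (L.+1 * D <=
  n)%N.
Proof.
move=> f0 [A [_ _ An fA]]; have [w wv nz] := represents_neq0 fA f0.
exact: leq_trans (leq_sparse_cost wv nz) An.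
Qed.

Lemma has_cost_full n L f : f != 0 -> has_cost (@sparse_cost R) n L f ->
  has_cost (@full_cost R) ((b + d) * n ^ 2) L f.
Proof.
move=> f0 fn; have [A [A0 AN An fA]] := fn; have [w wv nz] := represents_neq0 fA f0.
have [B0 BN] := prune_ends wv nz A0 AN.
exists (prune A (alphabet d b (L * D))); split => //.
- apply: leq_trans (full_cost_prune (M := b + d) _ A0 _) _.
  + by move=> v _; rewrite /alphabet; case: ifP => _; rewrite ?leq_addr ?leq_addl.
  + by apply: leq_trans (leq_sparse_cost wv nz); rewrite muln_gt0 D_gt0.
  + by rewrite leq_mul2l leq_exp2r ?An ?orbT.
- by apply: eq_represents fA => w' w'v; rewrite value_prune.
Qed.

(** Level 1 rather than 0: for D = 1 a train of level 0 is a single core, with no inner bond to be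
    emptied. *)
Lemma has_cost_full0 : has_cost (@full_cost R) 0 1 0.
Proof.
have N1 : (1 < 2 * D)%N by rewrite mul2n -addnn; case: (D) D_gt0 => // D' _;
  rewrite addSn addnS.
exists (zero_automaton (2 * D)); split.
- by rewrite cards1.
- by rewrite /= ltnn andbF cards1.
- by rewrite full_cost_zero.
- move=> w wb; apply: filterS (ae_wmap b_gt0 1 wb (L0_0_ae (cube R D))) => x ->.
  by rewrite big1// => n _; rewrite value_zero ?mul0r// ltnW.
Qed.

Lemma has_costZ (cost : cost_function) n L c f :
  (forall A m N, (cost (scale_automaton A c) m N <= cost A m N)%N) ->
  has_cost cost n L f -> has_cost cost n L (c *: f).
Proof.
move=> hcost [A [A0 AN An fA]]; exists (scale_automaton A c); split => //.
  exact: leq_trans (hcost _ _ _) An.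
have N0 : (0 < L.+1 * D)%N by rewrite muln_gt0.
by apply: eq_represents (representsZ c fA) => w _; rewrite value_scale.
Qed.

Lemma has_cost_sparseD n n' L f g :
  has_cost (@sparse_cost R) n L f -> has_cost (@sparse_cost R) n' L g ->
  has_cost (@sparse_cost R) (n + n') L (f + g).
Proof.
move=> [A [A0 AN An fA]] [B [B0 BN Bn gB]].
have N0 : (0 < L.+1 * D)%N by rewrite muln_gt0.
exists (merge_ends (sum_automaton A B) (L.+1 * D)); split.
- by rewrite card_merge_ends.
- by rewrite card_merge_ends /inner ltnn andbF.
- apply: leq_trans (sparse_cost_merge_ends _ _ _) _.
  by apply: leq_trans (sparse_cost_sum _ _ _ _) _; exact: leq_add.
- by apply: eq_represents (representsD fA gB) => w _;
    rewrite value_merge_ends// value_sum.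
Qed.

Lemma has_cost_fullD n n' L f g : f != 0 -> g != 0 ->
  has_cost (@full_cost R) n L f -> has_cost (@full_cost R) n' L g ->
  has_cost (@full_cost R) ((2 * (b + d)).+1 * (n + n')) L (f + g).
Proof.
move=> f0 g0 [A [A0 AN An fA]] [B [B0 BN Bn gB]].
have N0 : (0 < L.+1 * D)%N by rewrite muln_gt0.
have [w wv nz] := represents_neq0 fA f0; have [w' w'v nz'] := represents_neq0 gB g0.
have [A' [A'0 A'N A'v A'n bA']] := balance wv nz A0 AN.
have [B' [B'0 B'N B'v B'n bB']] := balance w'v nz' B0 BN.
exists (merge_ends (sum_automaton A' B') (L.+1 * D)); split.
- by rewrite card_merge_ends.
- by rewrite card_merge_ends /inner ltnn andbF.
- apply: leq_trans (full_cost_merge_ends _ _ _) _; rewrite ?card_sum_bond ?A'0 ?A'N//.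
  apply: leq_trans (full_cost_sum (M := b + d) _ bA' bB') _.
    by move=> v _; rewrite /alphabet; case: ifP => _; rewrite ?leq_addr ?leq_addl.
  by rewrite leq_mul2l leq_add ?orbT//; [exact: leq_trans A'n An|exact: leq_trans B'n Bn].
- apply: eq_represents (representsD fA gB) => u uv.
  by rewrite value_merge_ends// value_sum A'v// B'v.
Qed.

Hypothesis phi_dilation : exists a : nat -> nat -> nat -> R,
  forall (i : 'I_b) (n : 'I_d), \forall x \ae leb01 R,
  phi n (step1 b i x) = \sum_(q < d) a i n q * phi q x.

(** The summands pay for the old cores, for the absorbing core, and for the cores after it, each
    multiplied by at most n. *)
Definition lift_const : nat := (1 + b * #|{: X}| + extend_const D d b).+1.

Lemma has_cost_lift (cost : cost_function) n L L' f :
  cost = @full_cost R \/ cost = @sparse_cost R -> f != 0 ->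
  has_cost cost n L f -> (L <= L')%N -> (L'.+1 * D <= n)%N ->
  has_cost cost (lift_const * n) L' f.
Proof.
move=> hc f0 fn LL' L'n.
have [<-|neLL'] := eqVneq L L'.
  have [A [A0 AN An fA]] := fn; exists A; split => //; apply: leq_trans An _.
  by rewrite leq_pmull.
have {neLL'}LL' : (L < L')%N by rewrite ltn_neqAle neLL'.
have [A [A0 AN An fA]] := fn; have [a phia] := phi_dilation.
have [w wv nz] := represents_neq0 fA f0.
have LDN : (L * D < L.+1 * D)%N by rewrite ltn_pmul2r.
have [bP mP bP1] := edges_gt0_bond (value_neq0_edge wv nz LDN).
pose B := extend D d a A (L * D) (L' * D).
have LDL'D : (L * D < L' * D)%N by rewrite ltn_pmul2r.
have DN : (L.+1 * D = L * D + D)%N by rewrite mulSn addnC.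
have DN' : (L'.+1 * D = L' * D + D)%N by rewrite mulSn addnC.
have d0 : (0 < d)%N.
  by have := wv (L * D)%N LDN; rewrite /alphabet ltnn; case: (d).
pose n0 : X := [ffun _ => Ordinal d0].
have N0 : (0 < L'.+1 * D)%N by rewrite muln_gt0.
have B0 : #|bond B 0| = 1%N by rewrite card_extend A0.
have BN : (0 < #|bond B (L'.+1 * D)|)%N.
  rewrite card_extend ifF; first by apply/card_gt0P; exists n0.
  by rewrite leqNgt DN' ltn_addr.
have le3 x y z : (x <= n)%N -> (y <= n)%N -> (z <= n)%N ->
    (x + y * b * #|{: X}| + z * extend_const D d b <= lift_const * n)%N.
  by move=> xn yn zn; rewrite -mulnA /lift_const;
    move: (b * _)%N (extend_const _ _ _) => p c; nia.
exists (merge_ends B (L'.+1 * D)); split.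
- by rewrite card_merge_ends.
- by rewrite card_merge_ends /inner ltnn andbF.
- case: hc => hc; rewrite {cost}hc in fn An *.
  + apply: leq_trans (full_cost_merge_ends _ _ _) _; rewrite ?B0//.
    rewrite DN'; apply: leq_trans (full_cost_extend _ _ _ _ LDL'D _) _.
    apply: le3; rewrite -?DN//; last by rewrite -DN'.
    (* The bond before the first variable core is bounded by the entries of that core, because its
       alphabet and its next bond are non-empty. *)
    apply: leq_trans An; rewrite /full_cost (bigD1 (Ordinal LDN))//=.
    by apply: leq_trans (leq_addr _ _); rewrite -mulnA leq_pmulr// muln_gt0 mP.
  + apply: leq_trans (sparse_cost_merge_ends _ _ _) _.
    rewrite DN'; apply: leq_trans (sparse_cost_extend _ _ D_gt0 _ LDL'D _) _.
    apply: le3; rewrite -?DN//; last by rewrite -DN'.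
    by apply: leq_trans An; rewrite /sparse_cost (bigD1 (Ordinal LDN))//= leq_addr.
- have fB := represents_extend phia LL' fA.
  by apply: eq_represents fB => u _; rewrite value_merge_ends.
Qed.

Lemma has_costD (cost : cost_function) n L L' f g :
  cost = @full_cost R \/ cost = @sparse_cost R -> f != 0 -> g != 0 ->
  has_cost cost n L f -> has_cost cost n L' g ->
  exists L'', has_cost cost ((2 * (b + d)).+1 * (2 * lift_const) * n) L'' (f + g).
Proof.
move=> hc; wlog LL' : L L' f g / (L <= L')%N => [hw f0 g0 fn gn|f0 g0 fn gn].
  have [LL'|/ltnW L'L] := leqP L L'; first exact: hw fn gn.
  by rewrite addrC; exact: hw gn fn.
have sp h l : has_cost cost n l h -> has_cost (@sparse_cost R) n l h.
  by case: hc => ->; [exact: has_cost_sparse|].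
have L'n := has_cost_levels g0 (sp _ _ gn).
have fn' := has_cost_lift hc f0 fn LL' L'n.
have gn' := has_cost_lift hc g0 gn (leqnn _) L'n.
(* Both lifted summands cost at most [lift_const] times n, hence the factor 2; the other factor
   comes from the dense direct sum. *)
exists L'; rewrite -mulnA -[(2 * _ * n)%N]mulnA [(2 * (_ * n))%N]mul2n -addnn.
case: hc => hc; rewrite {}hc in fn' gn' *; first exact: has_cost_fullD.
have [A [A0 AN An fA]] := has_cost_sparseD fn' gn'.
exists A; split => //; apply: leq_trans An _.
by rewrite leq_pmull.
Qed.

End representations.

(** * Tensor-train families as approximation families *)

Section tensor_train_families.
Context {R : realType}.
Local Notation TR := (measurableTypeR R).
Variables (b D d : nat) (phi : 'I_d -> L0 (leb01 R)).
Hypotheses (b_gt0 : (0 < b)%N) (D_gt0 : (0 < D)%N).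
Local Notation X := {ffun 'I_D -> 'I_d}.
Local Notation LD := (L0 (cube R D)).

Lemma basis_mem S n : is_basis S phi -> S (phi n).
Proof.
move=> [SE _]; apply/SE; exists (fun i => (i == n)%:R).
rewrite (bigD1 n)//= eqxx scale1r big1 ?addr0// => i /negPf ->.
by rewrite scale0r.
Qed.

Lemma basis_dilation S : is_basis S phi -> dilation_closed b S ->
  exists a : nat -> nat -> nat -> R, forall (i : 'I_b) (n : 'I_d), \forall x \ae leb01 R,
    phi n (step1 b i x) = \sum_(q < d) a i n q * phi q x.
Proof.
move=> basis dil; have [SE _] := basis.
have hex (p : 'I_b * 'I_d) : exists c : 'I_d -> R, \forall x \ae leb01 R,
    phi p.2 (step1 b p.1 x) = \sum_(q < d) c q * phi q x.
  case: p => i n /=.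
  have [g Sg gE] := dil _ i (basis_mem n basis).
  have [c gc] := iffLR (SE g) Sg; exists c.
  have hZ : \forall x \ae leb01 R, forall q : 'I_d,
      (c q *: phi q : L0 (leb01 R)) x = c q * phi q x.
    by apply: filter_forall => q; exact: L0Z_ae.
  have hs := L0_sum_ae (index_enum 'I_d) (fun q => c q *: phi q : L0 (leb01 R)).
  apply: filterS3 gE hs hZ => x gx sx Zx; rewrite /step1 -gx gc sx.
  by apply: eq_bigr => q _; rewrite Zx.
have [c hc] := choice hex.
exists (fun i n q => if (insub i, insub n, insub q) is (Some i, Some n, Some q)
  then c (i, n) q else 0) => i n.
apply: (@filterS _ (almost_everywhere (leb01 R)) _ _ _ _ (hc (i, n))) => x /= ->;
  apply: eq_bigr => q _.
by rewrite !valK.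
Qed.

(** The multi-indices enumerate the elementary tensors, so a representation brings membership in V
    with it and the families are described by cost alone. *)
Lemma coef_represents_V S L T (f : LD) : (forall n, S (phi n)) ->
  coef_represents b phi L T f -> V_bS b S f.
Proof.
move=> Sphi fT; exists L.
exists #|{: X}|, (fun m i => T (wcat (L * D) (word_of i) (enum_val m : X))),
  (fun m j => phi ((enum_val m : X) j)); split => [m j|i]; first exact: Sphi.
apply: filterS (fT (word_of i) (word_of_ltn b_gt0 i)) => x.
rewrite /tensorize (@tmapE _ _ _ _ _ (word_of i)); last by move=> v; rewrite word_ofE.
move=> ->; rewrite -(big_enum_val (fun n : X => T (wcat (L * D) (word_of i) n) *
  \prod_(j < D) phi (n j) (tnth x j)))/=.
by apply: eq_bigl => n; rewrite inE.
Qed.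

Lemma Phi_complP (c : forall L r, ttrain R b D d L r -> nat)
    (cost : automaton (R := R) -> (nat -> nat) -> nat -> nat) S n (f : LD) :
  (forall n, S (phi n)) ->
  (forall L r (U : ttrain R b D d L r) A (e : forall v, 'I_(r v) -> state A),
    represented_by U e -> c L r U = cost A (alphabet d b (L * D)) (L.+1 * D)%N) ->
  Phi_compl phi c S n f <-> exists L, has_cost b phi cost n L f.
Proof.
move=> Sphi cE; split=> [[_ fn]|[L [A [A0 AN An fA]]]].
  have [L [r [U [rU fU Un]]]] : exists L r (U : ttrain R b D d L r),
      [/\ tt_ranks D L r, tt_represents phi U f & (c L r U <= n)%N].
    apply: contrapT => h; suff : ((n.+1%:R)%:E <= compl phi c f)%E.
      by move=> /le_trans/(_ fn); rewrite lee_fin ler_nat ltnn.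
    apply: le_ereal_inf_tmp => _ [L [r [U [rU fU ->]]]].
    rewrite lee_fin ler_nat ltnNge; apply/negP => Un; apply: h.
    by exists L, r, U.
  have [A [e UA]] := automaton_of_ttrain U; have [r0 rN] := rU.
  exists L, A; split.
  - by rewrite (rep_bond UA)// card_imset ?cardsT ?card_ord//; exact: rep_inj UA _ _.
  - by rewrite (rep_bond UA)// card_imset ?cardsT ?card_ord//; exact: rep_inj UA _ _.
  - by rewrite -(cE _ _ _ _ _ UA).
  - exact/(tt_represents_coef phi b_gt0 UA).
have [U UA] := ttrain_of_automaton b D d L A.
split; first exact: coef_represents_V Sphi fA.
apply: (@le_trans _ _ (c L _ U)%:R%:E).
  apply: ereal_inf_lbound; exists L, (fun v => #|bond A v|), U; split => //.
  exact/(tt_represents_coef phi b_gt0 UA).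
by rewrite lee_fin ler_nat (cE _ _ _ _ _ UA).
Qed.

Lemma has_cost_family (cost : automaton (R := R) -> (nat -> nat) -> nat -> nat)
    (Phi : nat -> set LD) :
  (exists a : nat -> nat -> nat -> R, forall (i : 'I_b) (n : 'I_d), \forall x \ae leb01 R,
    phi n (step1 b i x) = \sum_(q < d) a i n q * phi q x) ->
  cost = @full_cost R \/ cost = @sparse_cost R ->
  (forall n f, Phi n f <-> exists L, has_cost b phi cost n L f) -> approx_family Phi.
Proof.
move=> dil hc PhiE.
have mono m n : (m <= n)%N -> Phi m `<=` Phi n.
  move=> mn f /PhiE[L [A [A0 AN Am fA]]]; apply/PhiE; exists L, A; split => //.
  exact: leq_trans mn.
have Phi0 n : Phi n 0.
  apply: (mono 0%N) => //; apply/PhiE; exists 1%N.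
  by case: hc => ->; [|apply: has_cost_sparse]; exact: has_cost_full0.
split => //.
- apply/seteqP; split => f /=; last by move=> ->.
  move=> /PhiE[L fL]; apply/eqP; apply: contrapT => /negP f0.
  have : has_cost b phi (@sparse_cost R) 0 L f.
    by case: hc fL => ->; [exact: has_cost_sparse|].
  move=> /(has_cost_levels b_gt0 f0); rewrite leqn0 muln_eq0/=.
  by rewrite gtn_eqF.
- move=> n c f /PhiE[L fL]; apply/PhiE; exists L; apply: has_costZ => //.
  by case: hc => -> A m N; [exact: leqnn|exact: sparse_cost_scale].
- exists ((2 * (b + d)).+1 * (2 * lift_const b D d))%N => n f g Pf Pg.
  have le_n : (n <= (2 * (b + d)).+1 * (2 * lift_const b D d) * n)%N by rewrite leq_pmull.
  (* Zero summands are split off, since their number of levels is not bounded by their cost. *)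
  have [->|f0] := eqVneq f 0; first by rewrite add0r; exact: mono Pg.
  have [->|g0] := eqVneq g 0; first by rewrite addr0; exact: mono Pf.
  move: Pf Pg => /PhiE[L fL] /PhiE[L' gL']; apply/PhiE.
  exact: has_costD fL gL'.
Qed.

End tensor_train_families.

Theorem theorem4p12 (R : realType) (b D : nat) (p q : \bar R) (alpha : R)
    (S : set (L0 (leb01 R))) (d : nat) (phi : 'I_d -> L0 (leb01 R)) :
  (2 <= b)%N -> (1 <= D)%N ->
  (0 < p)%E -> (0 < q)%E -> 0 < alpha ->
  S `<=` Lp (leb01 R) p ->
  submod_closed (mem S) ->
  is_basis S phi ->
  dilation_closed b S ->
  [/\ quasi_banach (classF b D phi S p alpha q) (normF b D phi S p alpha q),
      quasi_banach (classS b D phi S p alpha q) (normS b D phi S p alpha q),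
      continuous_embedding
        (classF b D phi S p alpha q) (normF b D phi S p alpha q)
        (classS b D phi S p alpha q) (normS b D phi S p alpha q)
    & continuous_embedding
        (classS b D phi S p alpha q) (normS b D phi S p alpha q)
        (classF b D phi S p (alpha / 2) q) (normF b D phi S p (alpha / 2) q)].

Proof.
move=> b2 D_gt0 p0 q0 alpha0 _ _ basis dil.
have b_gt0 : (0 < b)%N by exact: ltnW.
have Sphi n : S (phi n) by exact: basis_mem basis.
have phi_dil := basis_dilation basis dil.
have PhiFE n f : PhiF b phi S n f <-> exists L, has_cost b phi (@full_cost R) n L f.
  by apply: Phi_complP => // L r U A e UA; exact: tt_complF_cost UA.
have PhiSE n f : PhiS b phi S n f <-> exists L, has_cost b phi (@sparse_cost R) n L f.
  by apply: Phi_complP => // L r U A e UA; exact: tt_complS_cost UA.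
have famF : approx_family (PhiF b phi S : nat -> set (L0 (cube R D))).
  by apply: (has_cost_family b_gt0 D_gt0 phi_dil (or_introl erefl)).
have famS : approx_family (PhiS b phi S : nat -> set (L0 (cube R D))).
  by apply: (has_cost_family b_gt0 D_gt0 phi_dil (or_intror erefl)).
have mu0 : (0 < cube R D setT)%E by rewrite probability_setT.
have [K K0 NK] := LpnormD mu0 p0.
have NZ := fun (a : R) (f : L0 (cube R D)) => LpnormZ a f mu0 p0.
have N0 (f : L0 (cube R D)) : (0 <= Lpnorm (cube R D) p f)%E by exact: Lnorm_ge0.
have Neq0 (f : L0 (cube R D)) := @Lpnorm_eq0 _ _ _ _ p f p0.
have Ncomplete := fun u => @Lpnorm_complete _ _ _ (cube R D) p u mu0 p0.
split.
- exact: (approx_quasi_banach N0 Neq0 NZ K0 NK Ncomplete famF (ltW alpha0) q0).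
- exact: (approx_quasi_banach N0 Neq0 NZ K0 NK Ncomplete famS (ltW alpha0) q0).
- apply: approx_embedding_sub => // n f /PhiFE[L fL].
  by apply/PhiSE; exists L; exact: has_cost_sparse.
- apply: (approx_embedding_sqr N0 (c := (b + d)%N)) => //;
    [exact: ltW|exact: approx_familyS famF|].
  move=> n f /PhiSE[L fL]; apply/PhiFE.
  (* Pruning a train of the zero function could empty its last bond, so zero is placed in the family
     directly. *)
  have [->|f0] := eqVneq f 0; last by exists L; exact: has_cost_full.
  apply/PhiFE; apply: (approx_familyS famF (leq0n _)).
  by rewrite (approx_family0 famF).
Qed.
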